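(* Let $d\ge 1$, $q_1,\dots,q_d$ be positive integers, $\Gamma=q_1\mathbb{Z}\oplus\cdots\oplus q_d\mathbb{Z}$ and $Q=q_1q_2\cdots q_d$. Let $X_e$ be the set of all complex-valued $\Gamma$-periodic functions $V$ on $\mathbb{Z}^d$ such that $\sum_{n\in W}V(n)=0$ and there exists an entire function $f_V:\mathbb{C}^d\to\mathbb{C}$ with $(k,f_V(k))\in B(\Delta+V)$ for all $k\in\mathbb{C}^d$. Let $\sim$ be the equivalence relation of Floquet isospectrality. Then $$\#\{X_e/\sim\}=Q\qquad\text{and}\qquad \#\{X_e\}\le Q\,Q!.$$
   Context: A function $V:\mathbb{Z}^d\to\mathbb{C}$ is $\Gamma$-periodic if $V(n+\gamma)=V(n)$ for all $n\in\mathbb{Z}^d$, $\gamma\in\Gamma$. The discrete Laplacian is $(\Delta u)(n)=\sum_{\|n'-n\|_1=1}u(n')$, where $\|n'-n\|_1=\sum_{l=1}^d|n_l-n'_l|$. Let $W=\{n=(n_1,\dots,n_d)\in\mathbb{Z}^d: 0\le n_j\le q_j-1,\ j=1,\dots,d\}$. Let $\mathbf{e}_j$ be the standard basis of $\mathbb{Z}^d$. For $k=(k_1,\dots,k_d)\in\mathbb{C}^d$, $D_V(k)$ is the $Q\times Q$ matrix representing $\Delta+V$ acting on the $Q$-dimensional space of functions $u:\mathbb{Z}^d\to\mathbb{C}$ satisfying the Floquet-Bloch condition $u(n+q_j\mathbf{e}_j)=e^{2\pi i k_j}u(n)$ for all $n\in\mathbb{Z}^d$, $j=1,\dots,d$,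 where $u$ is identified with its values $\{u(n)\}_{n\in W}$. The Bloch variety is $B(\Delta+V)=\{(k,\lambda)\in\mathbb{C}^d\times\mathbb{C}:\det(D_V(k)-\lambda I)=0\}$. Two $\Gamma$-periodic functions $V,Y$ are Floquet isospectral, written $V\sim Y$, if $\sigma(D_V(k))=\sigma(D_Y(k))$ for all $k\in\mathbb{R}^d$, where $\sigma$ denotes the multiset of eigenvalues counted with algebraic multiplicity. $\#$ denotes cardinality. *)

(* Defs.v *)
From mathcomp Require Import all_boot all_order all_algebra.
From mathcomp Require Import all_classical all_reals all_analysis.
From mathcomp Require Import complex.

Set Implicit Arguments.
Unset Strict Implicit.
Unset Printing Implicit Defensive.

Import Order.TTheory GRing.Theory Num.Theory.
Import numFieldNormedType.Exports.

Local Open Scope classical_set_scope.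
Local Open Scope ring_scope.
Local Open Scope complex_scope.

Definition cexp (R : realType) (z : R[i]) : R[i] :=
  (expR (complex.Re z))%:C * (cos (complex.Im z) +i* sin (complex.Im z)).

Definition entire (R : realType) (d : nat) (f : 'rV[R[i]]_d -> R[i]) : Prop :=
  forall k, differentiable (f : 'rV[R[i]]_d -> (R[i])^o) k.

Section Lattice.
Context (d : nat).
Implicit Types n : 'rV[int]_d.

Definition e_ (j : 'I_d) : 'rV[int]_d := delta_mx 0 j.

Definition norm1 n : int := \sum_(l < d) `|n 0 l|.

Context (R : realType).
Implicit Types u V : 'rV[int]_d -> R[i].

(* The sphere is finite, so this is a plain sum; see laplacianE. *)
Definition laplacian u n : R[i] :=
  \sum_(n' \in [set n' : 'rV[int]_d | norm1 (n' - n) = 1]) u n'.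

Lemma norm1_eq1 n : norm1 n = 1 <-> exists j, n = e_ j \/ n = - e_ j.
Proof.
split=> [n1|[j nE]]; last first.
  rewrite /norm1 (bigD1 j)//= big1 => [|l /negPf lj].
    by case: nE => ->; rewrite !mxE !eqxx.
  by case: nE => ->; rewrite !mxE lj andbF ?oppr0 normr0.
have [j nj0] : exists j, n 0 j != 0.
  apply/existsP; apply: contra_eqT n1; rewrite negb_exists => /forallP n0.
  by rewrite /norm1 big1 // => l _; have := n0 l; rewrite negbK => /eqP ->.
have rest_ge0 : 0 <= \sum_(l < d | l != j) `|n 0 l| by apply: sumr_ge0.
have nj1 : 1 <= `|n 0 j| by rewrite -gtz0_ge1 normr_gt0.
move: n1; rewrite /norm1 (bigD1 j)//= => n1.
have nj : `|n 0 j| = 1 by apply/eqP; rewrite eq_le nj1 andbT -n1 lerDl.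
have n0 l : l != j -> n 0 l = 0.
  have rest0 : \sum_(l < d | l != j) `|n 0 l| = 0.
    by apply: (addrI `|n 0 j|); rewrite n1 nj addr0.
  move=> lj; apply/eqP; rewrite -normr_eq0.
  by move/psumr_eq0P: rest0 => -> //.
have nE (s : int) : n 0 j = s -> n = s *: e_ j.
  move=> njs; apply/rowP => l; rewrite !mxE eqxx /=.
  by have [->|/n0 ->] := eqVneq l j; rewrite ?njs ?mulr1 ?mulr0.
exists j; move/eqP: nj; rewrite eqr_norml ler01 andbT => /orP[]/eqP/nE ->.
  by left; rewrite scale1r.
by right; rewrite scaleN1r.
Qed.

Lemma laplacianE u n :
  laplacian u n = \sum_(j < d) (u (n + e_ j) + u (n - e_ j)).
Proof.
pose r := [seq n + e_ j | j <- enum 'I_d] ++ [seq n - e_ j | j <- enum 'I_d].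
have e_inj : injective e_.
  move=> i j /rowP/(_ i); rewrite !mxE !eqxx /=.
  by have [->|] := eqVneq i j.
have uniq_r : uniq r.
  have addI : injective (fun j => n + e_ j) by move=> i j /addrI/e_inj.
  have subI : injective (fun j => n - e_ j).
    by move=> i j /addrI/oppr_inj/e_inj.
  rewrite cat_uniq !map_inj_uniq -?enumT ?(enum_uniq, andbT) //.
  apply/hasPn => _ /mapP[j _ ->]; apply/mapP => -[i _] /addrI /rowP/(_ j).
  by rewrite !mxE !eqxx /=; case: eqP.
rewrite /laplacian (_ : [set n' | _] = [set` r]); last first.
  apply/seteqP; split=> [m /norm1_eq1[j mE]|m] /=.
    rewrite mem_cat; apply/orP; case: mE => mE; [left|right]; apply/mapP;
      by exists j; rewrite ?mem_enum// -mE addrC subrK.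
  rewrite mem_cat => /orP[] /mapP[j _ ->]; apply/norm1_eq1; exists j;
    rewrite addrC addKr; [by left|by right].
by rewrite -fsbig_seq// big_cat !big_map -!enumT !big_enum big_split.
Qed.

Definition schroedinger V u n : R[i] := laplacian u n + V n * u n.

End Lattice.

Section Floquet.
Context (d : nat) (q : 'I_d -> nat).

Definition period_lattice : set 'rV[int]_d :=
  [set g | exists a : 'rV[int]_d, g = \row_j ((q j)%:Z * a 0 j)].

(* The fundamental cell W, as a finite type together with its embedding. *)
Definition cell : finType := {dffun forall j : 'I_d, 'I_(q j)}.

Definition cell_pt (w : cell) : 'rV[int]_d := \row_j (w j : nat)%:Z.

Lemma card_cell : #|{: cell}| = (\prod_(j < d) q j)%N.
Proof. by rewrite card_dep_ffun foldrE big_map big_enum; under eq_bigr do rewrite card_ord. Qed.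

Lemma cell_ptP (n : 'rV[int]_d) :
  (exists w, n = cell_pt w) <-> (forall j, 0 <= n 0 j <= (q j)%:Z - 1).
Proof.
split=> [[w ->] j|W_n].
  by rewrite mxE lez_nat leq0n /= lerBrDr -PoszD lez_nat addn1.
have lt_nq j : (absz (n 0%R j) < q j)%N.
  by have /andP[n0 n1] := W_n j; rewrite -ltz_nat gez0_abs// -lezD1 -lerBrDr.
exists (finfun (fun j => Ordinal (lt_nq j)) : cell).
by apply/rowP => j; rewrite mxE ffunE/= gez0_abs//; have /andP[] := W_n j.
Qed.

Lemma cell_pt_inj : injective cell_pt.
Proof.
move=> v w /rowP vw; apply/ffunP => j; apply/val_inj.
by have := vw j; rewrite !mxE => -[].
Qed.

Context (R : realType).
Implicit Types (u V Y : 'rV[int]_d -> R[i]) (k : 'rV[R[i]]_d).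

Definition periodic V : Prop :=
  forall n g, period_lattice g -> V (n + g) = V n.

Definition phase k (j : 'I_d) : R[i] := cexp (2 * pi%:C * 'i%C * k 0 j).

Definition floquet_bloch k u : Prop :=
  forall n j, u (n + (q j)%:Z *: e_ j) = phase k j * u n.

(* The Floquet-Bloch function whose restriction to the cell is the indicator
   of w; see bloch_basisP, bloch_basis_cell and bloch_basis_span. *)
Definition bloch_basis k (w : cell) (n : 'rV[int]_d) : R[i] :=
  \prod_(j < d) if (n 0%R j %% (q j)%:Z)%Z == (w j : nat)%:Z
                then phase k j ^ (n 0%R j %/ (q j)%:Z)%Z else 0.

(* The matrix of the operator in the basis (bloch_basis k w)_w, i.e. in the
   coordinates u |-> (u (cell_pt w))_w; see floquet_mxP. *)
Definition floquet_mx V k : 'M[R[i]]_#|{: cell}| :=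
  \matrix_(a, b) schroedinger V (bloch_basis k (enum_val b))
                              (cell_pt (enum_val a)).

Lemma phase_neq0 k j : phase k j != 0.
Proof.
rewrite /phase /cexp mulf_neq0 //.
  by rewrite eq_complex /= negb_and gt_eqF ?expR_gt0.
apply/eqP => -[c0 s0]; have := cos2Dsin2 (complex.Im (2 * pi%:C * 'i%C * k 0 j)).
by rewrite c0 s0 !expr0n addr0 => /esym/eqP; rewrite oner_eq0.
Qed.

Lemma bloch_basisP k w : (forall j, (0 < q j)%N) ->
  floquet_bloch k (bloch_basis k w).
Proof.
move=> q_gt0 n j; rewrite /bloch_basis (bigD1 j)//= [in RHS](bigD1 j)//= mulrA.
congr (_ * _); last first.
  apply: eq_bigr => i /negPf ij.
  by rewrite !mxE eqxx ij /= mulr0 addr0.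
have qj0 : (q j)%:Z != 0 by rewrite eqz_nat -lt0n.
rewrite !mxE !eqxx mulr1 modzDr divzDr ?dvdzz// divzz qj0.
case: ifP => _; last by rewrite mulr0.
by rewrite exprzDr ?expr1z 1?mulrC// unitfE phase_neq0.
Qed.

Lemma bloch_basis_cell k v w : bloch_basis k w (cell_pt v) = (v == w)%:R.
Proof.
rewrite /bloch_basis; case: eqVneq => [->|vw].
  rewrite big1 // => j _; rewrite !mxE modz_small ?eqxx ?divz_small ?expr0z//.
  - by rewrite lez_nat ltz_nat ltn_ord.
  - by rewrite lez_nat ltz_nat ltn_ord.
have [j vwj] : exists j, v j != w j.
  apply/existsP; apply: contra_neqT vw; rewrite negb_exists => /forallP vw.
  by apply/ffunP => j; apply/eqP; have := vw j; rewrite negbK.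
rewrite (bigD1 j)//= !mxE modz_small ?lez_nat ?ltz_nat ?ltn_ord//.
by rewrite eqz_nat val_eqE (negPf vwj) mul0r.
Qed.

Lemma bloch_basis_span k u n : (forall j, (0 < q j)%N) -> floquet_bloch k u ->
  u n = \sum_w u (cell_pt w) * bloch_basis k w n.
Proof.
move=> q_gt0 u_bloch.
have shift v : floquet_bloch k v -> forall j (m : int) p,
    v (p + (m * (q j)%:Z) *: e_ j) = phase k j ^ m * v p.
  move=> v_bloch j m p; elim: m p => [|m IH|m IH] p.
  - by rewrite mul0r scale0r addr0 expr0z mul1r.
  - rewrite intS [1 + _]addrC mulrDl mul1r scalerDl addrA v_bloch IH mulrA.
    by rewrite exprzDr ?unitfE ?phase_neq0// expr1z [_ ^ _ * _]mulrC.
  - apply: (mulfI (phase_neq0 k j)); rewrite -v_bloch -addrA -scalerDl.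
    rewrite -{2}(mul1r (q j)%:Z) -mulrDl intS opprD [-1 + _]addrC subrK IH.
    have -> : phase k j ^ (- m%:Z) = phase k j * phase k j ^ (- m%:Z - 1).
      rewrite -{2}[phase k j]expr1z -exprzDr ?unitfE ?phase_neq0//.
      by rewrite addrC subrK.
    by rewrite mulrA.
have shifts v : floquet_bloch k v -> forall (m : 'I_d -> int) p (r : seq 'I_d),
    v (p + \sum_(j <- r) (m j * (q j)%:Z) *: e_ j) =
    (\prod_(j <- r) phase k j ^ m j) * v p.
  move=> v_bloch m p; elim=> [|j r IH]; first by rewrite !big_nil addr0 mul1r.
  rewrite !big_cons [X in p + X]addrC addrA shift// IH.
  by rewrite mulrA.
pose m j := (n 0%R j %/ (q j)%:Z)%Z.
have qj0 j : (q j)%:Z != 0 by rewrite eqz_nat -lt0n.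
have [w nE] : exists w, n = cell_pt w + \sum_(j < d) (m j * (q j)%:Z) *: e_ j.
  have [|w wE] := (cell_ptP (\row_j (n 0%R j %% (q j)%:Z)%Z)).2.
    by move=> j; rewrite mxE modz_ge0//= -ltzD1 subrK ltz_pmod// ltz_nat.
  exists w; rewrite -wE; apply/rowP => j; rewrite !mxE summxE (bigD1 j)//=.
  rewrite big1 ?addr0 => [|l /negPf lj].
    by rewrite !mxE !eqxx mulr1 addrC -divz_eq.
  by rewrite !mxE eq_sym lj andbF mulr0.
have valE v : floquet_bloch k v ->
    v n = (\prod_(j < d) phase k j ^ m j) * v (cell_pt w).
  by move=> v_bloch; rewrite {1}nE shifts.
rewrite (bigD1 w)//= big1 => [|v /negPf vw].
  rewrite (valE _ (bloch_basisP k w q_gt0)) bloch_basis_cell eqxx mulr1 addr0.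
  by rewrite mulrC (valE u u_bloch).
rewrite (valE _ (bloch_basisP k v q_gt0)) bloch_basis_cell.
by rewrite eq_sym vw !mulr0.
Qed.

Lemma floquet_mxP V k u : (forall j, (0 < q j)%N) -> floquet_bloch k u ->
  floquet_mx V k *m (\col_a u (cell_pt (enum_val a))) =
  \col_a schroedinger V u (cell_pt (enum_val a)).
Proof.
move=> q_gt0 u_bloch; apply/colP => a; rewrite !mxE.
set x := cell_pt _.
have -> : schroedinger V u x =
    \sum_w u (cell_pt w) * schroedinger V (bloch_basis k w) x.
  have uE n := bloch_basis_span n q_gt0 u_bloch.
  rewrite /schroedinger [u x]uE laplacianE.
  under eq_bigr => j _ do rewrite (uE (x + _)) (uE (x - _)) -big_split.
  rewrite exchange_big /= mulr_sumr -big_split /=; apply: eq_bigr => w _.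
  rewrite laplacianE mulrDr mulr_sumr mulrCA; congr (_ + _).
  by apply: eq_bigr => j _; rewrite mulrDr.
rewrite [RHS](reindex (@enum_val cell predT)) /=; last first.
  exact/onW_bij/enum_val_bij.
by apply: eq_bigr => b _; rewrite !mxE mulrC.
Qed.

Lemma schroedinger_bloch V k u : periodic V -> floquet_bloch k u ->
  floquet_bloch k (schroedinger V u).
Proof.
move=> V_per u_bloch n j; rewrite /schroedinger V_per; last first.
  exists (e_ j); apply/rowP => l; rewrite !mxE.
  by have [->|_] := eqVneq l j; rewrite ?andbF ?mulr0.
rewrite u_bloch !laplacianE mulrDr mulr_sumr mulrCA; congr (_ + _).
by apply: eq_bigr => l _; rewrite mulrDr -!u_bloch ![_ + _ *: _ + _]addrAC.
Qed.

Definition bloch_variety V : set ('rV[R[i]]_d * R[i]) :=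
  [set kl | \det (floquet_mx V kl.1 - kl.2%:M) = 0].

(* A multiset is encoded by its multiplicity function. *)
Definition spectrum (m : nat) (A : 'M[R[i]]_m) : R[i] -> nat :=
  fun z => mup z (char_poly A).

Definition floquet_isospectral V Y : Prop :=
  forall k : 'rV[R]_d,
    spectrum (floquet_mx V (map_mx (real_complex R) k)) =
    spectrum (floquet_mx Y (map_mx (real_complex R) k)).

Definition X_e : set ('rV[int]_d -> R[i]) :=
  [set V | [/\ periodic V,
               \sum_(w : cell) V (cell_pt w) = 0
             & exists f : 'rV[R[i]]_d -> R[i],
                 entire f /\ forall k, bloch_variety V (k, f k)]].

End Floquet.

Definition quotient_set (T : Type) (A : set T) (r : T -> T -> Prop) :
  set (set T) :=
  [set A `&` [set y | r x y] | x in A].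

(* Main.v *)
(**
  In the variables w_j = e^{2 pi i k_j / q_j}, a discrete Fourier transform in
  direction j turns D_V(k) into a bounded perturbation of the diagonal matrix
  with entries om^l w_j + om^-l / w_j, where om is a primitive q_j-th root of
  unity.  Hence an entire section f grows like om^l w_j at one end of the
  k_j-cylinder and like om^l' / w_j at the other, and Liouville's theorem gives
  f = sum_j (a_j w_j + b_j / w_j) + c with a_j, b_j roots of unity.  Translating
  k_j by integers multiplies w_j by roots of unity and produces Q different
  eigenvalues, so f determines the characteristic polynomial of D_V(k); its
  trace shows c = 0, and the isospectrality class of V depends only, and
  injectively, on the Q possible values of (a_j b_j)_j.

  Every class is nonempty: for a separable V the claim reduces to d = 1, where
  the discriminant of V has to be a Dickson polynomial.  This is a polynomial
  system in the values of V.  The potentials in one class solve such a system as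
  well, because at a fixed k the characteristic polynomial of D_V(k) is
  prescribed.  In both systems there are n equations in n unknowns, whose leading
  forms are the elementary symmetric polynomials.  The n! staircase monomials
  then span the polynomial ring over the subalgebra generated by the equations,
  which is itself a polynomial ring; so there is a solution, and there are at
  most n! of them.
*)
From mathcomp Require Import all_boot all_order all_algebra.
From mathcomp Require mpoly ssrcomplements.
From mathcomp Require boolp.
From mathcomp Require Import fingroup perm zify ring.

Set Implicit Arguments.
Unset Strict Implicit.
Unset Printing Implicit Defensive.

(** * Polynomial systems with elementary symmetric leading forms *)

(** Entire functions are given as merely differentiable ones, with no continuity of the derivative,
    so Liouville's theorem is derived from Goursat's bisection of rectangles rather than from
    Green's formula.

    An integer shift of k_j multiplies w_j by a q_j-th root of unity and leaves D_V(k) unchanged.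
    Such shifts normalise a_j to 1 and put a_j b_j in the place of b_j, which is why only the
    products a_j b_j survive.

    The Q eigenvalues are distinct only generically. To reach every k, k is moved along a line on
    which w_j is multiplied by s^(j+1) with |s| = 1 and j counted from 0. Determinants and
    eigenvalue branches become Laurent polynomials in the single variable s, so identities may be
    checked off finitely many s, and the distinct exponents keep the d directions apart.

    For the polynomial systems, solvability means that the equations generate a proper ideal, which
    is a Nakayama argument. The bound n! arises because evaluation at the solutions factors through
    the n! coefficients of the staircase monomials. *)

Module PolySystem.
Import Order.TTheory GRing.Theory ssrcomplements mpoly.
Local Open Scope ring_scope.

(** * Reciprocals of products of linear factors *)

Section RevProd.
Variable R : comNzRingType.

Lemma size_prod_1sub (I : Type) (s : seq I) (P : pred I) (x : I -> R) :
  (size (\prod_(i <- s | P i) (1 - x i *: 'X))%R <= (count P s).+1)%N.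
Proof.
elim: s => [|a s IH]; first by rewrite big_nil size_poly1.
rewrite big_cons /=; case: (P a) => //=.
apply: (leq_trans (size_polyMleq _ _)).
have : (size (1 - x a *: 'X : {poly R})%R <= 2)%N.
  apply: (leq_trans (size_polyD _ _)); rewrite size_poly1 size_polyN geq_max /=.
  by apply: (leq_trans (size_scale_leq _ _)); rewrite size_polyX.
by move=> /leq_add/(_ IH) le2; rewrite -subn1 leq_subLR (leq_trans le2).
Qed.

(** The two products are reciprocal polynomials. The form on the left is the one that is invertible
    as a power series, with the complete homogeneous polynomials as coefficients of the inverse. *)
Lemma coef_prod_1sub (s : seq R) i : (i <= size s)%N ->
  (\prod_(x <- s) (1 - x *: 'X))`_i = (\prod_(x <- s) ('X - x%:P))`_(size s - i).
Proof.
elim: s i => [|x s IH] i; first by rewrite leqn0 => /eqP ->; rewrite !big_nil.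
rewrite !big_cons /= => le_i.
rewrite !mulrBl mul1r !coefB coefXM coefCM -scalerAl coefZ coefXM.
have sz1 : (size (\prod_(x <- s) (1 - x *: 'X))%R <= (size s).+1)%N.
  by apply: (leq_trans (size_prod_1sub _ _ _)); rewrite count_predT.
have sz2 : size (\prod_(x <- s) ('X - x%:P))%R = (size s).+1.
  exact: size_prod_XsubC.
case: i le_i => [_|i le_i] /=.
  rewrite subn0 /= mulr0 subr0 IH // subn0.
  by rewrite [in X in _ - X]nth_default ?sz2 // mulr0 subr0.
rewrite subSS; move: le_i; rewrite ltnS leq_eqVlt => /orP[/eqP->|lt_i].
  rewrite subnn /= [in LHS]nth_default ?sz1 // IH // subnn.
  by rewrite sub0r.
rewrite !IH ?(ltnW lt_i) //; have -> : (size s - i == 0)%N = false by lia.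
by have -> : ((size s - i).-1 = size s - i.+1)%N by lia.
Qed.

End RevProd.

(** * The monomial order and total degree *)

Section Degree.
Variables (n : nat) (K : idomainType).
Local Notation A := {mpoly K[n]}.
Implicit Types (f g : A) (m : 'X_{1..n}).

(** The order on monomials compares total degrees first ([lt_mdeg_ltmc]), so a degree bound is
    enough to be below; it is the order of the induction in [spanned_all]. *)
Definition below m f := forall k, k \in msupp f -> (k < m)%O.

Lemma below0 m : below m 0. Proof. by move=> k; rewrite msupp0. Qed.

Lemma belowD m f g : below m f -> below m g -> below m (f + g).
Proof. by move=> bf bg k /msuppD_le; rewrite mem_cat => /orP[/bf|/bg]. Qed.

Lemma belowN m f : below m f -> below m (- f).
Proof. by move=> bf k; rewrite (perm_mem (msuppN f)); apply: bf. Qed.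

Lemma below_sum m (I : Type) (r : seq I) (P : pred I) (F : I -> A) :
  (forall i, P i -> below m (F i)) -> below m (\sum_(i <- r | P i) F i).
Proof. by move=> bF; apply: big_ind => //; [apply: below0 | apply: belowD]. Qed.

Lemma below_mulX m m' f : below m f -> below (m' + m)%MM ('X_[m'] * f).
Proof.
move=> bf k; rewrite mulrC => k_f.
have := k_f; rewrite (perm_mem (msuppMX _ _)) => /mapP[k' k'f ->].
by rewrite ltmc_add2r; apply: bf.
Qed.

Lemma below_msize m f : (msize f <= mdeg m)%N -> below m f.
Proof. by move=> sf k /msize_mdeg_lt lt_k; apply: lt_mdeg_ltmc; apply: leq_trans lt_k sf. Qed.

(** [msize] is the degree plus one, and 0 for the zero polynomial; hence the predecessor here and in
    [tdeg_ltM]. *)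
Lemma msizeM_leq a b f g : (msize f <= a)%N -> (msize g <= b)%N ->
  (msize (f * g) <= (a + b).-1)%N.
Proof.
move=> fa gb; have [->|f0] := eqVneq f 0; first by rewrite mul0r mmeasure0.
have [->|g0] := eqVneq g 0; first by rewrite mulr0 mmeasure0.
by rewrite msizeM // -!subn1 leq_sub2r // leq_add.
Qed.

Lemma msizeD_leq a f g : (msize f <= a)%N -> (msize g <= a)%N ->
  (msize (f + g) <= a)%N.
Proof. by move=> fa ga; apply: (leq_trans (mmeasureD_le _ _ _)); rewrite geq_max fa. Qed.

Lemma msize_sum_leq a (I : Type) (r : seq I) (P : pred I) (F : I -> A) :
  (forall i, P i -> (msize (F i) <= a)%N) ->
  (msize (\sum_(i <- r | P i) F i)%R <= a)%N.
Proof.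
move=> bF; apply: (big_ind (fun f => (msize f <= a)%N)) => //.
  by rewrite mmeasure0.
exact: msizeD_leq.
Qed.

(* [f] has total degree < N, the indeterminate of the outer polynomials
   counting as degree 1. *)
Definition tdeg_lt N (f : {poly A}) := forall i, (msize f`_i <= N - i)%N.

Lemma tdeg_ltW N M (f : {poly A}) : (N <= M)%N -> tdeg_lt N f -> tdeg_lt M f.
Proof. by move=> le_NM tf i; apply: (leq_trans (tf i)); apply: leq_sub2r. Qed.

Lemma tdeg_ltD N (f g : {poly A}) : tdeg_lt N f -> tdeg_lt N g -> tdeg_lt N (f + g).
Proof. by move=> tf tg i; rewrite coefD; apply: msizeD_leq. Qed.

Lemma tdeg_ltN N (f : {poly A}) : tdeg_lt N f -> tdeg_lt N (- f).
Proof. by move=> tf i; rewrite coefN mmeasureN. Qed.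

Lemma tdeg_ltB N (f g : {poly A}) : tdeg_lt N f -> tdeg_lt N g -> tdeg_lt N (f - g).
Proof. by move=> tf tg; apply: tdeg_ltD => //; apply: tdeg_ltN. Qed.

Lemma tdeg_lt0 N : tdeg_lt N 0.
Proof. by move=> i; rewrite coef0 mmeasure0. Qed.

Lemma tdeg_lt_sum N (I : Type) (r : seq I) (P : pred I) (F : I -> {poly A}) :
  (forall i, P i -> tdeg_lt N (F i)) -> tdeg_lt N (\sum_(i <- r | P i) F i).
Proof. by move=> tF; apply: big_ind => //; [apply: tdeg_lt0 | apply: tdeg_ltD]. Qed.

Lemma tdeg_lt1 : tdeg_lt 1 1.
Proof. by case=> [|i]; rewrite coef1 /= ?mulr1n ?mulr0n ?msize1 ?mmeasure0. Qed.

Lemma tdeg_ltC (c : K) : tdeg_lt 1 (c%:MP)%:P.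
Proof. by case=> [|i]; rewrite coefC /= ?mmeasureC ?mmeasure0 //; case: eqP. Qed.

Lemma tdeg_ltX : tdeg_lt 2 'X.
Proof. by case=> [|[|i]]; rewrite coefX /= ?mmeasure0 ?msize1. Qed.

Lemma tdeg_ltXi i : tdeg_lt 2 ('X_i)%:P.
Proof. by case=> [|j]; rewrite coefC /= ?mmeasure0 // msizeX mdeg1. Qed.

Lemma tdeg_ltM N M (f g : {poly A}) : tdeg_lt N f -> tdeg_lt M g -> tdeg_lt (N + M).-1 (f * g).
Proof.
move=> tf tg k; rewrite coefM; apply: msize_sum_leq => i _.
have [->|f0] := eqVneq f`_i 0; first by rewrite mul0r mmeasure0.
have [->|g0] := eqVneq g`_(k - i) 0; first by rewrite mulr0 mmeasure0.
have fi : (0 < msize f`_i)%N by rewrite lt0n mmeasure_poly_eq0.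
have gi : (0 < msize g`_(k - i))%N by rewrite lt0n mmeasure_poly_eq0.
rewrite msizeM //.
by have := tf i; have := tg (k - i)%N; have := ltn_ord i; move: fi gi; lia.
Qed.

Lemma tdeg_lt_prod (I : Type) (r : seq I) (P : pred I) (F : I -> {poly A}) :
  (forall i, P i -> tdeg_lt 2 (F i)) ->
  tdeg_lt (count P r).+1 (\prod_(i <- r | P i) F i).
Proof.
move=> tF; elim: r => [|a r IH]; first by rewrite big_nil; apply: tdeg_lt1.
rewrite big_cons /=; case: ifP => // Pa.
by have := tdeg_ltM (tF _ Pa) IH.
Qed.

End Degree.

(** * Truncated generating functions of complete homogeneous polynomials *)

Section CompleteHomogeneous.
Variables (n : nat) (K : idomainType).
Local Notation A := {mpoly K[n]}.

(* Up to order N in T, the generating function of the complete homogeneous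
   polynomials in the variables satisfying P. *)
Definition hgen N (P : pred 'I_n) : {poly A} :=
  \prod_(j < n | P j) \sum_(a < N.+1) 'X_j ^+ a *: 'X^a.

Definition isobaric (P : pred 'I_n) (f : {poly A}) :=
  forall d m, m \in msupp f`_d -> mdeg m = d /\ forall i, ~~ P i -> m i = 0%N.

Lemma isobaric_hgen N P : isobaric P (hgen N P).
Proof.
rewrite /hgen; apply: big_ind.
- move=> [|d] m; rewrite coef1 /= ?mulr0n ?msupp0 //.
  rewrite mulr1n msupp1 inE => /eqP ->; rewrite mdeg0; split=> // i _.
  exact: mnm0E.
- move=> f g hf hg d m; rewrite coefM => /msupp_sum_le /flattenP[_ /mapP[i _ ->]].
  move=> /msuppM_le /allpairsP[[u v] /= [/hf[du zu] /hg[dv zv] ->]].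
  rewrite mdegD du dv; split; first by have := ltn_ord i; lia.
  by move=> j Pj; rewrite mnmDE zu ?zv.
- move=> j Pj d m; rewrite coef_sum => /msupp_sum_le /flattenP[_ /mapP[a _ ->]].
  rewrite coefZ coefXn; case: eqP => [->|_]; last by rewrite mulr0 msupp0.
  rewrite mulr1 mpolyXn msuppX inE => /eqP ->.
  rewrite mdegMn mdeg1 mul1n; split=> // i Pi.
  rewrite mulmnE mnm1E; case: eqP => [ji|_]; last by rewrite mul0n.
  by move: Pi; rewrite -ji Pj.
Qed.

Lemma msize_hgen N P d : (msize (hgen N P)`_d <= d.+1)%N.
Proof. by rewrite msizeE; apply/bigmax_leqP_seq => m /isobaric_hgen[-> _]. Qed.

Lemma geo_telescope N (x : A) :
  (1 - x *: 'X) * (\sum_(a < N.+1) x ^+ a *: 'X^a) = 1 - x ^+ N.+1 *: 'X^(N.+1) :> {poly A}.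
Proof.
under eq_bigr do rewrite -exprZn.
by rewrite -exprZn; apply: oppr_inj; rewrite -mulNr !opprB subrX1.
Qed.

(** Each factor with [P j] cancels against its truncated geometric series up to a multiple of
    T^(N+1), and polynomials of the form 1 + T^(N+1) g are closed under products. *)
Lemma prod_1sub_hgen N (P : pred 'I_n) : exists g : {poly A},
  (\prod_(j < n) (1 - ('X_j : A) *: 'X)) * hgen N P =
  (\prod_(j < n | ~~ P j) (1 - ('X_j : A) *: 'X)) * (1 + 'X^(N.+1) * g).
Proof.
rewrite /hgen (bigID P) /= mulrAC -big_split /= mulrC.
suff [g ->] : exists g : {poly A}, \prod_(j < n | P j)
   ((1 - ('X_j : A) *: 'X) * \sum_(a < N.+1) 'X_j ^+ a *: 'X^a) = 1 + 'X^(N.+1) * g.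
  by exists g.
apply: (big_ind (fun f : {poly A} => exists g, f = 1 + 'X^(N.+1) * g)).
- by exists 0; rewrite mulr0 addr0.
- by move=> _ _ [f ->] [g ->]; exists (f + g + 'X^(N.+1) * f * g); ring.
- move=> j _; exists (- ('X_j ^+ N.+1)%:P); rewrite geo_telescope.
  by rewrite mulrN -mul_polyC mulrC.
Qed.

(** Only the k factors with index below k survive the cancellation, so up to order n the degree in T
    is at most k. This is the relation sum_i (-1)^i e_i h_(k+1-i) = 0 between the elementary
    symmetric polynomials in all variables and the complete homogeneous ones in X_k, ...,
    X_(n-1). *)
Lemma coef_prod_1sub_hgen k : (k < n)%N ->
  ((\prod_(j < n) (1 - ('X_j : A) *: 'X)) * hgen n (fun j => (k <= j)%N))`_k.+1 = 0.
Proof.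
move=> lt_kn; have [g ->] := prod_1sub_hgen n (fun j => (k <= j)%N).
rewrite mulrDr mulr1 mulrCA coefD coefXnM ltnS lt_kn addr0 nth_default //.
apply: (leq_trans (size_prod_1sub _ _ _)); rewrite ltnS.
rewrite -sum1_count -(big_mkord (fun j => ~~ (k <= j)%N) (fun=> 1%N)) /=.
rewrite (@big_cat_nat _ _ _ k) ?(ltnW lt_kn) //=.
rewrite [X in (_ + X)%N]big1_seq; last first.
  by move=> i /andP[h]; rewrite mem_index_iota => /andP[h' _]; rewrite h' in h.
rewrite addn0 sum1_count; apply: (leq_trans (count_size _ _)).
by rewrite size_iota subn0.
Qed.

(** Among the monomials of degree k+1 in X_k, ..., X_(n-1) the power of X_k is the largest. These
    polynomials are the classical Groebner basis of the ideal generated by the elementary symmetric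
    polynomials. *)
Lemma below_hgen (k : 'I_n) :
  below (U_(k) *+ k.+1)%MM ((hgen n (fun j => (k <= j)%N))`_k.+1 - 'X_k ^+ k.+1).
Proof.
have -> : hgen n (fun j : 'I_n => (k <= j)%N) =
    (\sum_(a < n.+1) 'X_k ^+ a *: 'X^a) * hgen n (fun j : 'I_n => (k < j)%N).
  rewrite /hgen (bigD1 k) //=; congr (_ * _); apply: eq_bigl => j.
  by rewrite ltn_neqAle andbC eq_sym.
(* In the expansion by powers of X_k, the term a = k+1 is X_k^(k+1) itself; for a <= k the cofactor
   has degree k+1-a in later variables only, so its monomials are smaller than X_k^(k+1-a). *)
rewrite mulr_suml coef_sum; under eq_bigr do rewrite -scalerAl coefZ coefXnM.
have ltkn : (k.+1 < n.+1)%N by rewrite ltnS.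
rewrite (bigD1 (Ordinal ltkn)) //= ltnn subnn.
have -> : (hgen n (fun j => (k < j)%N))`_0 = 1.
  rewrite /hgen coef0_prod big1 // => j _; rewrite coef_sum big_ord_recl big1 ?addr0.
    by rewrite expr0 scale1r coefXn.
  by move=> i _; rewrite coefZ coefXn /= mulr0.
rewrite mulr1 addrAC subrr add0r; apply: below_sum => a; rewrite -val_eqE /= => ne_a.
case: ltnP => [_|le_a]; first by rewrite mulr0; apply: below0.
have lt_a : (a < k.+1)%N by rewrite ltn_neqAle ne_a.
have -> : (U_(k) *+ k.+1 = U_(k) *+ a + U_(k) *+ (k.+1 - a))%MM.
  by apply/mnmP => i; rewrite mnmDE !mulmnE -mulnDr subnKC.
rewrite mpolyXn; apply: below_mulX => m /isobaric_hgen[dm zm].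
apply/ltmcP; first by rewrite dm mdegMn mdeg1 mul1n.
exists k; first by move=> i lt_ik; rewrite zm ?mulmnE ?mnm1E -?leqNgt ?(ltnW lt_ik) // (_ : (k == i) = false) //; apply/eqP => e; rewrite e ltnn in lt_ik.
by rewrite zm -?leqNgt // mulmnE mnm1E eqxx mul1n subn_gt0.
Qed.

End CompleteHomogeneous.

Lemma sum_ord_ltn n k : (k <= n)%N -> (\sum_(i < n) (i < k))%N = k.
Proof.
move/subnKC; move: (n - k)%N => b <-; rewrite big_split_ord /=.
rewrite [X in (_ + X)%N]big1 ?addn0; last by move=> j _; rewrite ltnNge leq_addr.
by rewrite (eq_bigr (fun=> 1%N)) ?sum1_card ?card_ord // => j _; rewrite ltn_ord.
Qed.

(** * Staircase monomials over the algebra generated by the equations *)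

Section System.
Variables (n : nat) (K : fieldType).
Local Notation A := {mpoly K[n]}.

(** Up to sign the elementary symmetric polynomial of degree n - i ([esp_mesym]), indexed as a
    coefficient because the systems are read off monic polynomials. As [msize] is the degree plus
    one, [p_esp] says that [p i] and [esp i] differ by terms of degree below n - i. *)
Definition esp (i : nat) : A := (\prod_(j < n) ('X - ('X_j : A)%:P))`_i.

Variable p : 'I_n -> A.
Hypothesis p_esp : forall i, (msize (p i - esp i) <= n - i)%N.

Let P := [tuple p i | i < n].

Let tnthP i : tnth P i = p i.
Proof. by rewrite tnth_mktuple. Qed.

Lemma esp_mesym k : (k <= n)%N -> esp (n - k) = (-1) ^+ k * mesym n K k.
Proof.
move=> le_kn; have lt_k : (k < n.+1)%N by [].
have := mroots_coeff [tuple ('X_j : A) | j < n] (Ordinal lt_k).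
rewrite /= big_map big_enum => /= eq_e.
rewrite /esp eq_e; congr (_ * _).
rewrite !mesymE raddf_sum /=; apply: eq_bigr => h _.
by rewrite mevalX mpolyXE_id; apply: eq_bigr => i _; rewrite tnth_mktuple.
Qed.

Lemma coef_prod_1sub_esp i : (i <= n)%N ->
  (\prod_(j < n) (1 - ('X_j : A) *: 'X))`_i = esp (n - i).
Proof.
move=> le_in; have := @coef_prod_1sub _ [seq ('X_j : A) | j <- enum 'I_n] i.
by rewrite !big_map -enumT !big_enum size_map size_enum_ord => ->.
Qed.

Lemma esp_n : esp n = 1.
Proof. by rewrite -[X in esp X]subn0 esp_mesym // mesym0E mulr1. Qed.

Lemma mlead_esp k : (k <= n)%N -> mlead (esp (n - k)) = [multinom (i < k : nat) | i < n].
Proof. by move=> le_kn; rewrite esp_mesym // -signr_odd mulr_sign; case: odd; rewrite ?mleadN mlead_mesym. Qed.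

Lemma esp_neq0 k : (k <= n)%N -> esp (n - k) != 0.
Proof. by move=> le_kn; rewrite esp_mesym // mulf_neq0 ?signr_eq0 // mesym_neq0. Qed.

Lemma mdeg_mlead_esp (i : 'I_n) : mdeg (mlead (esp i)) = (n - i)%N.
Proof.
rewrite -(subKn (ltnW (ltn_ord i))) mlead_esp ?leq_subr // mdegE.
under eq_bigr do rewrite mnmE.
by rewrite sum_ord_ltn ?leq_subr // (subKn (leq_subr i n)).
Qed.

Lemma mlead_sys i : mlead (p i) = mlead (esp i) /\ p i != 0.
Proof.
have e0 : esp i != 0 by rewrite -(subKn (ltnW (ltn_ord i))) esp_neq0 ?leq_subr.
have -> : p i = (p i - esp i) + esp i by rewrite subrK.
have [->|d0] := eqVneq (p i - esp i) 0; first by rewrite add0r.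
have lt_lead : (mlead (p i - esp i) < mlead (esp i))%O.
  apply: lt_mdeg_ltmc; rewrite mdeg_mlead_esp.
  by apply: leq_trans (p_esp i); rewrite -mlead_deg.
split; first exact: mleadDr.
by rewrite addr_eq0; apply: contraTneq lt_lead => ->; rewrite mleadN ltxx.
Qed.

Let mlead_monom m :
  mlead ('X_[m] \mPo P) = [multinom \sum_(i < n | (j < n - i)%N) m i | j < n].
Proof.
rewrite comp_mpolyX mlead_prod /=; last first.
  by move=> i _ _; rewrite tnthP expf_neq0 // (mlead_sys i).2.
apply/mnmP => j; rewrite mnm_sumE mnmE [RHS]big_mkcond /=; apply: eq_bigr => i _.
rewrite tnthP mleadX ?(mlead_sys i).2 // (mlead_sys i).1 mulmnE.
rewrite -{1}(subKn (ltnW (ltn_ord i))) mlead_esp ?leq_subr // mnmE.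
by case: (_ < _)%N; rewrite ?mul1n ?mul0n.
Qed.

Let monom_neq0 m : 'X_[m] \mPo P != 0 :> A.
Proof.
rewrite comp_mpolyX; apply/prodf_neq0 => i _.
by rewrite tnthP expf_neq0 // (mlead_sys i).2.
Qed.

(** The leading monomial of [esp i] is X_0 ... X_(n-i-1), so the exponents of the leading monomial
    are partial sums of m, and m is recovered from their differences. *)
Let mlead_monom_inj m1 m2 :
  mlead ('X_[m1] \mPo P) = mlead ('X_[m2] \mPo P) -> m1 = m2.
Proof.
rewrite !mlead_monom => /mnmP eq12.
have {}eq12 k : (k <= n)%N -> \sum_(i < n | (i < k)%N) m1 i = \sum_(i < n | (i < k)%N) m2 i.
  case: k => [|k] lt_kn; first by rewrite !big_pred0.
  have lt_j : (n - k.+1 < n)%N by lia.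
  have := eq12 (Ordinal lt_j); rewrite !mnmE /=.
  by congr (_ = _); apply: eq_bigl => i; have := ltn_ord i; lia.
apply/mnmP => i; have := eq12 i.+1 (ltn_ord i).
have split_last m : \sum_(j < n | (j < i.+1)%N) m j = (m i + \sum_(j < n | (j < i)%N) m j)%N.
  rewrite (bigD1 i) //=; congr (_ + _)%N; apply: eq_bigl => j.
  by rewrite -val_eqE /=; lia.
by rewrite !split_last eq12 ?(ltnW (ltn_ord i)) // => /addIn.
Qed.

(** Distinct monomials in the [p i] have distinct leading monomials, so the largest of them cannot
    cancel. *)
Lemma sys_alg_indep (t : A) : t \mPo P = 0 -> t = 0.
Proof.
move/eqP; apply/contraTeq=> nz_t; rewrite -mleadc_eq0.
have h m: m \in msupp t -> mlead (t@_m *: ('X_[m] \mPo P)) = mlead ('X_[m] \mPo P).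
  by move=> m_in_t; rewrite mleadZ // mcoeff_eq0 m_in_t.
rewrite comp_mpolyEX mlead_sum ?filter_predT; last first.
  rewrite (iffLR (eq_in_map _ _ _) h).
  apply/(@uniqP _ 0%MM) => i j; rewrite size_map.
  move=> lti ltj; rewrite !(nth_map 0%MM) // => /mlead_monom_inj.
  exact: (can_in_inj (nthK _ _)).
rewrite big_seq (eq_bigr _ h) -big_seq.
case: (eq_bigjoin (fun m => mlead ('X_[m] \mPo P)) _ (r := msupp t)).
  exact/le_total. by rewrite msupp_eq0.
move=> /= m m_in_t /eqP/esym lmm.
rewrite -lmm raddf_sum /= (bigD1_seq m) //= mcoeffZ.
rewrite big_seq_cond big1.
  by rewrite addr0 mulf_neq0 ?mleadc_eq0 // mcoeff_eq0 m_in_t.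
move=> /= m' /andP[m'_in_t ne_m'm]; rewrite mcoeffZ.
rewrite [X in _*X]mcoeff_gt_mlead ?mulr0 //.
rewrite lt_neqAle (contra_neq (@mlead_monom_inj _ _)) //= lmm.
exact: (joins_sup_seq (fun m => mlead ('X_[m] \mPo P))).
Qed.

(** The exponents of the monomials divisible by none of the X_k^(k+1), the leading monomials in
    [below_hgen]. *)
Definition staircase : finType := {dffun forall k : 'I_n, 'I_k.+1}.
Definition stair_mon (b : staircase) : 'X_{1..n} := [multinom (b k : nat) | k < n].

Lemma card_staircase : #|{: staircase}| = n`!.
Proof.
rewrite card_dep_ffun foldrE big_map big_enum fact_prod /=.
by rewrite big_add1 /= big_mkord; apply: eq_bigr => i _; rewrite card_ord.
Qed.

Definition spanned (f : A) := exists G : staircase -> A,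
  f = \sum_b (G b \mPo P) * 'X_[stair_mon b].

Lemma spanned0 : spanned 0.
Proof. by exists (fun=> 0); rewrite big1 // => b _; rewrite comp_mpoly0 mul0r. Qed.

Lemma spannedD f g : spanned f -> spanned g -> spanned (f + g).
Proof.
move=> [F ->] [G ->]; exists (fun b => F b + G b); rewrite -big_split.
by apply: eq_bigr => b _; rewrite comp_mpolyD mulrDl.
Qed.

Lemma spannedM t f : spanned f -> spanned ((t \mPo P) * f).
Proof.
move=> [F ->]; exists (fun b => t * F b); rewrite mulr_sumr.
by apply: eq_bigr => b _; rewrite rmorphM mulrA.
Qed.

Lemma spannedZ c f : spanned f -> spanned (c *: f).
Proof. by move/(spannedM c%:MP); rewrite comp_mpolyC mul_mpolyC. Qed.

Lemma spanned_sum (I : Type) (r : seq I) (Q : pred I) (F : I -> A) :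
  (forall i, Q i -> spanned (F i)) -> spanned (\sum_(i <- r | Q i) F i).
Proof. by move=> sF; apply: big_ind => //; [apply: spanned0 | apply: spannedD]. Qed.

Lemma spanned_stair b : spanned 'X_[stair_mon b].
Proof.
exists (fun c => (c == b)%:R); rewrite (bigD1 b) //= eqxx comp_mpoly1 mul1r.
by rewrite big1 ?addr0 // => c /negPf->; rewrite comp_mpoly0 mul0r.
Qed.

Lemma spanned_below m : (forall k, (k < m)%O -> spanned 'X_[k]) ->
  forall f, below m f -> spanned f.
Proof.
move=> sm f bf; rewrite [f]mpolyE big_seq; apply: spanned_sum => k /bf lt_k.
exact/spannedZ/sm.
Qed.

(** A monomial outside the staircase is divisible by some X_k^(k+1). This power is traded for
    h_(k+1), which is a combination of complete homogeneous polynomials of lower degree with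
    coefficients [esp], and [esp] equals p up to lower degree. What remains to be spanned after each
    exchange lies below the given monomial. *)
Lemma spanned_all f : spanned f.
Proof.
suff sX m : spanned 'X_[m].
  by rewrite [f]mpolyE; apply: spanned_sum => m _; apply: spannedZ.
elim/(@ltmwf n): m => m IH; have sb := spanned_below IH.
have [/forallP le_m|] := boolP [forall k : 'I_n, (m k <= k)%N].
  suff -> : m = stair_mon [ffun k : 'I_n => Ordinal (le_m k : (m k < k.+1)%N)].
    exact: spanned_stair.
  by apply/mnmP => k; rewrite mnmE ffunE.
rewrite negb_forall => /existsP[k]; rewrite -ltnNge => lt_k.
pose d := (U_(k) *+ k.+1)%MM; pose m' := (m - d)%MM.
have mE : m = (m' + d)%MM.
  rewrite submK //; apply/mnm_lepP => i; rewrite mulmnE mnm1E.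
  by case: eqP => [<-|_]; rewrite ?mul1n ?mul0n.
have mdm : mdeg m = (mdeg m' + k.+1)%N by rewrite {1}mE mdegD mdegMn mdeg1 mul1n.
pose h i := (hgen K n (fun j : 'I_n => (k <= j)%N))`_i.
(* The relation of [coef_prod_1sub_hgen], solved for the term i = 0, where [esp n] is 1. *)
have hE : h k.+1 = - \sum_(i < k.+1) esp (n - i.+1) * h (k - i)%N.
  apply/eqP; rewrite -addr_eq0; apply/eqP.
  have := coef_prod_1sub_hgen K (ltn_ord k).
  rewrite coefM big_ord_recl coef_prod_1sub_esp // subn0 esp_n mul1r subn0 => hE.
  rewrite -[RHS]hE; congr (_ + _); apply: eq_bigr => i _.
  rewrite coef_prod_1sub_esp ?subSS //.
  by have := ltn_ord i; have := ltn_ord k; rewrite /= /bump /=; lia.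
have -> : 'X_[m] = - ('X_[m'] * (h k.+1 - 'X_k ^+ k.+1)) + 'X_[m'] * h k.+1 :> A.
  by rewrite {1}mE mpolyXD mpolyXn mulrBr opprB subrK.
apply: spannedD.
  by apply: sb; apply: belowN; rewrite {1}mE; apply: below_mulX; apply: below_hgen.
rewrite hE mulrN mulr_sumr -sumrN; apply: spanned_sum => i _.
have lt_i : (n - i.+1 < n)%N by have := ltn_ord k; lia.
(* The factor p is absorbed by the coefficients, which lowers the degree by i+1; the error p - [esp]
   lowers it by at least one. *)
have pE : esp (n - i.+1) = p (Ordinal lt_i) - (p (Ordinal lt_i) - esp (n - i.+1)).
  by rewrite subKr.
rewrite {}pE mulrBl mulrBr opprB addrC.
have hi : (msize ('X_[m'] * h (k - i)%N) <= (mdeg m' + (k - i)).+1)%N.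
  apply: leq_trans (msizeM_leq (leqnn _) (@msize_hgen n K n _ (k - i))) _.
    by rewrite msizeX addSn addnS.
apply: spannedD.
  have -> : - ('X_[m'] * (p (Ordinal lt_i) * h (k - i)%N)) =
      (('X_(Ordinal lt_i) : A) \mPo P) * ((-1) *: ('X_[m'] * h (k - i)%N)).
    rewrite comp_mpolyXU -tnth_nth tnthP scaleN1r mulrN; congr (- _).
    by rewrite mulrCA.
  apply: spannedM; apply: spannedZ; apply: sb; apply: below_msize.
  by apply: leq_trans hi _; rewrite mdm; have := ltn_ord i; lia.
rewrite mulrCA; apply: sb; apply: below_msize.
apply: leq_trans (msizeM_leq (p_esp _) hi) _.
by rewrite mdm /=; have := ltn_ord i; have := ltn_ord k; lia.
Qed.

End System.

(** * Ideals as predicates *)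

Section Ideal.
Variable A : comNzRingType.

Definition ideal (I : A -> Prop) :=
  [/\ I 0, forall f g, I f -> I g -> I (f + g) & forall h f, I f -> I (h * f)].

Definition adjoin (I : A -> Prop) (g f : A) := exists h, I (f - h * g).

Variable I : A -> Prop.
Hypothesis idI : ideal I.

Lemma ideal_adjoin g : ideal (adjoin I g).
Proof.
have [I0 ID IM] := idI; split; first by exists 0; rewrite mul0r subr0.
- move=> f f' [h Ih] [h' Ih']; exists (h + h').
  by rewrite mulrDl opprD addrACA; apply: ID.
- by move=> k f [h Ih]; exists (k * h); rewrite -mulrA -mulrBr; apply: IM.
Qed.

Lemma adjoin_sub g f : I f -> adjoin I g f.
Proof. by move=> If; exists 0; rewrite mul0r subr0. Qed.

Lemma adjoin_gen g : adjoin I g g.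
Proof. by exists 1; rewrite mul1r subrr; case: idI. Qed.

Lemma ideal_sum (J : Type) (r : seq J) (Q : pred J) (F : J -> A) :
  (forall i, Q i -> I (F i)) -> I (\sum_(i <- r | Q i) F i).
Proof. by have [I0 ID _] := idI; move=> IF; apply: big_ind. Qed.

Lemma idealN f : I f -> I (- f).
Proof. by have [_ _ IM] := idI; rewrite -mulN1r; apply: IM. Qed.

Lemma idealB f g : I f -> I g -> I (f - g).
Proof. by have [_ ID _] := idI; move=> If Ig; apply: ID => //; apply: idealN. Qed.

Lemma ideal_congM f f' g g' : I (f - f') -> I (g - g') -> I (f * g - f' * g').
Proof.
have [_ ID IM] := idI; move=> If Ig.
have -> : f * g - f' * g' = g * (f - f') + f' * (g - g') by ring.
by apply: ID; apply: IM.
Qed.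

Lemma ideal_cong_prod (J : Type) (r : seq J) (F G : J -> A) :
  (forall i, I (F i - G i)) -> I (\prod_(i <- r) F i - \prod_(i <- r) G i).
Proof.
move=> IFG; apply: (big_ind2 (fun f g => I (f - g))) => //; last first.
  by move=> f f' g g'; apply: ideal_congM.
by rewrite subrr; case: idI.
Qed.

Lemma ideal_congX f g k : I (f - g) -> I (f ^+ k - g ^+ k).
Proof.
move=> Ifg; elim: k => [|k IH]; first by rewrite !expr0 subrr; case: idI.
by rewrite !exprS; apply: ideal_congM.
Qed.

(** If adjoining x - l yields the unit ideal, then x - l is invertible modulo I and can be cancelled
    from the product; cancelling every factor would put 1 in I. *)
Lemma adjoin_proper (x : A) (s : seq A) :
  ~ I 1 -> I (\prod_(l <- s) (x - l)) -> exists l, l \in s /\ ~ adjoin I (x - l) 1.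
Proof.
have [I0 ID IM] := idI.
move=> I1; elim: s => [|l s IH]; first by rewrite big_nil => /I1.
rewrite big_cons => Is; case: (boolp.EM (adjoin I (x - l) 1)) => [|nI].
  move=> [h Ih]; have [|k [ks nk]] := IH.
    have -> : \prod_(l0 <- s) (x - l0) =
       \prod_(l0 <- s) (x - l0) * (1 - h * (x - l)) + h * ((x - l) * \prod_(l0 <- s) (x - l0)).
      by ring.
    by apply: ID; apply: IM.
  by exists k; rewrite inE ks orbT.
by exists l; rewrite mem_head.
Qed.

End Ideal.

(** The determinant trick: the adjugate turns the hypothesis into [\det M *: e = 0], and e has an
    entry 1. *)
Lemma det_eq0_of_mul_eq0 (S : comNzRingType) N (M : 'M[S]_N) (e : 'cV_N) i :
  M *m e = 0 -> e i 0 = 1 -> \det M = 0.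
Proof.
move=> Me0 ei1; have : \adj M *m (M *m e) = 0 by rewrite Me0 mulmx0.
rewrite mulmxA mul_adj_mx mul_scalar_mx => /matrixP/(_ i 0).
by rewrite !mxE ei1 mulr1.
Qed.

Lemma horner_char_poly (S : comNzRingType) N (M : 'M[S]_N) x :
  (char_poly M).[x] = \det (x%:M - M).
Proof.
rewrite -horner_evalE -det_map_mx; congr (\det _); apply/matrixP => i j.
by rewrite !mxE /= horner_evalE !hornerE hornerMn hornerX.
Qed.

(** * Solvability and the number of solutions *)

Section Solutions.
Variables (n : nat) (K : fieldType).
Local Notation A := {mpoly K[n]}.
Variable p : 'I_n -> A.
Hypothesis p_esp : forall i, (msize (p i - esp n K i) <= n - i)%N.
Variable c : 'I_n -> K.

Let P := [tuple p i | i < n].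

Let tnthP i : tnth P i = p i.
Proof. by rewrite tnth_mktuple. Qed.

Let N := #|{: staircase n}|.
Let E : 'cV[A]_N := \col_a 'X_[stair_mon (enum_val a)].

(** Multiplication by f on the staircase generators, with entries in the algebra generated by p. [G]
    is a lift of that matrix to polynomials in unknowns that stand for the [p i]. *)
Let mult_mx f : exists G : 'M[A]_N, map_mx (comp_mpoly P) G *m E = f *: E.
Proof.
have /fin_all_exists[G GE] : forall a : 'I_N, spanned p (f * 'X_[stair_mon (enum_val a)]).
  by move=> a; apply: spanned_all.
exists (\matrix_(a, b) G a (enum_val b)); apply/colP => a; rewrite !mxE.
rewrite (GE a) [RHS](reindex (@enum_val (staircase n) predT)) /=; last first.
  exact/onW_bij/enum_val_bij.
by apply: eq_bigr => b _; rewrite !mxE.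
Qed.

Let i0 : 'I_N := enum_rank ([ffun k : 'I_n => ord0] : staircase n).

Let E1 : E i0 0 = 1.
Proof.
rewrite mxE enum_rankK -mpolyX0; congr 'X_[_]; apply/mnmP => k.
by rewrite mnmE ffunE mnm0E.
Qed.

Definition sys_ideal (f : A) := exists h : 'I_n -> A, f = \sum_i h i * (p i - (c i)%:MP).

Lemma ideal_sys : ideal sys_ideal.
Proof.
split; first by exists (fun=> 0); rewrite big1 // => i _; rewrite mul0r.
  move=> _ _ [h ->] [k ->]; exists (fun i => h i + k i).
  by rewrite -big_split; apply: eq_bigr => i _; rewrite mulrDl.
move=> g _ [h ->]; exists (fun i => g * h i).
by rewrite mulr_sumr; apply: eq_bigr => i _; rewrite mulrA.
Qed.

Lemma sys_ideal_gen i : sys_ideal (p i - (c i)%:MP).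
Proof.
exists (fun j => (i == j)%:R); rewrite (bigD1 i) //= eqxx mul1r big1 ?addr0 //.
by move=> j /negPf; rewrite eq_sym => ->; rewrite mul0r.
Qed.

(** Nakayama's argument: if 1 = sum_i h_i (p_i - c_i), then [M] evaluated at p kills the generators,
    so its determinant vanishes there. By algebraic independence the determinant of [M] is already
    zero as a polynomial in the unknowns, yet at the point c it is the determinant of the
    identity. *)
Lemma sys_ideal_proper : ~ sys_ideal 1.
Proof.
move=> [h h1]; have /fin_all_exists[G GE] := fun i => mult_mx (h i).
pose M : 'M[A]_N := 1%:M - \sum_i ('X_i - (c i)%:MP) *: G i.
have : \det (map_mx (comp_mpoly P) M) = 0.
  apply: (det_eq0_of_mul_eq0 _ E1).
  rewrite /M map_mxB map_mx1 mulmxBl mul1mx raddf_sum mulmx_suml.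
  rewrite -[X in X - _]scale1r h1 scaler_suml; apply/eqP; rewrite subr_eq0; apply/eqP.
  apply: eq_bigr => i _; rewrite /= map_mxZ -scalemxAl GE scalerA mulrC; congr (_ *: _).
  by rewrite rmorphB /= comp_mpolyXU comp_mpolyC -tnth_nth tnthP.
rewrite det_map_mx => /(sys_alg_indep p_esp) /(congr1 (meval c)).
rewrite meval0 -det_map_mx /M map_mxB map_mx1 raddf_sum /= big1 ?subr0 ?det1.
  by move/eqP; rewrite oner_eq0.
move=> i _; rewrite map_mxZ /= rmorphB /= mevalXU mevalC subrr scale0r.
by [].
Qed.

Lemma sys_ideal_comp t : sys_ideal ((t \mPo P) - (t.@[c])%:MP).
Proof.
have id := ideal_sys; have [_ _ IM] := id.
rewrite comp_mpolyEX mevalE raddf_sum -sumrB; apply: (ideal_sum id) => m _.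
rewrite /= mpolyCM mul_mpolyC -scalerBr -mul_mpolyC; apply: IM.
rewrite comp_mpolyX rmorph_prod; apply: (ideal_cong_prod id) => i.
by rewrite rmorphXn /= tnthP; apply: (ideal_congX id); apply: sys_ideal_gen.
Qed.

(** The characteristic polynomial of multiplication by X_i annihilates X_i, and modulo the ideal its
    coefficients are constants by [sys_ideal_comp]. *)
Lemma sys_ideal_integral i : exists2 q : {poly K}, q \is monic &
  sys_ideal (map_poly (@mpolyC n K) q).['X_i].
Proof.
have id := ideal_sys; have [_ _ IM] := id.
have [G GE] := mult_mx 'X_i.
exists (map_poly (meval c) (char_poly G)).
  by apply: monic_map; apply: char_poly_monic.
have det0 : (map_poly (comp_mpoly P) (char_poly G)).['X_i] = 0.
  rewrite map_char_poly horner_char_poly.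
  apply: (det_eq0_of_mul_eq0 _ E1).
  by rewrite mulmxBl GE mul_scalar_mx subrr.
rewrite -[X in sys_ideal X]opprK; apply: (idealN id); rewrite -sub0r -det0.
rewrite (@horner_coef_wide _ (size (char_poly G)) (map_poly _ _) 'X_i) ?size_poly //.
rewrite (@horner_coef_wide _ (size (char_poly G)) (map_poly _ (map_poly _ _))); last first.
  exact: leq_trans (size_poly _ _) (size_poly _ _).
rewrite -sumrB; apply: (ideal_sum id) => j _; rewrite !coef_map /= -mulrBl mulrC.
exact/IM/sys_ideal_comp.
Qed.

End Solutions.

(** The coordinates are chosen one after another: X_i is integral over K modulo the ideal, so over a
    closed field some X_i - l can be adjoined without reaching 1. In the final ideal p_i is
    congruent both to c_i and to its value at x; if these differed, the ideal would contain a
    nonzero constant. *)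
Lemma system_solvable n (K : closedFieldType) (p : 'I_n -> {mpoly K[n]}) (c : 'I_n -> K) :
  (forall i, (msize (p i - esp n K i) <= n - i)%N) ->
  exists x : 'I_n -> K, forall i, (p i).@[x] = c i.
Proof.
move=> p_esp; have idS := ideal_sys p c.
suff [I [x [idI I1 SI xI]]] : exists I (x : 'I_n -> K),
    [/\ ideal I, ~ I 1, forall f, sys_ideal p c f -> I f &
      forall i, i \in enum 'I_n -> I ('X_i - (x i)%:MP)].
  have {}xI i : I ('X_i - (x i)%:MP) by apply: xI; rewrite mem_enum.
  exists x => i; apply/eqP; rewrite -subr_eq0; apply/negPn/negP => d0.
  have Ix : I (p i - ((p i).@[x])%:MP).
    rewrite [p i in X in I (X - _)]mpolyE mevalE raddf_sum -sumrB.
    apply: (ideal_sum idI) => m _.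
    rewrite /= mpolyCM mul_mpolyC -scalerBr -mul_mpolyC.
    have [_ _ IM] := idI; apply: IM; rewrite mpolyXE_id rmorph_prod.
    apply: (ideal_cong_prod idI) => j; rewrite rmorphXn /=.
    by apply: (ideal_congX idI); apply: xI.
  have := idealB idI (SI _ (sys_ideal_gen p c i)) Ix.
  rewrite opprB addrC addrA subrK -mpolyCB => Id.
  apply: I1; have [_ _ /(_ ((p i).@[x] - c i)^-1%:MP _ Id)] := idI.
  by rewrite -mpolyCM mulVf.
elim: (enum 'I_n) => [|i s [I [x [idI I1 SI xI]]]].
  by exists (sys_ideal p c), (fun=> 0); split=> //; apply: sys_ideal_proper.
have [q q_mon Sq] := sys_ideal_integral p_esp c i.
have [r qE] := closed_field_poly_normal q; rewrite (monicP q_mon) scale1r in qE.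
have Ir : I (\prod_(l <- [seq l%:MP | l <- r]) ('X_i - l)).
  have := SI _ Sq; rewrite qE rmorph_prod horner_prod big_map.
  by congr I; apply: eq_bigr => l _; rewrite rmorphB /= map_polyX map_polyC hornerXsubC.
have [_ [/mapP[l _ ->] nI]] := adjoin_proper idI I1 Ir.
exists (adjoin I ('X_i - l%:MP)), (fun j => if j == i then l else x j); split=> //.
- exact: ideal_adjoin.
- by move=> f /SI; apply: adjoin_sub.
- move=> j; rewrite inE; case: eqP => [-> _|_ /= /xI Ij]; first exact: adjoin_gen.
  exact: adjoin_sub.
Qed.

(** At every solution p_i takes the value c_i, so the values of a polynomial at the N solutions
    depend on n! scalars only. Interpolation polynomials produce the identity matrix, which
    therefore factors as [C *m D] through dimension n!. *)
Lemma system_count n (K : fieldType) (p : 'I_n -> {mpoly K[n]}) (c : 'I_n -> K)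
    N (x : 'I_N -> 'I_n -> K) :
  (forall i, (msize (p i - esp n K i) <= n - i)%N) ->
  (forall r i, (p i).@[x r] = c i) ->
  (forall r s, x r =1 x s -> r = s) -> (N <= n`!)%N.
Proof.
move=> p_esp xc x_inj.
pose d r s := [pick j | x r j != x s j].
(* For r != s, a linear polynomial equal to 1 at [x r] and 0 at [x s], in a coordinate where the two
   solutions differ. *)
pose fac r s : {mpoly K[n]} :=
  if d r s is Some j then (x r j - x s j)^-1 *: ('X_j - (x s j)%:MP) else 1.
have facr r s : (fac r s).@[x r] = 1.
  rewrite /fac /d; case: pickP => [j ne|_]; last exact: meval1.
  by rewrite mevalZ mevalB mevalXU mevalC mulVf // subr_eq0.
have facs r s : s != r -> (fac r s).@[x s] = 0.
  rewrite /fac /d; case: pickP => [j ne _|eq_rs /eqP []].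
    by rewrite mevalZ mevalB mevalXU mevalC subrr mulr0.
  by apply: x_inj => j; apply/esym; have /negbT/negPn/eqP := eq_rs j.
pose f r := \prod_(s < N | s != r) fac r s.
have fE r t : (f r).@[x t] = (r == t)%:R.
  rewrite rmorph_prod /=; have [<-|ne] := eqVneq r t; first by rewrite big1.
  by rewrite (bigD1 t) 1?eq_sym //= facs ?mul0r // eq_sym.
have /fin_all_exists[G GE] := fun r => spanned_all p_esp (f r).
pose C : 'M[K]_(N, #|{: staircase n}|) := \matrix_(r, b) (G r (enum_val b)).@[c].
pose D : 'M[K]_(#|{: staircase n}|, N) :=
  \matrix_(b, t) ('X_[stair_mon (enum_val b)]).@[x t].
rewrite -card_staircase; apply: (@mulmx1_min K _ _ C D).
apply/matrixP => r t; rewrite !mxE -fE (GE r) raddf_sum.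
rewrite [RHS](reindex (@enum_val (staircase n) predT)) /=; last first.
  exact/onW_bij/enum_val_bij.
apply: eq_bigr => b _; rewrite !mxE rmorphM /= comp_mpoly_meval; congr (_ * _).
by apply: meval_eq => i; rewrite tnth_mktuple.
Qed.

(** * Systems read off the coefficients of a polynomial *)

Section PolynomialTarget.
Variables (n : nat).

Definition mprodX (K : nzRingType) : {poly {mpoly K[n]}} :=
  \prod_(j < n) ('X - ('X_j)%:P).

Let esp_of (K : fieldType) (F : {poly {mpoly K[n]}}) :
  tdeg_lt n (F - mprodX K) -> forall i : 'I_n, (msize (F`_i - esp n K i) <= n - i)%N.
Proof. by move=> tF i; have := tF i; rewrite coefB. Qed.

Lemma monic_target_solvable (K : closedFieldType) (F : {poly {mpoly K[n]}}) (g : {poly K}) :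
  tdeg_lt n (F - mprodX K) -> g \is monic -> size g = n.+1 ->
  exists x : 'I_n -> K, map_poly (meval x) F = g.
Proof.
move=> tF g_mon sz_g.
have [x xE] := system_solvable (fun i => g`_i) (esp_of tF).
exists x; apply/polyP => i; rewrite coef_map /=.
have [lt_i|le_i] := ltnP i n; first exact: (xE (Ordinal lt_i)).
(* From index n on the bound n - i is 0, so F has the coefficients of [mprodX]: 1 at n and 0
   beyond. *)
have /eqP : F`_i - (mprodX K)`_i = 0.
  by apply/eqP; rewrite -(mmeasure_poly_eq0 (Measure.clone _ mdeg _)) -leqn0 -coefB (leq_trans (tF i)) // leqn0 subn_eq0.
have sz_m : size (mprodX K) = n.+1.
  by rewrite size_prod_XsubC /index_enum -enumT size_enum_ord.
rewrite subr_eq0 => /eqP ->; move: le_i; rewrite leq_eqVlt => /orP[/eqP <-|lt_i].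
  have -> : (mprodX K)`_n = 1.
    have := monic_prod_XsubC (index_enum 'I_n) xpredT (fun j => 'X_j : {mpoly K[n]}).
    by rewrite monicE /lead_coef => /eqP; rewrite sz_m.
  by rewrite meval1 -(monicP g_mon) /lead_coef sz_g.
by rewrite !nth_default ?sz_g ?sz_m ?meval0.
Qed.

Lemma monic_target_count (K : fieldType) (F : {poly {mpoly K[n]}}) (g : {poly K})
    N (x : 'I_N -> 'I_n -> K) :
  tdeg_lt n (F - mprodX K) -> (forall r, map_poly (meval (x r)) F = g) ->
  (forall r s, x r =1 x s -> r = s) -> (N <= n`!)%N.
Proof.
move=> tF xF; apply: (system_count (c := fun i => g`_i) (esp_of tF)) => r i.
by rewrite -(xF r) coef_map.
Qed.

End PolynomialTarget.

Section TdegProd.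
Variables (n : nat) (K : idomainType) (I : eqType).
Implicit Types (u v : I -> {poly {mpoly K[n]}}) (r : seq I).

Lemma tdeg_lt_prodD r u v :
  (forall i, tdeg_lt 2 (u i)) -> (forall i, tdeg_lt 1 (v i)) ->
  tdeg_lt (size r) (\prod_(i <- r) (u i + v i) - \prod_(i <- r) u i).
Proof.
move=> tu tv; elim: r => [|i r IH]; first by rewrite !big_nil subrr; apply: tdeg_lt0.
rewrite !big_cons /=.
have -> : (u i + v i) * \prod_(j <- r) (u j + v j) - u i * \prod_(j <- r) u j =
  u i * (\prod_(j <- r) (u j + v j) - \prod_(j <- r) u j) + v i * \prod_(j <- r) (u j + v j).
  by ring.
apply: tdeg_ltD; first exact: tdeg_ltM (tu i) IH.
have := @tdeg_lt_prod n K I r xpredT (fun j => u j + v j); rewrite count_predT => tuv.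
have {}tuv := tuv (fun j _ => tdeg_ltD (tu j) (tdeg_ltW (leqnSn 1) (tv j))).
exact: tdeg_ltM (tv i) tuv.
Qed.

Lemma tdeg_lt_prod_drop r u i : i \in r -> (forall j, tdeg_lt 2 (u j)) ->
  tdeg_lt 1 (u i) -> tdeg_lt (size r) (\prod_(j <- r) u j).
Proof.
move=> ir tu ti; rewrite (big_rem i) //=.
have := @tdeg_lt_prod n K I (rem i r) xpredT u (fun j _ => tu j).
rewrite count_predT size_rem // prednK => [tr|]; last by case: (r) ir.
exact: tdeg_ltM ti tr.
Qed.

End TdegProd.

(** In the Leibniz expansion only the identity permutation reaches total degree n, with top form the
    product of the T - X_j; any other permutation picks an off-diagonal entry, which is a
    constant. *)
Lemma char_poly_addmx_diag_count (K : fieldType) n (M : 'M[K]_n) (g : {poly K})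
    N (x : 'I_N -> 'I_n -> K) :
  (forall r, char_poly (M + diag_mx (\row_j x r j)) = g) ->
  (forall r s, x r =1 x s -> r = s) -> (N <= n`!)%N.
Proof.
pose B : 'M[{mpoly K[n]}]_n := map_mx (@mpolyC n K) M + diag_mx (\row_j 'X_j).
move=> xg; apply: (monic_target_count (F := char_poly B) (g := g)) => [|r]; last first.
  rewrite map_char_poly -(xg r); apply: congr1.
  rewrite /B map_mxD map_diag_mx; apply: f_equal2.
    by apply/matrixP => i j; rewrite !mxE /= mevalC.
  by apply: congr1; apply/rowP => j; rewrite !mxE /= mevalXU.
have entry i j : char_poly_mx B i j =
    (if i == j then 'X - ('X_i)%:P else 0) + (- (M i j)%:MP%:P).
  rewrite !mxE; case: eqP => [->|_]; rewrite ?mulr1n ?mulr0n.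
    move: (M j j)%:MP ('X_j) => a b.
    by rewrite polyCD opprD [LHS]addrCA [RHS]addrC.
  by rewrite addr0.
have tC i j : tdeg_lt 1 (- (M i j)%:MP%:P : {poly {mpoly K[n]}}).
  exact/tdeg_ltN/tdeg_ltC.
have tX i : tdeg_lt 2 ('X - ('X_i)%:P : {poly {mpoly K[n]}}).
  exact: tdeg_ltB (tdeg_ltX _ _) (tdeg_ltXi _ _).
have sz : size (index_enum 'I_n) = n by rewrite /index_enum -enumT size_enum_ord.
rewrite /char_poly /determinant (bigD1 (1%g : 'S_n)) //= odd_perm1 expr0 mul1r addrAC.
apply: tdeg_ltD.
  rewrite -{2}sz; under eq_bigr do rewrite perm1 entry eqxx.
  apply: tdeg_lt_prodD => i //; exact: tC.
apply: tdeg_lt_sum => s s1; rewrite -signr_odd.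
have [i si] : exists i, s i != i.
  apply/existsP; apply: contraNT s1 => /existsPn s1; apply/eqP/permP => i.
  by rewrite perm1; apply/eqP; have := s1 i; rewrite negbK.
have tp : tdeg_lt n (\prod_i char_poly_mx B i (s i)).
  rewrite -{2}sz; apply: (tdeg_lt_prod_drop (i := i)) => [|j|].
  - by rewrite mem_index_enum.
  - rewrite entry; apply: tdeg_ltD; last exact: tdeg_ltW (tC _ _).
    by case: ifP => _ //; apply: tdeg_lt0.
  - by rewrite entry eq_sym (negPf si) add0r; apply: tC.
by rewrite mulr_sign; case: odd => //; apply: tdeg_ltN.
Qed.

(* The pair (u (r-1), u r) of the solution of u (j+1) = v j * u j - u (j-1)
   with (u (-1), u 0) = (a, b). *)
Fixpoint recur (S : pzRingType) (v : nat -> S) (a b : S) (r : nat) : S * S :=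
  if r is r'.+1 then let: (u', u) := recur v a b r' in (u, v r' * u - u')
  else (a, b).

(** The trace of the product of the transfer matrices over r sites, that is, the discriminant; the
    summands are the two diagonal entries of that product. *)
Definition monodromy_trace (S : pzRingType) (v : nat -> S) (r : nat) : S :=
  (recur v 0 1 r).2 + (recur v 1 0 r).1.

Lemma recurS (S : pzRingType) (v : nat -> S) a b r :
  recur v a b r.+1 = ((recur v a b r).2, v r * (recur v a b r).2 - (recur v a b r).1).
Proof. by rewrite /=; case: (recur v a b r). Qed.

Lemma recur_morph (S T : pzRingType) (f : {rmorphism S -> T}) v w a b r :
  (forall j, (j < r)%N -> f (v j) = w j) ->
  recur w (f a) (f b) r = (f (recur v a b r).1, f (recur v a b r).2).
Proof.
elim: r => [//|r IH] vw; rewrite !recurS IH => [|j lt_j]; last first.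
  by apply: vw; rewrite ltnW.
by rewrite /= rmorphB rmorphM vw.
Qed.

Lemma monodromy_trace_morph (S T : pzRingType) (f : {rmorphism S -> T}) v w r :
  (forall j, (j < r)%N -> f (v j) = w j) ->
  f (monodromy_trace v r) = monodromy_trace w r.
Proof.
move=> vw; rewrite /monodromy_trace rmorphD.
by rewrite -(rmorph0 f) -(rmorph1 f) !(recur_morph _ _ vw).
Qed.

(** The solution started from (0, 1) is a continuant, whose top form is the product of the [v j];
    the one started from (1, 0) contributes lower total degree only. *)
Lemma tdeg_lt_monodromy_trace n (K : idomainType) (v : nat -> {poly {mpoly K[n.+1]}}) :
  (forall i : 'I_n.+1, v i = 'X - ('X_i)%:P) ->
  tdeg_lt n.+1 (monodromy_trace v n.+1 - mprodX n.+1 K).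
Proof.
move=> vE; have tv j : (j < n.+1)%N -> tdeg_lt 2 (v j).
  by move=> lt_j; rewrite (vE (Ordinal lt_j)); exact: tdeg_ltB (tdeg_ltX _ _) (tdeg_ltXi _ _).
have tC r : (r <= n.+1)%N -> [/\ tdeg_lt r (recur v 0 1 r).1,
    tdeg_lt r.+1 (recur v 0 1 r).2 &
    tdeg_lt r ((recur v 0 1 r).2 - \prod_(j < r) v j)].
  elim: r => [_|r IH lt_r].
    rewrite /= big_ord0 subrr; split; [exact: tdeg_lt0|exact: tdeg_lt1|exact: tdeg_lt0].
  have [t1 t2 t3] := IH (ltnW lt_r).
  rewrite recurS /= big_ord_recr /= [_ * v r]mulrC.
  have tvr := tdeg_ltM (tv r lt_r) t2.
  split=> //; first by apply: tdeg_ltB => //; apply: tdeg_ltW t1; lia.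
  rewrite addrAC -mulrBr; apply: tdeg_ltB; last exact: tdeg_ltW t1.
  exact: tdeg_ltM (tv r lt_r) t3.
(* [r.-1.+1] is r except at r = 0, where the first component is the constant 1. *)
have tS r : (r <= n.+1)%N -> tdeg_lt r.-1.+1 (recur v 1 0 r).1 /\
    tdeg_lt r (recur v 1 0 r).2.
  elim: r => [_|r IH lt_r].
    by split; [exact: tdeg_lt1|exact: tdeg_lt0].
  have [t1 t2] := IH (ltnW lt_r); rewrite recurS /=; split.
    exact: tdeg_ltW t2.
  apply: tdeg_ltB; first exact: tdeg_ltM (tv r lt_r) t2.
  by apply: tdeg_ltW t1; lia.
rewrite /monodromy_trace addrAC; apply: tdeg_ltD; last exact: (tS _ (leqnn _)).1.
have [_ _] := tC _ (leqnn _).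
by congr (tdeg_lt _ (_ - _)); apply: eq_bigr => j _; rewrite vE.
Qed.

Lemma monodromy_trace_solvable (K : closedFieldType) n (g : {poly K}) :
  g \is monic -> size g = n.+2 ->
  exists V : nat -> K, forall l, monodromy_trace (fun j => l - V j) n.+1 = g.[l].
Proof.
move=> g_mon sz_g.
pose v j : {poly {mpoly K[n.+1]}} := 'X - ('X_(inord j : 'I_n.+1))%:P.
have vE (i : 'I_n.+1) : v i = 'X - ('X_i)%:P by rewrite /v inord_val.
have [x <-] := monic_target_solvable (tdeg_lt_monodromy_trace vE) g_mon sz_g.
exists (fun j => x (inord j)) => l; rewrite -horner_evalE.
rewrite (monodromy_trace_morph _ (w := fun j => 'X - (x (inord j))%:P)); last first.
  by move=> j _; rewrite rmorphB /= map_polyX map_polyC /= mevalXU.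
by rewrite (monodromy_trace_morph _ (w := fun j => l - x (inord j))) // => j _; rewrite /= horner_evalE hornerXsubC.
Qed.

End PolySystem.

Require Import Defs.
From mathcomp Require Import all_classical all_reals all_analysis.
From mathcomp Require Import complex.
From mathcomp Require Import lra.

Import Order.TTheory GRing.Theory Num.Theory.
Import numFieldNormedType.Exports.

Local Open Scope classical_set_scope.
Local Open Scope ring_scope.
Local Open Scope complex_scope.

(** * Goursat's lemma *)

Section Goursat.
Context (R : realType).
Implicit Types (f g : R -> R) (P Q : R -> R -> R) (a b c d x y e : R).

(** The base point A stays to the left of every rectangle, so the integral over a segment is a
    difference of two values and subdivision becomes a ring identity. *)
Definition prim (A : R) f x : R := \int[@lebesgue_measure R]_(t in `[A, x]) f t.

Lemma is_derive_prim A f x : continuous f -> A < x -> is_derive x 1 (prim A f) (f x).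
Proof.
move=> cf Ax.
have xu : x < x + 1 by rewrite ltrDl.
have fi : (@lebesgue_measure R).-integrable `[A, x + 1] (EFin \o f).
  apply: continuous_compact_integrable; first exact: segment_compact.
  exact: continuous_subspaceT.
have [df fE] := continuous_FTC1_closed xu fi Ax (cf x).
apply: DeriveDef; first exact: df.
by rewrite -derive1E; exact: fE.
Qed.

Lemma prim_sub_le A f g a b K M : continuous f -> continuous g ->
  A < a -> a <= b -> (forall x, a <= x <= b -> `|f x - g x - K| <= M) ->
  `|(prim A f b - prim A f a) - (prim A g b - prim A g a) - K * (b - a)| <= M * (b - a).
Proof.
move=> cf cg Aa ab fgM.
pose H := prim A f - prim A g - ( *%R K).
have dH x : a <= x -> is_derive x 1 H (f x - g x - K).
  move=> ax; have Ax := lt_le_trans Aa ax.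
  have df := is_derive_prim cf Ax; have dg := is_derive_prim cg Ax.
  have dK : is_derive x 1 ( *%R K) K.
    by apply: is_derive_eq; rewrite /GRing.scale /= ?mulr1 ?mulr0 ?addr0.
  exact: is_deriveB.
have [||z /itvP zab HE] := @MVT_segment R H (fun x => f x - g x - K) a b ab.
- by move=> x /itvP xab; apply: dH; rewrite xab.
- apply: derivable_within_continuous => x /itvP xab.
  by have [] := dH x _; rewrite ?xab.
have -> : prim A f b - prim A f a - (prim A g b - prim A g a) - K * (b - a) = H b - H a.
  rewrite /H !fctE; ring.
rewrite HE normrM [X in _ * X]ger0_norm ?subr_ge0 // ler_wpM2r ?subr_ge0 //.
by apply: fgM; rewrite !zab.
Qed.

(** The form P dx + Q dy is differentiable at each point and closed: the shared [p2] is both dP/dy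
    and dQ/dx. *)
Definition closed_form P Q := forall x y, exists p1 p2 q2 : R,
  forall e, 0 < e -> exists2 d : R, 0 < d & forall h k, `|h| <= d -> `|k| <= d ->
    `|P (x + h) (y + k) - P x y - p1 * h - p2 * k| <= e * (`|h| + `|k|) /\
    `|Q (x + h) (y + k) - Q x y - p2 * h - q2 * k| <= e * (`|h| + `|k|).

(** The integral of P dx + Q dy along the boundary of the rectangle [a, b] x [c, d],
    counterclockwise. *)
Definition circulation A B P Q a b c d :=
  (prim A (P ^~ c) b - prim A (P ^~ c) a) - (prim A (P ^~ d) b - prim A (P ^~ d) a)
  + ((prim B (Q b) d - prim B (Q b) c) - (prim B (Q a) d - prim B (Q a) c)).

Lemma approx_continuous f (l : R -> R) :
  (forall x e, 0 < e -> exists2 d : R, 0 < d & forall h, `|h| <= d ->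
     `|f (x + h) - f x - l x * h| <= e * `|h|) -> continuous f.
Proof.
move=> fl x; apply/cvgrPdist_le => e e0.
have [d d0 fd] := fl x 1 ltr01.
have L0 : 0 < 1 + `|l x| by rewrite ltr_pwDl.
near=> y.
have yd : `|y - x| <= d.
  by rewrite distrC; near: y; apply: cvgr_dist_le.
have yE : `|y - x| <= e / (1 + `|l x|).
  by rewrite distrC; near: y; apply: cvgr_dist_le => //; apply: divr_gt0.
have := fd _ yd; rewrite [x + _]addrC subrK mul1r => fyx.
rewrite distrC -[f y - f x](subrK (l x * (y - x))).
apply: (le_trans (ler_normD _ _)); apply: (le_trans (lerD fyx (lexx _))).
rewrite normrM -{1}[`|y - x|]mul1r -mulrDl mulrC.
by rewrite -ler_pdivlMr.
Unshelve. all: by end_near. Qed.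

Lemma closed_form_continuous P Q : closed_form P Q ->
  (forall c, continuous (P ^~ c)) /\ (forall a, continuous (Q a)).
Proof.
move=> PQ; split=> [c|a].
  pose l x := xget 0 [set p : R | forall e, 0 < e -> exists2 d : R, 0 < d & forall h, `|h| <= d ->
     `|P (x + h) c - P x c - p * h| <= e * `|h|].
  apply: (@approx_continuous _ l) => x; rewrite /l; case: xgetP => [p _ //|].
  have [p1 [p2 [q2 PQx]]] := PQ x c.
  move=> /(_ p1) []; move=> e /PQx[d d0 dP]; exists d => // h hd.
  have n0 : `|0 : R| <= d by rewrite normr0 ltW.
  have [+ _] := dP h 0 hd n0.
  by rewrite addr0 mulr0 subr0 normr0 addr0.
pose l x := xget 0 [set p : R | forall e, 0 < e -> exists2 d : R, 0 < d & forall h, `|h| <= d ->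
   `|Q a (x + h) - Q a x - p * h| <= e * `|h|].
apply: (@approx_continuous _ l) => x; rewrite /l; case: xgetP => [p _ //|].
have [p1 [p2 [q2 PQx]]] := PQ a x.
move=> /(_ q2) []; move=> e /PQx[d d0 dP]; exists d => // h hd.
have n0 : `|0 : R| <= d by rewrite normr0 ltW.
have [_] := dP 0 h n0 hd.
by rewrite addr0 mulr0 subr0 normr0 add0r.
Qed.

Section Bisection.
Variables (A B : R) (P Q : R -> R -> R) (a0 c0 w h : R).
Hypotheses (PQ : closed_form P Q) (w0 : 0 <= w) (h0 : 0 <= h) (Aa : A < a0) (Bc : B < c0).

Let C n (z : R * R) :=
  `|circulation A B P Q z.1 (z.1 + w / 2 ^+ n) z.2 (z.2 + h / 2 ^+ n)|.

Let split n z (i : bool * bool) : R * R :=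
  (z.1 + (if i.1 then w / 2 ^+ n.+1 else 0), z.2 + (if i.2 then h / 2 ^+ n.+1 else 0)).

Let half (v : R) n : v / 2 ^+ n = v / 2 ^+ n.+1 + v / 2 ^+ n.+1.
Proof. by rewrite exprS invfM mulrA -[_ / 2 / _]mulrA; field. Qed.

(** The inner edges of the four quarters cancel, so one quarter carries at least a fourth of the
    circulation. *)
Let C_split n z : exists i, C n z <= 4 * C n.+1 (split n z i).
Proof.
pose c i := C n.+1 (split n z i).
have le4 : C n z <= c (false, false) + c (false, true) + c (true, false) + c (true, true).
  rewrite /c /C /split /= !addr0 (half w n) (half h n).
  set a := z.1; set y := z.2; set v := w / _; set k := h / _; rewrite !addrA.
  have -> : circulation A B P Q a (a + v + v) y (y + k + k) =
     circulation A B P Q a (a + v) y (y + k) +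
     circulation A B P Q a (a + v) (y + k) (y + k + k) +
     circulation A B P Q (a + v) (a + v + v) y (y + k) +
     circulation A B P Q (a + v) (a + v + v) (y + k) (y + k + k).
    rewrite /circulation; ring.
  by do 2?[apply: (le_trans (ler_normD _ _)); rewrite lerD2r]; apply: ler_normD.
apply: contrapT => /forallNP lt4.
have lt i : 4 * c i < C n z by rewrite ltNge; apply/negP/lt4.
have := lt (false, false); have := lt (false, true).
have := lt (true, false); have := lt (true, true); lra.
Qed.

Let next n z := split n z (xget (false, false) [set i | C n z <= 4 * C n.+1 (split n z i)]).

Let C_next n z : C n z <= 4 * C n.+1 (next n z).
Proof.
rewrite /next; case: xgetP => [i -> //|no].
by have [i /no] := C_split n z.
Qed.

Let pt := fix pt n : R * R := if n is n'.+1 then next n' (pt n') else (a0, c0).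

Let C_pt n : C 0 (pt 0) <= 4 ^+ n * C n (pt n).
Proof.
elim: n => [|n IH]; first by rewrite expr0 mul1r.
apply: (le_trans IH); rewrite exprSr -mulrA ler_wpM2l ?exprn_ge0 //.
Qed.

Let nested (u : nat -> R) v : 0 <= v ->
  (forall n, u n.+1 = u n \/ u n.+1 = u n + v / 2 ^+ n.+1) ->
  exists x, forall n, u n <= x <= u n + v / 2 ^+ n.
Proof.
move=> v0 uS.
have vn n : 0 <= v / 2 ^+ n by rewrite divr_ge0 // exprn_ge0.
have mono n k : u n <= u (n + k)%N /\ u (n + k)%N + v / 2 ^+ (n + k) <= u n + v / 2 ^+ n.
  elim: k => [|k [IH1 IH2]]; first by rewrite addn0.
  rewrite addnS; have := uS (n + k)%N; have := half v (n + k)%N; have := vn (n + k).+1.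
  by move=> ? ? [] ->; split; lra.
have bnd n m : u m <= u n + v / 2 ^+ n.
  have [le_mn|/ltnW le_nm] := leqP m n.
    have [le1 _] := mono m (n - m)%N; rewrite subnKC // in le1.
    by rewrite (le_trans le1) // lerDl.
  have [_ le2] := mono n (m - n)%N; rewrite subnKC // in le2.
  by apply: le_trans le2; rewrite lerDl.
have sup_u : has_sup (range u).
  by split; [exists (u 0%N), 0%N | exists (u 0%N + v / 2 ^+ 0) => _ [m _ <-]].
exists (sup (range u)) => n; apply/andP; split.
  by apply: (sup_upper_bound sup_u); exists n.
by apply: sup_le_ub => [|_ [m _ <-]]; [exists (u 0%N), 0%N | apply: bnd].
Qed.

(** The nested quarters shrink to a point. The affine part of the form at that point has no
    circulation around any rectangle, because the form is closed. The remainder contributes at most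
    2 e times the square of the half-perimeter, and the factor 4^n of the bisection exactly restores
    the original size. *)
Lemma goursat : circulation A B P Q a0 (a0 + w) c0 (c0 + h) = 0.
Proof.
have [cP cQ] := closed_form_continuous PQ.
have [x xP] := @nested (fun n => (pt n).1) w w0 (fun n => ltac:(
  rewrite /= /next /split; case: (xget _ _).1 => /=; [right|left]; by rewrite ?addr0)).
have [y yP] := @nested (fun n => (pt n).2) h h0 (fun n => ltac:(
  rewrite /= /next /split; case: (xget _ _).2 => /=; [right|left]; by rewrite ?addr0)).
have ptA n : a0 <= (pt n).1 /\ c0 <= (pt n).2.
  elim: n => [//|n [IH1 IH2]]; rewrite /= /next /split /=; split.
    by rewrite (le_trans IH1) // lerDl; case: ifP => // _; rewrite divr_ge0 // exprn_ge0.
  by rewrite (le_trans IH2) // lerDl; case: ifP => // _; rewrite divr_ge0 // exprn_ge0.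
have [p1 [p2 [q2 PQxy]]] := PQ x y.
suff le_e e : 0 < e -> C 0 (pt 0) <= 2 * e * (w + h) ^+ 2.
  apply/eqP; rewrite -normr_le0.
  have -> : a0 + w = (pt 0).1 + w / 2 ^+ 0 by rewrite expr0 divr1.
  have -> : c0 + h = (pt 0).2 + h / 2 ^+ 0 by rewrite expr0 divr1.
  rewrite -/(C 0 (pt 0)); apply/ler_addgt0Pr => e e0; rewrite add0r.
  have D0 : 0 < 2 * ((w + h) ^+ 2 + 1) by rewrite mulr_gt0 // ltr_wpDl // sqr_ge0.
  apply: (le_trans (le_e (e / (2 * ((w + h) ^+ 2 + 1))) _)); first by rewrite divr_gt0.
  rewrite -mulrA mulrCA -mulrA ler_piMr ?(ltW e0) //.
  by rewrite mulrC ler_pdivrMr // mul1r ler_pM2l // lerDl.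
move=> e0; have [d d0 dP] := PQxy e e0.
have [n [wn hn]] : exists n, w / 2 ^+ n <= d /\ h / 2 ^+ n <= d.
  have [n lt_n] : exists n, (w + h) / d < 2 ^+ n.
    exists (Num.bound ((w + h) / d)).
    apply: lt_trans (archi_boundP _) _; first by rewrite divr_ge0 ?addr_ge0 // ltW.
    by rewrite -natrX ltr_nat ltn_expl.
  exists n; have p0 : (0 : R) < 2 ^+ n by rewrite exprn_gt0.
  rewrite !ler_pdivrMr //; move: lt_n; rewrite ltr_pdivrMr // mulrC => /ltW lt_n.
  by split; apply: le_trans lt_n; rewrite ?lerDl ?lerDr.
apply: (le_trans (C_pt n)).
have p40 : (0 : R) < 4 ^+ n by rewrite exprn_gt0.
have -> : 2 * e * (w + h) ^+ 2 = 4 ^+ n * (2 * e * (w / 2 ^+ n + h / 2 ^+ n) ^+ 2).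
  have -> : (4 : R) = 2 ^+ 2 by rewrite expr2; lra.
  have p20 : (2 : R) ^+ n != 0 by rewrite expf_neq0.
  by rewrite exprAC; field.
rewrite ler_pM2l //.
have [an cn] := ptA n; have := xP n; have := yP n; rewrite /C.
move: (pt n) an cn => [a c] /= an cn.
set v := w / 2 ^+ n in wn *; set k := h / 2 ^+ n in hn * => /andP[yl yr] /andP[xl xr].
have v0 : 0 <= v by rewrite divr_ge0 // exprn_ge0.
have k0 : 0 <= k by rewrite divr_ge0 // exprn_ge0.
have nx t : a <= t <= a + v -> `|t - x| <= v by move=> /andP[? ?]; rewrite ler_norml; lra.
have ny t : c <= t <= c + k -> `|t - y| <= k by move=> /andP[? ?]; rewrite ler_norml; lra.
have step s t : a <= s <= a + v -> c <= t <= c + k ->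
  `|P s t - P x y - p1 * (s - x) - p2 * (t - y)| <= e * (v + k) /\
  `|Q s t - Q x y - p2 * (s - x) - q2 * (t - y)| <= e * (v + k).
  move=> /nx sx /ny ty; have := dP _ _ (le_trans sx wn) (le_trans ty hn).
  rewrite ![_ + (_ - _)]addrC !subrK => -[le1 le2].
  have le3 : e * (`|s - x| + `|t - y|) <= e * (v + k) by rewrite ler_pM2l // lerD.
  by split; [apply: le_trans le1 _|apply: le_trans le2 _].
have ca : a <= a <= a + v by rewrite lexx lerDl.
have cb : a <= a + v <= a + v by rewrite lexx lerDl v0.
have cc : c <= c <= c + k by rewrite lexx lerDl.
have cd : c <= c + k <= c + k by rewrite lexx lerDl k0.
have av : a <= a + v by rewrite lerDl.
have ck : c <= c + k by rewrite lerDl.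
(* From bottom minus top the affine part of P leaves - p2 k, from right minus left that of Q leaves
   p2 v; multiplied by the side lengths v and k they cancel. *)
have IP := @prim_sub_le A (P ^~ c) (P ^~ (c + k)) a (a + v) (- p2 * k) (2 * e * (v + k))
  (cP _) (cP _) (lt_le_trans Aa an) av.
have IQ := @prim_sub_le B (Q (a + v)) (Q a) c (c + k) (p2 * v) (2 * e * (v + k))
  (cQ _) (cQ _) (lt_le_trans Bc cn) ck.
have {}IP := IP (fun s sab => ltac:(
  have [s1 _] := step s c sab cc; have [s2 _] := step s (c + k) sab cd;
  move: s1 s2; rewrite !ler_norml => /andP[? ?] /andP[? ?]; apply/andP; split; lra)).
have {}IQ := IQ (fun t tcd => ltac:(
  have [_ s1] := step (a + v) t cb tcd; have [_ s2] := step a t ca tcd;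
  move: s1 s2; rewrite !ler_norml => /andP[? ?] /andP[? ?]; apply/andP; split; lra)).
rewrite /circulation; move: IP IQ.
rewrite ![_ + v - a]addrAC ![_ + k - c]addrAC !subrr !add0r.
set I1 := _ - _ - (_ - _); set I2 := _ - _ - (_ - _) => IP IQ.
have -> : I1 + I2 = (I1 - - p2 * k * v) + (I2 - p2 * v * k) by ring.
apply: (le_trans (ler_normD _ _)); apply: (le_trans (lerD IP IQ)).
by rewrite le_eqVlt; apply/orP; left; apply/eqP; ring.
Qed.

End Bisection.
End Goursat.

(** * Complex differentiability *)

Section RealDerivative.
Context (R : realType).
Implicit Types (f : R -> R) (x l : R).

Lemma is_derive_approx f x l : is_derive x 1 f l ->
  forall e, 0 < e -> exists2 d : R, 0 < d & forall h, `|h| <= d ->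
    `|f (x + h) - f x - l * h| <= e * `|h|.
Proof.
move=> [df fl] e e0.
have : h^-1 *: (f (h + x) - f x) @[h --> 0^'] --> l.
  rewrite -fl; have := df; rewrite /derivable /derive.
  by under eq_fun do rewrite scaler1.
move=> /cvgrPdist_le/(_ e e0); rewrite near_withinE near_simpl.
move=> /nbhs_ballP[d /= d0 dP]; exists (d / 2) => [|h hd]; first by rewrite divr_gt0.
have [->|h0] := eqVneq h 0; first by rewrite addr0 subrr mulr0 subr0 normr0 mulr0.
have := dP h; rewrite /ball /= sub0r normrN => /(_ _ h0) le_e.
have {}le_e : `|l - h^-1 * (f (h + x) - f x)| <= e.
  by apply: le_e; apply: (le_lt_trans hd); rewrite ltr_pdivrMr // ltr_pMr // ltr1n.
have -> : f (x + h) - f x - l * h = - (l - h^-1 * (f (h + x) - f x)) * h.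
  by rewrite [x + h]addrC; field.
by rewrite normrM normrN ler_wpM2r.
Qed.

Lemma approx_is_derive f x l :
  (forall e, 0 < e -> exists2 d : R, 0 < d & forall h, `|h| <= d ->
    `|f (x + h) - f x - l * h| <= e * `|h|) -> is_derive x 1 f l.
Proof.
move=> fl; have cv : h^-1 *: (f (h *: 1 + x) - f x) @[h --> 0^'] --> l.
  apply/cvgrPdist_le => e e0; have [d d0 dP] := fl e e0.
  near=> h.
  have h0 : h != 0 by near: h; exact: nbhs_dnbhs_neq.
  have hd : `|h| <= d by near: h; apply: dnbhs0_le.
  have -> : l - h^-1 *: (f (h *: 1 + x) - f x) = - (h^-1 * (f (x + h) - f x - l * h)).
    by rewrite scaler1 [x + h]addrC /GRing.scale /=; field.
  rewrite normrN.
  by rewrite normrM normfV mulrC ler_pdivrMr ?normr_gt0 // dP.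
split; first by apply/cvg_ex; exists l.
exact: cvg_lim cv.
Unshelve. all: by end_near. Qed.

End RealDerivative.

Section ComplexDerivative.
Context (R : realType).
Local Notation C := R[i].
Local Notation normc := (@Normc.normc R).
Local Notation Re := (@complex.Re R).
Local Notation Im := (@complex.Im R).
Implicit Types (f g : C -> C) (z w D : C) (e d : R).

Lemma normc_ge0 z : 0 <= normc z.
Proof. by case: z => a b; apply: sqrtr_ge0. Qed.

Lemma ler_normcB z w : normc (z - w) <= normc z + normc w.
Proof. by rewrite -(normcN w); apply: le_normcD. Qed.

Lemma normc_ReIm z : normc z <= `|Re z| + `|Im z|.
Proof.
case: z => a b /=; rewrite -[X in _ <= X]ger0_norm ?addr_ge0 // -sqrtr_sqr.
rewrite ler_wsqrtr // sqrrD !real_normK ?num_real // -addrAC lerDl.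
by rewrite mulrn_wge0 // mulr_ge0.
Qed.

Lemma ler_normRe z : `|Re z| <= normc z.
Proof. by case: z => a b /=; rewrite -sqrtr_sqr ler_wsqrtr // lerDl sqr_ge0. Qed.

Lemma ler_normIm z : `|Im z| <= normc z.
Proof. by case: z => a b /=; rewrite -sqrtr_sqr ler_wsqrtr // lerDr sqr_ge0. Qed.

Lemma normc_sub_le z w : normc z - normc w <= normc (z - w).
Proof. by rewrite lerBlDr -{1}(subrK w z) le_normcD. Qed.

Definition cderiv f z D := forall e, 0 < e -> exists2 d : R, 0 < d & forall h,
  normc h <= d -> normc (f (z + h) - f z - D * h) <= e * normc h.

Definition cdiff f := forall z, exists D, cderiv f z D.

Lemma cderiv_lip f z D : cderiv f z D -> exists L d : R,
  [/\ 0 < L, 0 < d & forall h, normc h <= d -> normc (f (z + h) - f z) <= L * normc h].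
Proof.
move=> fD; have [d d0 dP] := fD 1 ltr01.
exists (1 + normc D), d; split=> // [|h /dP]; first by rewrite ltr_wpDr // normc_ge0.
rewrite mul1r mulrDl mul1r -Normc.normcM => le1.
by rewrite -[X in normc X](subrK (D * h)) (le_trans (le_normcD _ _)) // lerD2r.
Qed.

Lemma cderiv_cst w z : cderiv (fun=> w) z 0.
Proof.
move=> e e0; exists 1 => // h _.
by rewrite subrr mul0r subr0 Normc.normc0 mulr_ge0 ?normc_ge0 // ltW.
Qed.

Lemma cderiv_id z : cderiv id z 1.
Proof.
move=> e e0; exists 1 => // h _.
by rewrite /= mul1r [z + h]addrC addrK subrr Normc.normc0 mulr_ge0 ?normc_ge0 // ltW.
Qed.

Lemma cderivD f g z D E : cderiv f z D -> cderiv g z E -> cderiv (fun w => f w + g w) z (D + E).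
Proof.
move=> fD gE e e0; have e20 : 0 < e / 2 by rewrite divr_gt0.
have [d d0 dP] := fD _ e20; have [d' d'0 dP'] := gE _ e20.
exists (Num.min d d') => [|h]; first by rewrite lt_min d0.
rewrite le_min => /andP[/dP le1 /dP' le2].
have -> : f (z + h) + g (z + h) - (f z + g z) - (D + E) * h =
   (f (z + h) - f z - D * h) + (g (z + h) - g z - E * h) by ring.
apply: (le_trans (le_normcD _ _)); apply: (le_trans (lerD le1 le2)).
by rewrite -mulrDl -splitr.
Qed.

Lemma cderivM f g z D E : cderiv f z D -> cderiv g z E ->
  cderiv (fun w => f w * g w) z (D * g z + f z * E).
Proof.
move=> fD gE e e0.
have [L [d1 [L0 d10 lip]]] := cderiv_lip fD.
have [L' [d2 [L'0 d20 lip']]] := cderiv_lip gE.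
(* The error of the product splits into three terms, each to be kept below (e / 3) |h|. *)
pose M := 1 + normc (f z) + normc (g z) + L.
have M0 : 0 < M by rewrite !ltr_wpDr ?normc_ge0 // ltW.
have eM : 0 < e / (3 * M) by rewrite divr_gt0 // mulr_gt0.
have [d3 d30 dP] := fD _ eM; have [d4 d40 dP'] := gE _ eM.
have d50 : 0 < e / (3 * L * L') by rewrite divr_gt0 // !mulr_gt0.
exists (Num.min (Num.min d1 d2) (Num.min (Num.min d3 d4) (e / (3 * L * L')))) => [|h].
  by rewrite !lt_min d10 d20 d30 d40.
rewrite !le_min => /andP[/andP[/lip l1 /lip' l2] /andP[/andP[/dP l3 /dP' l4] hd]].
have n0 := normc_ge0 h.
have -> : f (z + h) * g (z + h) - f z * g z - (D * g z + f z * E) * h =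
  (f (z + h) - f z - D * h) * g z + f z * (g (z + h) - g z - E * h)
  + (f (z + h) - f z) * (g (z + h) - g z) by ring.
have -> : e * normc h = e / 3 * normc h + e / 3 * normc h + e / 3 * normc h by field.
have MgM : normc (g z) / M <= 1.
  by rewrite ler_pdivrMr // mul1r /M; have := normc_ge0 (f z); have := normc_ge0 (g z); lra.
have MfM : normc (f z) / M <= 1.
  by rewrite ler_pdivrMr // mul1r /M; have := normc_ge0 (f z); have := normc_ge0 (g z); lra.
have eh : 0 <= e / 3 * normc h by rewrite mulr_ge0 // divr_ge0 // ltW.
apply: (le_trans (le_normcD _ _)); apply: lerD.
  apply: (le_trans (le_normcD _ _)); rewrite !Normc.normcM; apply: lerD.
    apply: (le_trans (ler_wpM2r (normc_ge0 _) l3)).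
    have -> : e / (3 * M) * normc h * normc (g z) = e / 3 * normc h * (normc (g z) / M).
      by field; rewrite gt_eqF.
    by rewrite ler_piMr.
  apply: (le_trans (ler_wpM2l (normc_ge0 _) l4)).
  have -> : normc (f z) * (e / (3 * M) * normc h) = e / 3 * normc h * (normc (f z) / M).
    by field; rewrite gt_eqF.
  by rewrite ler_piMr.
rewrite Normc.normcM; apply: (le_trans (ler_pM (normc_ge0 _) (normc_ge0 _) l1 l2)).
have -> : L * normc h * (L' * normc h) = normc h * (3 * L * L') / 3 * normc h by field.
rewrite ler_wpM2r // ler_pM2r //.
by rewrite -ler_pdivlMr // !mulr_gt0.
Qed.

Lemma cderiv_comp f g z D E : cderiv g z E -> cderiv f (g z) D ->
  cderiv (fun w => f (g w)) z (D * E).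
Proof.
move=> gE fD e e0.
have [L [d1 [L0 d10 lip]]] := cderiv_lip gE.
have eL : 0 < e / (2 * L) by rewrite divr_gt0 // mulr_gt0.
have nD0 : 0 < 1 + normc D by rewrite ltr_wpDr // normc_ge0.
have eD : 0 < e / (2 * (1 + normc D)) by rewrite divr_gt0 // mulr_gt0.
have [d2 d20 dP] := fD _ eL; have [d3 d30 dP'] := gE _ eD.
exists (Num.min (Num.min d1 (d2 / L)) d3) => [|h].
  by rewrite !lt_min d10 d30 divr_gt0.
rewrite !le_min => /andP[/andP[/lip l1 hd] /dP' l3].
have n0 := normc_ge0 h.
have l2 : normc (g (z + h) - g z) <= d2.
  by apply: (le_trans l1); rewrite mulrC -ler_pdivlMr.
have := dP _ l2; rewrite [g z + _]addrC subrK => {}l2.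
have -> : f (g (z + h)) - f (g z) - D * E * h =
  (f (g (z + h)) - f (g z) - D * (g (z + h) - g z)) + D * (g (z + h) - g z - E * h) by ring.
have -> : e * normc h = e / 2 * normc h + e / 2 * normc h by field.
apply: (le_trans (le_normcD _ _)); apply: lerD.
  apply: (le_trans l2); apply: (le_trans (ler_wpM2l (ltW eL) l1)).
  by rewrite le_eqVlt; apply/orP; left; apply/eqP; field; rewrite gt_eqF.
rewrite Normc.normcM; apply: (le_trans (ler_wpM2l (normc_ge0 _) l3)).
have -> : normc D * (e / (2 * (1 + normc D)) * normc h) =
   e / 2 * normc h * (normc D / (1 + normc D)) by field; rewrite gt_eqF.
apply: ler_piMr; first by rewrite mulr_ge0 // divr_ge0 // ltW.
by rewrite ler_pdivrMr // mul1r lerDr.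
Qed.

Lemma cdiff_cst w : cdiff (fun=> w).
Proof. by move=> z; exists 0; apply: cderiv_cst. Qed.

Lemma cdiff_id : cdiff id.
Proof. by move=> z; exists 1; apply: cderiv_id. Qed.

Lemma cdiffD f g : cdiff f -> cdiff g -> cdiff (fun w => f w + g w).
Proof.
by move=> fD gE z; have [D ?] := fD z; have [E ?] := gE z; exists (D + E); apply: cderivD.
Qed.

Lemma cdiffM f g : cdiff f -> cdiff g -> cdiff (fun w => f w * g w).
Proof.
move=> fD gE z; have [D ?] := fD z; have [E ?] := gE z.
by exists (D * g z + f z * E); apply: cderivM.
Qed.

Lemma cdiff_comp f g : cdiff f -> cdiff g -> cdiff (fun w => f (g w)).
Proof.
move=> fD gE z; have [E ?] := gE z; have [D ?] := fD (g z).
by exists (D * E); apply: cderiv_comp.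
Qed.

Lemma cexpD z w : cexp (z + w) = cexp z * cexp w.
Proof.
case: z w => a b [c d]; rewrite /cexp /= expRD cosD sinD.
by apply/eqP; rewrite eq_complex /=; apply/andP; split; apply/eqP; ring.
Qed.

Lemma cexp0 : cexp (0 : C) = 1.
Proof. by rewrite /cexp /= expR0 cos0 sin0 mulr1. Qed.

Lemma normc_cexp z : normc (cexp z) = expR (Re z).
Proof.
rewrite /cexp Normc.normcM /= cos2Dsin2 sqrtr1 mulr1 expr0n addr0 sqrtr_sqr.
by rewrite ger0_norm // expR_ge0.
Qed.

Lemma cexpN z : cexp (- z) = (cexp z)^-1.
Proof.
have z0 : cexp z != 0.
  apply/eqP => /(congr1 normc); rewrite normc_cexp Normc.normc0 => /eqP.
  by rewrite gt_eqF // expR_gt0.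
by apply: (mulfI z0); rewrite -cexpD subrr cexp0 divff.
Qed.

Lemma cderiv_cexp0 : cderiv (@cexp R) 0 1.
Proof.
(* The errors of the real and imaginary parts will add up to 8 e' |h|; e' <= 1 ensures that the real
   part of h is at most 1 in modulus. *)
move=> e e0; pose e' := Num.min (e / 8) 1.
have e'0 : 0 < e' by rewrite lt_min ltr01 divr_gt0.
have e8 : e' <= e / 8 by rewrite ge_min lexx.
have e1 : e' <= 1 by rewrite ge_min lexx orbT.
move: e' e'0 e8 e1 => e' e'0 e8 e1.
have [d1 d10 dP1] := is_derive_approx (is_derive_expR (0 : R)) e'0.
have [d2 d20 dP2] := is_derive_approx (is_derive_cos (0 : R)) e'0.
have [d3 d30 dP3] := is_derive_approx (is_derive_sin (0 : R)) e'0.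
exists (Num.min (Num.min d1 d2) (Num.min d3 e')) => [|[a b]].
  by rewrite !lt_min d10 d20 d30 e'0.
rewrite !le_min => /andP[/andP[h1 h2] /andP[h3 h4]].
have na := ler_normRe (a +i* b); have nb := ler_normIm (a +i* b).
set h := normc _ in h1 h2 h3 h4 na nb *; rewrite /= in na nb.
have := dP1 a (le_trans na h1); have := dP2 b (le_trans nb h2); have := dP3 b (le_trans nb h3).
rewrite !add0r expR0 cos0 sin0 oppr0 mul0r oppr0 !addr0 !mul1r => ls lc le.
rewrite cexp0; apply: (le_trans (normc_ReIm _)).
have h0 : 0 <= h by apply: normc_ge0.
have a1 : `|a| <= 1 by rewrite (le_trans na) // (le_trans h4).
have {le} le : `|expR a - 1 - a| <= e' * h by rewrite (le_trans le) // ler_pM2l.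
have {lc} lc : `|cos b - 1| <= e' * h by rewrite (le_trans lc) // ler_pM2l.
have {ls} ls : `|sin b - b| <= e' * h by rewrite (le_trans ls) // ler_pM2l.
have cb : `|cos b| <= 1 by rewrite ler_norml cos_geN1 cos_le1.
have le2 : `|expR a - 1| <= 2 * h.
  rewrite -[expR a - 1](subrK a) (le_trans (ler_normD _ _)) //.
  have -> : 2 * h = h + h by ring.
  by rewrite lerD // (le_trans le) // ler_piMl.
have ls2 : `|sin b| <= 2 * e'.
  rewrite -[sin b](subrK b) (le_trans (ler_normD _ _)) //.
  have -> : 2 * e' = e' + e' by ring.
  rewrite lerD //; last exact: le_trans nb h4.
  by apply: (le_trans ls); apply: ler_piMr; [apply: ltW|apply: le_trans h4 e1].
have -> : Re (cexp (a +i* b) - 1 - (a +i* b)) =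
    (expR a - 1 - a) * cos b + (1 + a) * (cos b - 1) by rewrite /cexp /=; ring.
have -> : Im (cexp (a +i* b) - 1 - (a +i* b)) =
    (expR a - 1) * sin b + (sin b - b) by rewrite /cexp /=; ring.
apply: (@le_trans _ _ ((e' * h + 2 * (e' * h)) + (2 * h * (2 * e') + e' * h))).
  apply: lerD; apply: (le_trans (ler_normD _ _)); rewrite !normrM; apply: lerD => //.
  - by rewrite -[X in _ <= X]mulr1 ler_pM.
  - by apply: ler_pM => //; rewrite (le_trans (ler_normD _ _)) // normr1; move: a1; lra.
  - exact: ler_pM.
have -> : e' * h + 2 * (e' * h) + (2 * h * (2 * e') + e' * h) = 8 * e' * h by ring.
by rewrite ler_wpM2r // mulrC -ler_pdivlMr.
Qed.

Lemma cdiff_cexp : cdiff (@cexp R).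
Proof.
move=> z; exists (cexp z) => e e0.
have n0 : 0 < normc (cexp z) by rewrite normc_cexp expR_gt0.
have [d d0 dP] := cderiv_cexp0 (divr_gt0 e0 n0).
exists d => // h /dP; rewrite add0r cexp0 mul1r => le1.
have -> : cexp (z + h) - cexp z - cexp z * h = cexp z * (cexp h - 1 - h).
  by rewrite cexpD; ring.
by rewrite Normc.normcM mulrC -ler_pdivlMr // mulrAC.
Qed.

End ComplexDerivative.

(** * Liouville's theorem *)

Section Liouville.
Context (R : realType).
Local Notation C := R[i].
Local Notation normc := (@Normc.normc R).
Local Notation Re := (@complex.Re R).
Local Notation Im := (@complex.Im R).
Implicit Types (f F : C -> C) (P Q : R -> R -> R).

(* [F dz] is the sum of [Re F dx - Im F dy] and [i (Im F dx + Re F dy)]. *)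
Lemma cdiff_closed_form F : cdiff F ->
  closed_form (fun x y => Re (F (x +i* y))) (fun x y => - Im (F (x +i* y))) /\
  closed_form (fun x y => Im (F (x +i* y))) (fun x y => Re (F (x +i* y))).
Proof.
move=> dF.
have key x y : exists p q : R, forall e : R, 0 < e -> exists2 d : R, 0 < d &
    forall h k, `|h| <= d -> `|k| <= d ->
    `|Re (F ((x + h) +i* (y + k))) - Re (F (x +i* y)) - p * h - - q * k| <= e * (`|h| + `|k|) /\
    `|Im (F ((x + h) +i* (y + k))) - Im (F (x +i* y)) - q * h - p * k| <= e * (`|h| + `|k|).
  have [[p q] DF] := dF (x +i* y); exists p, q => e e0.
  have [d d0 dP] := DF e e0; exists (d / 2) => [|h k hd kd]; first by rewrite divr_gt0.
  have nhk := normc_ReIm (h +i* k); rewrite /= in nhk.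
  have /dP le1 : normc (h +i* k) <= d.
    by apply: (le_trans nhk); rewrite (splitr d) lerD.
  have {}le1 := le_trans le1 (ler_wpM2l (ltW e0) nhk).
  have xyE : (x +i* y) + (h +i* k) = (x + h) +i* (y + k) by [].
  rewrite xyE in le1; move: (F _) (F _) le1 => [a b] [a' b'] le1 /=.
  split; apply: le_trans le1.
    apply: le_trans (ler_normRe _); rewrite le_eqVlt; apply/orP; left; apply/eqP.
    by congr `|_|; rewrite /=; ring.
  apply: le_trans (ler_normIm _); rewrite le_eqVlt; apply/orP; left; apply/eqP.
  by congr `|_|; rewrite /=; ring.
split=> x y; have [p [q pq]] := key x y.
  exists p, (- q), (- p) => e /pq[d d0 dP]; exists d => // h k hd kd.
  have [le1 le2] := dP h k hd kd; split=> //.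
  by rewrite -normrN; apply: le_trans le2; rewrite le_eqVlt; apply/orP; left; apply/eqP; congr `|_|; ring.
exists q, p, (- q) => e /pq[d d0 dP]; exists d => // h k hd kd.
by have [le1 le2] := dP h k hd kd; split=> //.
Qed.

(** In Goursat's lemma on [s0, s1] x [0, T] the horizontal sides cancel by periodicity, which leaves
    the two vertical integrals. *)
Lemma periodic_mean_const P Q T s0 s1 : closed_form P Q -> 0 <= T ->
  (forall x, P x 0 = P x T) -> s0 <= s1 ->
  prim (-1) (Q s1) T - prim (-1) (Q s1) 0 = prim (-1) (Q s0) T - prim (-1) (Q s0) 0.
Proof.
move=> PQ T0 P0T s01.
have sA : s0 - 1 < s0 by rewrite ltrBlDr ltrDl.
have w0 : 0 <= s1 - s0 by rewrite subr_ge0.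
have N1 : -1 < 0 :> R by rewrite ltrN10.
have := goursat PQ w0 T0 sA N1; rewrite /circulation add0r.
have -> : s0 + (s1 - s0) = s1 by ring.
have -> : P ^~ 0 = P ^~ T by apply/funext.
by rewrite subrr add0r => /eqP; rewrite subr_eq0 => /eqP.
Qed.

Lemma mean_zero P Q T (K : R) : closed_form P Q -> 0 < T -> (forall x, P x 0 = P x T) ->
  (forall e, 0 < e -> exists s0 s1, [/\ s0 <= s1, forall y, `|Q s0 y - K| <= e &
     forall y, `|Q s1 y| <= e]) -> K = 0.
Proof.
move=> PQ T0 P0T lims; have [_ cQ] := closed_form_continuous PQ.
apply/eqP; rewrite -normr_le0; apply/ler_addgt0Pr => e e0; rewrite add0r.
have e20 : 0 < e / 2 by rewrite divr_gt0.
have [s0 [s1 [s01 Q0 Q1]]] := lims _ e20.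
have N1 : -1 < 0 :> R by rewrite ltrN10.
have := @prim_sub_le R (-1) (Q s0) (Q s1) 0 T K e (cQ _) (cQ _) N1 (ltW T0).
rewrite (periodic_mean_const PQ (ltW T0) P0T s01) subrr sub0r subr0 normrN normrM.
rewrite (gtr0_norm T0) ler_pM2r //; apply=> y _.
have -> : Q s0 y - Q s1 y - K = (Q s0 y - K) - Q s1 y by ring.
by rewrite (le_trans (ler_normB _ _)) // (splitr e) lerD.
Qed.

Lemma ReB (u v : C) : Re (u - v) = Re u - Re v.
Proof. by case: u v => ? ? []. Qed.

Lemma ImB (u v : C) : Im (u - v) = Im u - Im v.
Proof. by case: u v => ? ? []. Qed.

Lemma cexp_imZ (x y : R) : cexp (x +i* y) = (expR x * cos y) +i* (expR x * sin y).
Proof. by rewrite /cexp /=; apply/eqP; rewrite eq_complex /=; apply/andP; split; apply/eqP; ring. Qed.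

(* The mean over [s, s + 2 pi i] of the 2 pi i-periodic function
   (f (z + exp w) - f z) exp (-w) does not depend on s; it tends to the
   derivative as s -> -oo and to 0 as s -> +oo. *)
Lemma bounded_deriv0 f M z D : cdiff f -> (forall w, normc (f w) <= M) ->
  cderiv f z D -> D = 0.
Proof.
move=> df fM fD.
pose F w := (f (z + cexp w) - f z) * cexp (- w).
have dN (g : C -> C) : cdiff g -> cdiff (fun w => - g w).
  move=> dg; have := cdiffM (@cdiff_cst R (-1)) dg.
  by congr cdiff; apply/funext => w; rewrite mulN1r.
have dF : cdiff F.
  apply: cdiffM; last exact: (cdiff_comp (@cdiff_cexp R) (dN _ (@cdiff_id R))).
  apply: cdiffD; last exact: cdiff_cst.
  apply: (cdiff_comp df); apply: cdiffD; [exact: cdiff_cst|exact: cdiff_cexp].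
have T0 : 0 < pi *+ 2 :> R by rewrite mulrn_wgt0 // pi_gt0.
have Fper x : F (x +i* 0) = F (x +i* (pi *+ 2)).
  rewrite /F !cexpN !cexp_imZ cos0 sin0.
  by rewrite -[pi *+ 2]add0r cosD2pi sinD2pi cos0 sin0.
have M0 : 0 <= M := le_trans (normc_ge0 _) (fM 0).
have lims e : 0 < e -> exists s0 s1, [/\ s0 <= s1,
   forall y, normc (F (s0 +i* y) - D) <= e & forall y, normc (F (s1 +i* y)) <= e].
  move=> e0; have [d d0 dP] := fD e e0.
  (* On Re w = s0 one has |exp w| <= d, where the derivative estimate applies; on Re w = s1 the
     bound 2 (M + 1) exp (-s1) is at most e. The comparisons with 0 give s0 <= s1. *)
  exists (Num.min (ln d) 0), (Num.max 0 (- ln (e / (2 * (M + 1))))); split.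
  - by apply: (@le_trans _ _ 0); rewrite ?ge_min ?le_max lexx ?orbT.
  - move=> y; set w := _ +i* y.
    have c0 : cexp w != 0.
      apply/eqP => /(congr1 normc); rewrite normc_cexp Normc.normc0 => /eqP.
      by rewrite gt_eqF // expR_gt0.
    have nd : normc (cexp w) <= d.
      rewrite normc_cexp /= -[X in _ <= X](lnK d0) ler_expR ge_min lexx //.
    have -> : F w - D = (f (z + cexp w) - f z - D * cexp w) * cexp (- w).
      by rewrite /F cexpN [RHS]mulrBl mulfK.
    rewrite Normc.normcM cexpN Normc.normcV ler_pdivrMr ?normc_cexp ?expR_gt0 //.
    by rewrite -normc_cexp dP.
  - move=> y; set w := _ +i* y.
    rewrite Normc.normcM; apply: (@le_trans _ _ ((2 * (M + 1)) * normc (cexp (- w)))).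
      rewrite ler_wpM2r ?normc_ge0 // (le_trans (ler_normcB _ _)) //.
      by have := fM (z + cexp w); have := fM z; lra.
    rewrite mulrC -ler_pdivlMr ?mulr_gt0 ?ltr_wpDl // normc_cexp /=.
    have q0 : 0 < e / (2 * (M + 1)) by rewrite divr_gt0 // mulr_gt0 // ltr_wpDl.
    by rewrite -[X in _ <= X](lnK q0) ler_expR lerNl le_max lexx orbT.
have [cf1 cf2] := cdiff_closed_form dF.
apply/eqP; rewrite eq_complex; apply/andP; split; apply/eqP.
  apply: (mean_zero cf2 T0) => [x|e /lims[s0 [s1 [le_s l0 l1]]]]; first by rewrite Fper.
  exists s0, s1; split=> // y; last exact: le_trans (ler_normRe _) (l1 y).
  rewrite -ReB; exact: le_trans (ler_normRe _) (l0 y).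
apply: oppr_inj; rewrite oppr0.
apply: (mean_zero cf1 T0) => [x|e /lims[s0 [s1 [le_s l0 l1]]]]; first by rewrite Fper.
exists s0, s1; split=> // y; last by rewrite normrN; apply: le_trans (ler_normIm _) (l1 y).
rewrite -opprD -ImB normrN; apply: le_trans (ler_normIm _) (l0 y).
Qed.

Lemma deriv0_const f : (forall z, cderiv f z 0) -> forall z w, f z = f w.
Proof.
move=> f0 z w.
pose g (t : R) := f (z + t%:C * (w - z)).
have lip (t e : R) : 0 < e -> exists2 d : R, 0 < d & forall h, `|h| <= d ->
    normc (g (t + h) - g t) <= e * `|h|.
  move=> e0; have n0 : 0 < 1 + normc (w - z) by rewrite ltr_wpDr ?normc_ge0.
  have [d d0 dP] := f0 (z + t%:C * (w - z)) (e / (1 + normc (w - z))) (divr_gt0 e0 n0).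
  exists (d / (1 + normc (w - z))) => [|h hd]; first by rewrite divr_gt0.
  have nh : normc (h%:C * (w - z)) = `|h| * normc (w - z).
    by rewrite Normc.normcM /= expr0n addr0 sqrtr_sqr.
  have le1 : `|h| * normc (w - z) <= `|h| * (1 + normc (w - z)).
    by rewrite ler_wpM2l // lerDr.
  have := dP (h%:C * (w - z)); rewrite nh mul0r subr0 -addrA -mulrDl -rmorphD => le2.
  apply: (le_trans (le2 _)).
    by apply: (le_trans le1); rewrite -ler_pdivlMr.
  rewrite mulrAC -mulrA; apply: ler_wpM2l; first exact: ltW.
  by rewrite ler_pdivrMr.
have cst (p : C -> R) : (forall u v, `|p u - p v| <= normc (u - v)) -> p (f z) = p (f w).
  move=> plip; have -> : f z = g 0 by rewrite /g mul0r addr0.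
  have -> : f w = g 1 by rewrite /g mul1r addrC subrK.
  apply: (@is_derive_0_is_cst _ (p \o g)) => t; apply: approx_is_derive => e /(lip t)[d d0 dP].
  exists d => // h /dP le1; rewrite mul0r subr0.
  exact: le_trans (plip _ _) le1.
apply/eqP; rewrite eq_complex; apply/andP; split; apply/eqP; apply: cst => u v.
  by rewrite -ReB ler_normRe.
by rewrite -ImB ler_normIm.
Qed.

Lemma liouville f M : cdiff f -> (forall w, normc (f w) <= M) -> forall z w, f z = f w.
Proof.
move=> df fM; apply: deriv0_const => z; have [D fD] := df z.
by rewrite -(bounded_deriv0 df fM fD).
Qed.

End Liouville.

(** * Functions of exponential growth *)

Section ExponentialGrowth.
Context (R : realType).
Local Notation C := R[i].
Local Notation normc := (@Normc.normc R).
Local Notation Re := (@complex.Re R).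

Lemma normcX (z : C) n : normc (z ^+ n) = normc z ^+ n.
Proof. by elim: n => [|n IH]; rewrite ?expr0 ?Normc.normc1 // !exprS Normc.normcM IH. Qed.

Lemma cdiffN (g : C -> C) : cdiff g -> cdiff (fun w => - g w).
Proof.
move=> dg; have := cdiffM (@cdiff_cst R (-1)) dg.
by congr cdiff; apply/funext => w; rewrite mulN1r.
Qed.

Lemma cdiffB (f g : C -> C) : cdiff f -> cdiff g -> cdiff (fun w => f w - g w).
Proof. by move=> df /cdiffN; apply: cdiffD. Qed.

Lemma normc_mulcexp (z t : C) : normc (z * cexp t) = normc z * expR (Re t).
Proof. by rewrite Normc.normcM normc_cexp. Qed.

Lemma seq_separated (s : seq C) :
  exists2 e : R, 0 < e & forall a b, a \in s -> b \in s -> a != b -> e <= normc (a - b).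
Proof.
elim: s => [|x s [e e0 sep]]; first by exists 1.
have [e' e'0 sep'] : exists2 e' : R, 0 < e' & forall a, a \in s -> a != x -> e' <= normc (a - x).
  elim: s {sep} => [|y s [e' e'0 sep]]; first by exists 1.
  have [->|yx] := eqVneq y x.
    by exists e' => // a; rewrite inE => /orP[/eqP->|/sep//]; rewrite eqxx.
  exists (Num.min e' (normc (y - x))).
    rewrite lt_min e'0 lt_neqAle normc_ge0 andbT eq_sym.
    by apply: contra_neq yx => /Normc.eq0_normc /eqP; rewrite subr_eq0 => /eqP.
  move=> a; rewrite inE => /orP[/eqP->|/sep le_e' /le_e' le_e].
    by rewrite ge_min lexx orbT.
  by rewrite ge_min le_e.
exists (Num.min e e') => [|a b]; first by rewrite lt_min e0.
rewrite !inE => /orP[/eqP->|a_s] /orP[/eqP->|b_s] ab.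
- by rewrite eqxx in ab.
- by rewrite -normcN opprB ge_min (sep' b) ?orbT // eq_sym.
- by rewrite ge_min (sep' a) ?orbT.
- by rewrite ge_min sep.
Qed.

Lemma cdiff_segment_continuous (H : C -> C) (z v : C) : cdiff H ->
  continuous (fun s : R => normc (H (z + s%:C * v))).
Proof.
move=> dH s; have [D HD] := dH (z + s%:C * v).
have [L [d [L0 d0 lip]]] := cderiv_lip HD.
have v0 : 0 < 1 + normc v by rewrite ltr_wpDr ?normc_ge0.
have n0 : 0 < 1 + L * (1 + normc v) by rewrite ltr_wpDr // mulr_ge0 // ltW.
have dv : 0 < d / (1 + normc v) by apply: divr_gt0.
apply/cvgrPdist_le => e e0.
have ev : 0 < e / (1 + L * (1 + normc v)) by apply: divr_gt0.
near=> t.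
have td : `|t - s| <= d / (1 + normc v).
  by rewrite distrC; near: t; apply: cvgr_dist_le.
have te : `|t - s| <= e / (1 + L * (1 + normc v)).
  by rewrite distrC; near: t; apply: cvgr_dist_le.
have nE : normc ((t - s)%:C * v) = `|t - s| * normc v.
  by rewrite Normc.normcM /= expr0n addr0 sqrtr_sqr.
have le1 : `|t - s| * normc v <= `|t - s| * (1 + normc v) by rewrite ler_wpM2l // lerDr.
have := lip ((t - s)%:C * v); rewrite nE -addrA -mulrDl -rmorphD [s + _]addrC subrK => le2.
have {}le2 : normc (H (z + t%:C * v) - H (z + s%:C * v)) <= e.
  apply: (le_trans (le2 _)); first by rewrite (le_trans le1) // -ler_pdivlMr.
  apply: (@le_trans _ _ (`|t - s| * (1 + L * (1 + normc v)))); last by rewrite -ler_pdivlMr.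
  rewrite mulrCA ler_wpM2l // [L * (_ + _)]mulrDr mulr1.
  by rewrite addrA lerDr addr_ge0 // ltW.
have := normc_sub_le (H (z + t%:C * v)) (H (z + s%:C * v)).
have := normc_sub_le (H (z + s%:C * v)) (H (z + t%:C * v)).
rewrite -[normc (H (z + s%:C * v) - _)]normcN opprB => le3 le4.
by rewrite ler_norml; apply/andP; split; move: le2 le3 le4 => /=; lra.
Unshelve. all: by end_near. Qed.

Variables (q : nat) (M : R).
Hypothesis q_gt0 : (0 < q)%N.

Let near_exp (om : C) (G : C -> C) := forall t, exists l,
  normc (G t - (om ^+ l * cexp t + (om ^+ l)^-1 * cexp (- t))) <= M.

Let norm_root (om : C) l : om ^+ q = 1 -> normc (om ^+ l) = 1.
Proof.
move=> om1; rewrite normcX; suff -> : normc om = 1 by rewrite expr1n.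
apply/eqP; rewrite -(@pexpr_eq1 _ _ q) ?normc_ge0 //.
by rewrite -normcX om1 Normc.normc1.
Qed.

(* In a right half-plane the exponent l is locally constant, hence constant. *)
Lemma half_plane_growth (om : C) (G : C -> C) : om ^+ q = 1 -> cdiff G -> near_exp om G ->
  exists l Y, 0 <= Y /\ forall t, Y <= Re t -> normc (G t - om ^+ l * cexp t) <= M + 1.
Proof.
move=> om1 dG nG.
have [e e0 sep] := seq_separated [seq om ^+ l | l <- iota 0 q].
have om_mem l : om ^+ l \in [seq om ^+ l | l <- iota 0 q].
  apply/mapP; exists (l %% q)%N; first by rewrite mem_iota ltn_mod.
  by rewrite {1}(divn_eq l q) mulnC exprD exprM om1 expr1n mul1r.
have M0 : 0 <= M by have [l] := nG 0; apply: le_trans; apply: normc_ge0.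
have M10 : 0 < M + 1 by rewrite ltr_wpDl.
(* Beyond Y one has (M + 1) |exp (-t)| <= e / 4, so G t exp (-t) lies within e / 4 of a root of
   unity, while distinct roots are at least e apart. *)
pose Y := Num.max 0 (- ln (e / 4 / (M + 1))).
have Y0 : 0 <= Y by rewrite le_max lexx.
have c0 t : cexp t != 0 :> C.
  apply/eqP => /(congr1 normc); rewrite normc_cexp Normc.normc0 => /eqP.
  by rewrite gt_eqF // expR_gt0.
have close t l : Y <= Re t ->
    normc (G t - (om ^+ l * cexp t + (om ^+ l)^-1 * cexp (- t))) <= M ->
    normc (G t - om ^+ l * cexp t) <= M + 1 /\
    normc (G t * cexp (- t) - om ^+ l) <= e / 4.
  move=> Yt le1; have t0 : 0 <= Re t := le_trans Y0 Yt.
  have le2 : normc (G t - om ^+ l * cexp t) <= M + 1.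
    have -> : G t - om ^+ l * cexp t = (G t - (om ^+ l * cexp t + (om ^+ l)^-1 * cexp (- t)))
       + (om ^+ l)^-1 * cexp (- t) by ring.
    apply: (le_trans (le_normcD _ _)); apply: lerD => //.
    rewrite Normc.normcM Normc.normcV norm_root // invr1 mul1r normc_cexp.
    by case: t t0 {Yt le1} => a b /= a0; rewrite -expR0 ler_expR oppr_le0.
  split=> //.
  have -> : G t * cexp (- t) - om ^+ l = (G t - om ^+ l * cexp t) * cexp (- t).
    by rewrite [RHS]mulrBl cexpN mulfK.
  rewrite Normc.normcM; apply: (le_trans (ler_wpM2r (normc_ge0 _) le2)).
  rewrite mulrC -ler_pdivlMr // normc_cexp.
  have q0 : 0 < e / 4 / (M + 1) by rewrite !divr_gt0.
  rewrite -[X in _ <= X](lnK q0) ler_expR.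
  have -> : Re (- t) = - Re t by case: (t).
  by rewrite lerNl (le_trans _ Yt) // le_max lexx orbT.
have [l le_l] := nG Y%:C; exists l, Y; split=> // t Yt.
have [_ l0] := close Y%:C l (lexx Y) le_l.
have [l' le_l'] := nG t; have [le1 le2] := close _ _ Yt le_l'.
have [<- //|ne] := eqVneq (om ^+ l') (om ^+ l).
exfalso; have far := sep _ _ (om_mem l') (om_mem l) ne.
pose H z := G z * cexp (- z) - om ^+ l.
have dH : cdiff H.
  apply: cdiffB; last exact: cdiff_cst.
  apply: cdiffM => //; exact: (cdiff_comp (@cdiff_cexp R) (cdiffN (@cdiff_id R))).
have cH := @cdiff_segment_continuous H Y%:C (t - Y%:C) dH.
have e4 : 3 * (e / 4) <= normc (H t).
  have : normc (om ^+ l' - om ^+ l) <= normc (H t) + normc (G t * cexp (- t) - om ^+ l').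
    have -> : om ^+ l' - om ^+ l = H t - (G t * cexp (- t) - om ^+ l') by rewrite /H; ring.
    exact: ler_normcB.
  by move: far le2; lra.
(* From Y to t the distance to om^l passes from at most e / 4 to at least 3 e / 4; where it equals e
   / 2, no power of om can be within e / 4. *)
have [s /itvP s01 sE] : exists2 s, s \in `[(0 : R), 1] &
    normc (H (Y%:C + s%:C * (t - Y%:C))) = e / 2.
  apply: IVT => //; first exact: continuous_subspaceT.
  rewrite mul0r addr0 mul1r [Y%:C + _]addrC subrK.
  rewrite min_l ?max_r; last by move: l0 e4; rewrite -/(H _); lra.
    by move: l0 e4 => /=; rewrite -/(H _) => ? ?; apply/andP; split; lra.
  by move: l0 e4; rewrite -/(H _); lra.
set z := _ + _ in sE.
have Yz : Y <= Re z.
  rewrite /z; case: t Yt {le1 le2 le_l' e4 cH sE z} => a b /= Ya.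
  rewrite !mul0r !subr0 -subr_ge0.
  have -> : Y + s * (a - Y) - Y = s * (a - Y) by ring.
  by rewrite mulr_ge0 ?subr_ge0 // s01.
have [m le_m] := nG z; have [_ le3] := close _ _ Yz le_m.
have [eq_m|ne_m] := eqVneq (om ^+ m) (om ^+ l).
  by move: le3; rewrite eq_m -/(H z) sE; lra.
have := sep _ _ (om_mem m) (om_mem l) ne_m.
have : normc (om ^+ m - om ^+ l) <= normc (H z) + normc (G z * cexp (- z) - om ^+ m).
  have -> : om ^+ m - om ^+ l = H z - (G z * cexp (- z) - om ^+ m) by rewrite /H; ring.
  exact: ler_normcB.
by rewrite sE; move: le3; lra.
Qed.

(** [half_plane_growth] for G t and for G (- t) yields the two exponential terms. Their difference
    from G is bounded on both half-planes and on the strip between them, hence constant. *)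
Lemma entire_near_exp (om : C) (G : C -> C) : om ^+ q = 1 -> cdiff G -> near_exp om G ->
  exists a b c, [/\ a ^+ q = 1, b ^+ q = 1 & forall t, G t = a * cexp t + b * cexp (- t) + c].
Proof.
move=> om1 dG nG.
have [l [Y [Y0 lY]]] := half_plane_growth om1 dG nG.
have omV1 : om^-1 ^+ q = 1 by rewrite exprVn om1 invr1.
have dG' := cdiff_comp dG (cdiffN (@cdiff_id R)).
have nG' : near_exp om^-1 (fun t => G (- t)).
  move=> t; have [m le_m] := nG (- t); exists m; apply: le_trans le_m.
  by rewrite exprVn invrK opprK [X in _ - X]addrC.
have [l' [Y' [Y'0 lY']]] := half_plane_growth omV1 dG' nG'.
set a := om ^+ l in lY; set b := om^-1 ^+ l' in lY'.
have a1 : a ^+ q = 1 by rewrite -exprM mulnC exprM om1 expr1n.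
have b1 : b ^+ q = 1 by rewrite -exprM mulnC exprM omV1 expr1n.
have na : normc a = 1 by apply: norm_root.
have nb : normc b = 1 by apply: norm_root.
have dD : cdiff (fun t => G t - (a * cexp t + b * cexp (- t))).
  apply: cdiffB => //; apply: cdiffD; apply: cdiffM; try exact: cdiff_cst.
    exact: cdiff_cexp.
  exact: (cdiff_comp (@cdiff_cexp R) (cdiffN (@cdiff_id R))).
have M0 : 0 <= M by have [m] := nG 0; apply: le_trans; apply: normc_ge0.
pose Z := Num.max Y Y'; pose B := M + 2 + 4 * expR Z.
have eZ : 0 < expR Z by apply: expR_gt0.
have ReN (t : C) : Re (- t) = - Re t by case: t.
have bD t : normc (G t - (a * cexp t + b * cexp (- t))) <= B.
  have [le_Y|lt_Y] := leP Y (Re t).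
    have := lY _ le_Y => le1.
    have -> : G t - (a * cexp t + b * cexp (- t)) = (G t - a * cexp t) - b * cexp (- t) by ring.
    apply: (le_trans (ler_normcB _ _)); rewrite Normc.normcM nb mul1r normc_cexp ReN.
    have : expR (- Re t) <= 1 by rewrite -expR0 ler_expR oppr_le0 (le_trans Y0).
    by rewrite /B; move: le1; lra.
  have [le_Y|lt_Y'] := leP Y' (- Re t).
    have := lY' (- t); rewrite ReN opprK => /(_ le_Y) le1.
    have -> : G t - (a * cexp t + b * cexp (- t)) = (G t - b * cexp (- t)) - a * cexp t by ring.
    apply: (le_trans (ler_normcB _ _)); rewrite Normc.normcM na mul1r normc_cexp.
    have : expR (Re t) <= 1 by rewrite -expR0 ler_expR -[Re t]opprK oppr_le0 (le_trans Y'0).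
    by rewrite /B; move: le1; lra.
  have [m le_m] := nG t.
  have e1 : expR (Re t) <= expR Z by rewrite ler_expR le_max ltW.
  have e2 : expR (- Re t) <= expR Z by rewrite ler_expR le_max (ltW lt_Y') orbT.
  have -> : G t - (a * cexp t + b * cexp (- t)) =
     (G t - (om ^+ m * cexp t + (om ^+ m)^-1 * cexp (- t))) +
     ((om ^+ m * cexp t + (om ^+ m)^-1 * cexp (- t)) - (a * cexp t + b * cexp (- t))) by ring.
  apply: (le_trans (le_normcD _ _)).
  have le1 := ler_normcB (om ^+ m * cexp t + (om ^+ m)^-1 * cexp (- t)) (a * cexp t + b * cexp (- t)).
  have le2 := le_normcD (om ^+ m * cexp t) ((om ^+ m)^-1 * cexp (- t)).
  have le3 := le_normcD (a * cexp t) (b * cexp (- t)).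
  rewrite !normc_mulcexp Normc.normcV norm_root // invr1 !mul1r ReN in le2.
  rewrite !normc_mulcexp na nb !mul1r ReN in le3.
  by rewrite /B; move: le_m le1 le2 le3 e1 e2; lra.
exists a, b, (G 0 - (a * cexp 0 + b * cexp (- 0))); split=> // t.
by rewrite -(liouville dD bD t 0) addrC subrK.
Qed.

End ExponentialGrowth.

(** * Floquet eigenfunctions *)

Section FloquetEigenfunctions.
Context (R : realType) (d : nat) (q : 'I_d -> nat).
Hypothesis q_gt0 : forall j, (0 < q j)%N.
Local Notation C := R[i].
Local Notation normc := (@Normc.normc R).
Implicit Types (u v V : 'rV[int]_d -> C) (k : 'rV[C]_d) (n : 'rV[int]_d).

Lemma cexpX (z : C) m : cexp z ^+ m = cexp (m%:R * z).
Proof.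
elim: m => [|m IH]; first by rewrite mul0r cexp0 expr0.
by rewrite exprS IH -cexpD -[in RHS]addn1 natrD mulrDl mul1r addrC.
Qed.

Lemma cexp_neq0 (z : C) : cexp z != 0.
Proof.
apply/eqP => /(congr1 normc); rewrite normc_cexp Normc.normc0 => /eqP.
by rewrite gt_eqF // expR_gt0.
Qed.

Lemma cexp_2pii : cexp (2 * pi%:C * 'i%C) = 1 :> C.
Proof.
have -> : (2 * pi%:C * 'i%C : C) = 0 +i* (pi *+ 2).
  by apply/eqP; rewrite eq_complex /=; apply/andP; split; apply/eqP; ring.
by rewrite cexp_imZ cos2pi sin2pi expR0 mul1r mulr0.
Qed.

Definition omega (m : nat) : C := cexp (2 * pi%:C * 'i%C / m%:R).

Lemma omegaX m : (0 < m)%N -> omega m ^+ m = 1.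
Proof. by move=> m0; rewrite cexpX mulrC divfK ?cexp_2pii // pnatr_eq0 -lt0n. Qed.

Lemma omega_neq0 m : omega m != 0.
Proof. exact: cexp_neq0. Qed.

Lemma omega_primitive m l : (0 < l < m)%N -> omega m ^+ l != 1.
Proof.
move=> /andP[l0 lm]; have m0 : (0 < m)%N by apply: leq_trans lm.
have mR : (0 : R) < m%:R by rewrite ltr0n.
pose x : R := pi * (l%:R / m%:R).
have -> : omega m ^+ l = cexp (Complex 0 (x *+ 2)).
  rewrite cexpX; congr cexp.
  have -> : (m%:R : C) = (m%:R : R)%:C by rewrite rmorph_nat.
  have -> : (l%:R : C) = (l%:R : R)%:C by rewrite rmorph_nat.
  rewrite -fmorphV /x; apply/eqP; rewrite eq_complex /=; apply/andP; split; apply/eqP; ring.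
have x0 : 0 < x < pi.
  rewrite /x mulr_gt0 ?divr_gt0 ?pi_gt0 ?ltr0n //=.
  by rewrite gtr_pMr ?pi_gt0 // ltr_pdivrMr // mul1r ltr_nat.
rewrite cexp_imZ expR0 !mul1r; apply/eqP => -[c1 _].
have s0 := sin_gt0_pi x0; move: c1; rewrite cos_mulr2n => c1.
have : sin x ^+ 2 = 0 by rewrite sin2cos2; move: c1; rewrite mulr2n; lra.
by move/eqP; rewrite expf_eq0 /= gt_eqF.
Qed.

Lemma sum_omega m (l : nat) : (0 < m)%N ->
  \sum_(i < m) (omega m ^+ i) ^+ l = if (m %| l)%N then m%:R else 0.
Proof.
move=> m0; case: ifP => [/dvdnP[c ->]|ml].
  under eq_bigr do rewrite -exprM mulnA mulnC exprM omegaX // expr1n.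
  by rewrite sumr_const card_ord.
have ne : omega m ^+ l - 1 != 0.
  rewrite subr_eq0 (divn_eq l m) mulnC exprD exprM omegaX // expr1n mul1r.
  by apply: omega_primitive; rewrite ltn_mod m0 andbT lt0n; apply/negbT.
apply: (mulfI ne); rewrite mulr0.
under eq_bigr do rewrite exprAC.
by rewrite -subrX1 exprAC omegaX // expr1n subrr.
Qed.

Lemma phase0 j : phase (0 : 'rV[C]_d) j = 1.
Proof. by rewrite /phase mxE mulr0 cexp0. Qed.

Lemma floquet_bloch_sum (I : finType) k (c : I -> C) (F : I -> 'rV[int]_d -> C) :
  (forall i, floquet_bloch q k (F i)) ->
  floquet_bloch q k (fun n => \sum_i c i * F i n).
Proof.
by move=> Fk n j; rewrite mulr_sumr; apply: eq_bigr => i _; rewrite Fk mulrCA.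
Qed.

Lemma floquet_bloch_ext k u v : floquet_bloch q k u -> floquet_bloch q k v ->
  (forall w : cell q, u (cell_pt w) = v (cell_pt w)) -> forall n, u n = v n.
Proof.
move=> uk vk uv n; rewrite (bloch_basis_span n q_gt0 uk) (bloch_basis_span n q_gt0 vk).
by apply: eq_bigr => w _; rewrite uv.
Qed.

Lemma periodic_cell v : floquet_bloch q 0 v ->
  forall n, exists w : cell q, v n = v (cell_pt w).
Proof.
move=> v0 n.
have qj0 j : (q j)%:Z != 0 by rewrite eqz_nat -lt0n.
have [|w wE] := (cell_ptP q (\row_j (n 0%R j %% (q j)%:Z)%Z)).2.
  by move=> j; rewrite mxE modz_ge0 //= -ltzD1 subrK ltz_pmod // ltz_nat.
exists w; rewrite -wE (bloch_basis_span n q_gt0 v0).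
rewrite [RHS](bloch_basis_span _ q_gt0 v0); apply: eq_bigr => w' _; congr (_ * _).
by apply: eq_bigr => j _; rewrite mxE modz_mod phase0 !exp1rz.
Qed.

Lemma periodic_floquet0 V : Defs.periodic q V -> floquet_bloch q 0 V.
Proof.
move=> Vp n j; rewrite phase0 mul1r; apply: Vp; exists (e_ j); apply/rowP => l.
by rewrite !mxE; have [->|_] := eqVneq l j; rewrite ?andbF ?mulr0.
Qed.

Lemma bloch_varietyP V k (lam : C) : Defs.periodic q V ->
  bloch_variety q V (k, lam) <-> exists u, [/\ floquet_bloch q k u, exists n, u n != 0 &
    forall n, schroedinger V u n = lam * u n].
Proof.
move=> Vp; rewrite /bloch_variety /=; split.
  move=> det0; have : \det (floquet_mx q V k - lam%:M)^T = 0 by rewrite det_tr.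
  move/eqP/det0P => [x x0 xM].
  pose u n := \sum_(a < #|{: cell q}|) x 0 a * bloch_basis k (enum_val a) n.
  have uk : floquet_bloch q k u by apply: floquet_bloch_sum => a; apply: bloch_basisP.
  have ua a : u (cell_pt (enum_val a : cell q)) = x 0 a.
    rewrite /u (bigD1 a) //= bloch_basis_cell eqxx mulr1 big1 ?addr0 // => b ba.
    by rewrite bloch_basis_cell (inj_eq enum_val_inj) eq_sym (negPf ba) mulr0.
  exists u; split=> //.
    have /existsP[a xa] : [exists a, x 0 a != 0].
      apply: contraNT x0 => /existsPn x0; apply/eqP/rowP => a; rewrite mxE.
      by apply/eqP; have := x0 a; rewrite negbK.
    by exists (cell_pt (enum_val a : cell q)); rewrite ua.
  apply: (floquet_bloch_ext (schroedinger_bloch Vp uk)) => [n j|w].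
    by rewrite uk mulrCA.
  rewrite -(enum_rankK w); have := floquet_mxP V q_gt0 uk.
  move=> /colP/(_ (enum_rank w)); rewrite [RHS]mxE => <-.
  have -> : \col_(a < #|{: cell q}|) u (cell_pt (enum_val a)) = x^T.
    by apply/colP => a; rewrite !mxE ua.
  have : (floquet_mx q V k - lam%:M) *m x^T = 0.
    by apply: trmx_inj; rewrite trmx_mul trmxK xM trmx0.
  rewrite mulmxBl mul_scalar_mx => /eqP; rewrite subr_eq0 => /eqP ->.
  by rewrite !mxE ua.
move=> [u [uk [n un] uE]]; apply/eqP; rewrite -det_tr; apply/det0P.
exists (\row_(a < #|{: cell q}|) u (cell_pt (enum_val a))).
  apply: contraNneq un => /rowP u0; rewrite (bloch_basis_span n q_gt0 uk) big1 // => w _.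
  by have := u0 (enum_rank w); rewrite !mxE enum_rankK => ->; rewrite mul0r.
apply: trmx_inj; rewrite trmx_mul trmxK trmx0.
have -> : (\row_(a < #|{: cell q}|) u (cell_pt (enum_val a)))^T =
          \col_(a < #|{: cell q}|) u (cell_pt (enum_val a)).
  by apply/matrixP => a b; rewrite !mxE.
rewrite mulmxBl floquet_mxP // mul_scalar_mx; apply/colP => a.
by rewrite !mxE uE subrr.
Qed.

(** The variable w_j of the overview. *)
Definition step k j : C := cexp (2 * pi%:C * 'i%C * k 0 j / (q j)%:R).

Lemma stepX k j : step k j ^+ q j = phase k j.
Proof. by rewrite cexpX mulrC divfK // pnatr_eq0 -lt0n. Qed.

Lemma step_neq0 k j : step k j != 0.
Proof. exact: cexp_neq0. Qed.

(** The plane wave with multipliers [step k j]. Dividing by it makes a Floquet-Bloch function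
    periodic and moves k from the boundary condition into the coefficients of the operator. *)
Definition gauge k n : C := \prod_(i < d) step k i ^ n 0 i.

Lemma gauge_neq0 k n : gauge k n != 0.
Proof. by apply/prodf_neq0 => i _; rewrite expfz_neq0 // step_neq0. Qed.

Lemma gauge_shift k n (a : int) j : gauge k (n + a *: e_ j) = step k j ^ a * gauge k n.
Proof.
rewrite /gauge (bigD1 j) //= [in RHS](bigD1 j) //= !mxE !eqxx mulr1 mulrA.
rewrite expfzDr ?step_neq0 // [step k j ^ a * _]mulrC; congr (_ * _).
by apply: eq_bigr => i /negPf ij; rewrite !mxE ij andbF mulr0 addr0.
Qed.

Lemma gaugeD k n j : gauge k (n + e_ j) = step k j * gauge k n.
Proof. by rewrite -[e_ j]scale1r gauge_shift expr1z. Qed.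

Lemma gaugeB k n j : gauge k (n - e_ j) = (step k j)^-1 * gauge k n.
Proof. by rewrite -[- e_ j]scaleN1r gauge_shift exprN1. Qed.

Lemma gauge_floquet k u : floquet_bloch q k u ->
  floquet_bloch q 0 (fun n => (gauge k n)^-1 * u n).
Proof.
move=> uk n j; rewrite phase0 mul1r uk gauge_shift -stepX -exprnP invfM.
by rewrite mulrACA mulVf ?mul1r // expf_neq0 // step_neq0.
Qed.

Lemma gauge_eq V k u (lam : C) : (forall n, schroedinger V u n = lam * u n) ->
  let v n := (gauge k n)^-1 * u n in
  forall n, \sum_(j < d) (step k j * v (n + e_ j) + (step k j)^-1 * v (n - e_ j))
    + V n * v n = lam * v n.
Proof.
move=> uE v n; have := uE n; rewrite /schroedinger laplacianE => {}uE.
rewrite /v !mulrA [V n * _]mulrC [lam * _]mulrC -!mulrA -uE mulrDr; congr (_ + _).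
rewrite mulr_sumr; apply: eq_bigr => j _; rewrite gaugeD gaugeB.
move: (step k j) (step_neq0 k j) (gauge k n) (gauge_neq0 k n) => s s0 g g0.
by field; rewrite s0 g0.
Qed.

(** A sup-norm bound for the gauged operator without its hopping in direction j, hence independent
    of k_j; the sum over the cell is a crude bound for sup |V|. *)
Definition sbound k j V : R := \sum_(i < d | i != j) (normc (step k i) + normc (step k i)^-1)
  + \sum_(w : cell q) normc (V (cell_pt w)).

Lemma sum_cyclic (m : nat) (g : nat -> C) : g m = g 0%N ->
  \sum_(i < m) g i.+1 = \sum_(i < m) g i.
Proof.
case: m => [|m] gm; first by rewrite !big_ord0.
by rewrite big_ord_recr [RHS]big_ord_recl /= gm addrC.
Qed.

Lemma le_normc_sum (I : Type) (r : seq I) (P : pred I) (F : I -> C) :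
  normc (\sum_(i <- r | P i) F i) <= \sum_(i <- r | P i) normc (F i).
Proof.
apply: (big_ind2 (fun (x : C) y => normc x <= y)) => [|x1 y1 x2 y2 h1 h2|//].
  by rewrite Normc.normc0.
by apply: (le_trans (le_normcD _ _)); apply: lerD.
Qed.

(* A discrete Fourier transform in direction j alone turns the hopping in that
   direction into a diagonal term; the remaining terms are bounded
   independently of k_j. *)
Lemma eigenvalue_near k j V (lam : C) : Defs.periodic q V -> bloch_variety q V (k, lam) ->
  exists l : nat, normc (lam - (omega (q j) ^+ l * step k j + (omega (q j) ^+ l)^-1 * (step k j)^-1))
    <= (q j)%:R * sbound k j V.
Proof.
move=> Vp /(bloch_varietyP _ _ Vp)[u [uk [n0 un0] uE]].
pose v n := (gauge k n)^-1 * u n.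
have v_per := gauge_floquet uk; have vE := gauge_eq k uE.
rewrite -/v in v_per; rewrite /= -/v in vE.
have vn0 : v n0 != 0 by rewrite mulf_neq0 // invr_eq0 gauge_neq0.
have [w0 v0E] := periodic_cell v_per n0.
(* The estimate is run at a point where |v| attains its maximum S. *)
have [wm _ wmax] := @arg_maxP _ R (cell q) w0 xpredT (fun w => normc (v (cell_pt w))) isT.
set S := normc (v (cell_pt wm)) in wmax.
have S_max n : normc (v n) <= S by have [w ->] := periodic_cell v_per n; apply: wmax.
have S0 : 0 < S.
  apply: lt_le_trans (S_max n0); rewrite lt_neqAle normc_ge0 andbT eq_sym.
  by apply: contra_neq vn0; apply: Normc.eq0_normc.
pose om := omega (q j).
have om0 : om != 0 by apply: omega_neq0.
(* By the eigenvalue equation [r] consists of the potential and the hopping in the other directions,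
   which [sbound] controls. *)
pose r n := lam * v n - step k j * v (n + e_ j) - (step k j)^-1 * v (n - e_ j).
have r_le n : normc (r n) <= sbound k j V * S.
  have -> : r n = \sum_(i < d | i != j) (step k i * v (n + e_ i) + (step k i)^-1 * v (n - e_ i)) + V n * v n.
    rewrite /r -vE (bigD1 j) //=.
    move: (step k j * _) ((step k j)^-1 * _) (\sum_(i < d | i != j) _) (V n * _) => a b s w.
    by rewrite -!addrA [a + _]addrC; ring.
  apply: (le_trans (le_normcD _ _)); rewrite /sbound mulrDl; apply: lerD.
    apply: (le_trans (le_normc_sum _ _ _)); rewrite mulr_suml; apply: ler_sum => i _.
    apply: (le_trans (le_normcD _ _)); rewrite mulrDl.
    rewrite (Normc.normcM (step k i)) (Normc.normcM (step k i)^-1) (Normc.normcV (step k i)).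
    by apply: lerD; apply: ler_wpM2l; rewrite ?invr_ge0 ?normc_ge0.
  rewrite Normc.normcM; apply: ler_pM; rewrite ?normc_ge0 //.
  have [w ->] := periodic_cell (periodic_floquet0 Vp) n.
  rewrite (bigD1 w) //= lerDl sumr_ge0 // => ? _; exact: normc_ge0.
pose hat (f : 'rV[int]_d -> C) l n := \sum_(m < q j) om ^- (l * m) * f (n + m%:Z *: e_ j).
have hat_shift (f : 'rV[int]_d -> C) l n : (forall n, f (n + (q j)%:Z *: e_ j) = f n) ->
    hat (fun n => f (n + e_ j)) l n = om ^+ l * hat f l n.
  move=> f_per; rewrite mulr_sumr.
  pose g (m : nat) := om ^+ l * (om ^- (l * m) * f (n + m%:Z *: e_ j)).
  rewrite -(@sum_cyclic (q j) g); last first.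
    rewrite /g muln0 scale0r addr0 f_per expr0 mulnC exprM omegaX // expr1n.
    by [].
  apply: eq_bigr => m _; rewrite /g mulnS exprD invfM !mulrA mulfV ?expf_neq0 // mul1r.
  have -> : (m.+1)%:Z = m%:Z + 1 by rewrite intS addrC.
  by rewrite scalerDl scale1r addrA.
have v_perj n : v (n + (q j)%:Z *: e_ j) = v n by rewrite v_per phase0 mul1r.
have hatr l n : hat r l n = (lam - (om ^+ l * step k j + (om ^+ l)^-1 * (step k j)^-1)) * hat v l n.
  have h1 := hat_shift v l n v_perj.
  have h2 : hat (fun n => v (n - e_ j)) l n = (om ^+ l)^-1 * hat v l n.
    apply: (mulfI (x := om ^+ l)); first by rewrite expf_neq0.
    rewrite mulrA mulfV ?expf_neq0 // mul1r -hat_shift => [|p]; last first.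
      by rewrite addrAC v_perj.
    by rewrite /hat; apply: eq_bigr => m _; rewrite addrK.
  have -> : (lam - (om ^+ l * step k j + (om ^+ l)^-1 * (step k j)^-1)) * hat v l n =
     lam * hat v l n - step k j * (om ^+ l * hat v l n) -
     (step k j)^-1 * ((om ^+ l)^-1 * hat v l n).
    by move: (step k j)^-1 ((om ^+ l)^-1) (step k j) (om ^+ l) => a b a' b'; ring.
  rewrite -h1 -h2 /hat !mulr_sumr -!sumrB; apply: eq_bigr => m _.
  by rewrite /r !mulrBr; congr (_ - _ - _); exact: mulrCA.
have hat_inv n : \sum_(l < q j) hat v l n = (q j)%:R * v n.
  rewrite /hat exchange_big /=.
  under eq_bigr => m _ do rewrite -mulr_suml.
  (* Inverse powers are turned into powers with exponent q_j - 1, which is prime to q_j, so that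
     [sum_omega] applies. *)
  have om_sum m : \sum_(i < q j) om ^- (i * m) = if (q j %| m)%N then (q j)%:R else 0.
    have oV l : om ^- l = om ^+ (l * (q j).-1).
      apply: (mulIf (x := om ^+ l)); rewrite ?expf_neq0 // mulVf ?expf_neq0 //.
      by rewrite -exprD addnC -mulnS prednK // mulnC exprM omegaX // expr1n.
    under eq_bigr do rewrite oV -mulnA exprM.
    rewrite sum_omega // Gauss_dvdl //.
    by case: (q j) (q_gt0 j) => // Q _; rewrite coprimeSn.
  rewrite (bigD1 (Ordinal (q_gt0 j))) //= om_sum dvdn0 scale0r addr0 big1 ?addr0 // => m.
  rewrite -val_eqE /= -lt0n => m0; rewrite om_sum gtnNdvd ?mul0r //.
(* Were lam far from every diagonal entry, each Fourier coefficient of v would have modulus below S;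
   but at the maximum point the q_j coefficients add up to q_j v, of modulus q_j S. *)
apply: contrapT => /forallNP far.
have B0 : 0 <= sbound k j V.
  by rewrite /sbound addr_ge0 // sumr_ge0 // => ? _; rewrite ?addr_ge0 ?normc_ge0.
have hat_lt l n : normc (hat v l n) < S.
  have le1 : normc (hat r l n) <= (q j)%:R * (sbound k j V * S).
    apply: (le_trans (le_normc_sum _ _ _)).
    rewrite mulr_natl -[X in _ *+ X]card_ord -sumr_const; apply: ler_sum => m _.
    rewrite Normc.normcM Normc.normcV normcX.
    have -> : normc om = 1.
      apply/eqP; rewrite -(@pexpr_eq1 _ _ (q j)) ?normc_ge0 //.
      by rewrite -normcX omegaX // Normc.normc1.
    by rewrite expr1n invr1 mul1r.
  rewrite ltNge; apply/negP => leS; apply: (far l).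
  rewrite -(ler_pM2r S0) -mulrA; apply: le_trans le1.
  rewrite hatr Normc.normcM; apply: ler_wpM2l => //; exact: normc_ge0.
have : normc (\sum_(l < q j) hat v l (cell_pt wm)) < (q j)%:R * S.
  apply: (le_lt_trans (le_normc_sum _ _ _)).
  rewrite mulr_natl -[X in _ *+ X]card_ord -sumr_const.
  apply: ltr_sum => [|l _]; last exact: hat_lt.
  by apply/hasP; exists (Ordinal (q_gt0 j)); rewrite ?mem_index_enum.
rewrite hat_inv Normc.normcM -(rmorph_nat (real_complex R)) /= expr0n addr0 sqrtr_sqr.
by rewrite ger0_norm // ltxx.
Qed.

End FloquetEigenfunctions.

(** * Entire sections of the Bloch variety *)

Section EntireSections.
Context (R : realType) (d : nat) (q : 'I_d -> nat).
Hypothesis q_gt0 : forall j, (0 < q j)%N.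
Local Notation C := R[i].
Local Notation normc := (@Normc.normc R).
Implicit Types (k : 'rV[C]_d) (f : 'rV[C]_d -> C) (j : 'I_d) (t : C).

Definition upd k j t : 'rV[C]_d := \row_i (if i == j then t else k 0 i).

Lemma updE k j t i : upd k j t 0 i = if i == j then t else k 0 i.
Proof. by rewrite mxE. Qed.

Lemma upd_id k j : upd k j (k 0 j) = k.
Proof. by apply/rowP => i; rewrite updE; case: eqP => [->|]. Qed.

Lemma upd_upd k j t s : upd (upd k j t) j s = upd k j s.
Proof. by apply/rowP => i; rewrite !updE; case: eqP. Qed.

Lemma updC k i j t s : i != j -> upd (upd k i t) j s = upd (upd k j s) i t.
Proof.
move=> ij; apply/rowP => l; rewrite !updE.
by have [->|//] := eqVneq l j; rewrite eq_sym (negPf ij).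
Qed.

Lemma upd_shift k j t h : upd k j (t + h) = h *: delta_mx 0 j + upd k j t.
Proof.
apply/rowP => i; rewrite !mxE /= ; case: eqP => _ /=.
  by rewrite mulr1 addrC.
by rewrite mulr0 add0r.
Qed.

Lemma upd_invariant (T : Type) (g : 'rV[C]_d -> T) :
  (forall k j t, g (upd k j t) = g k) -> forall k k', g k = g k'.
Proof.
move=> gU k k'.
pose h (s : seq 'I_d) := \row_i (if i \in s then k' 0 i else k 0 i) : 'rV[C]_d.
have hE s : g (h s) = g k.
  elim: s => [|j s IH].
    by congr g; apply/rowP => i; rewrite mxE in_nil.
  rewrite -IH -(gU (h s) j (k' 0 j)); congr g; apply/rowP => i.
  by rewrite updE !mxE inE; case: eqP => [->|].
rewrite -(hE (enum 'I_d)); congr g; apply/rowP => i.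
by rewrite mxE mem_enum.
Qed.

Lemma entire_cdiff f k j : entire f -> cdiff (fun t => f (upd k j t)).
Proof.
move=> fE t0.
have /cvg_ex[/= D fD] := @diff_derivable _ _ _ _ _ (delta_mx 0 j) (fE (upd k j t0)).
exists D => e e0.
have eC : (0 : C) < e%:C by rewrite ltcR.
move/cvgrPdist_le/(_ _ eC): fD; rewrite near_withinE near_simpl.
move=> /nbhs_ballP[r /= r0 rP].
have rE : r = (complex.Re r)%:C by rewrite RRe_real // gtr0_real.
have r1 : 0 < complex.Re r by rewrite -ltcR -rE.
exists (complex.Re r / 2) => [|h hr]; first by rewrite divr_gt0.
have [->|h0] := eqVneq h 0.
  by rewrite addr0 subrr mulr0 subr0 Normc.normc0 mulr0.
have hr1 : `|h| < r.
  rewrite rE -[`|h|]/((normc h)%:C) ltcR.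
  by apply: (le_lt_trans hr); rewrite ltr_pdivrMr // ltr_pMr // ltr1n.
have := rP h; rewrite /ball_ /= sub0r normrN => /(_ hr1 h0).
rewrite -upd_shift => le1.
have {}le1 : normc (D - h^-1 * (f (upd k j (t0 + h)) - f (upd k j t0))) <= e.
  by rewrite -lecR.
have -> : f (upd k j (t0 + h)) - f (upd k j t0) - D * h =
    - ((D - h^-1 * (f (upd k j (t0 + h)) - f (upd k j t0))) * h) by field.
by rewrite normcN Normc.normcM ler_wpM2r ?normc_ge0.
Qed.

Lemma step_upd k j t i : step q (upd k j t) i =
  if i == j then cexp (2 * pi%:C * 'i%C * t / (q j)%:R) else step q k i.
Proof. by rewrite /step updE; case: eqP => [->|]. Qed.

Lemma sbound_upd k j t V : sbound q (upd k j t) j V = sbound q k j V.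
Proof.
by rewrite /sbound; congr (_ + _); apply: eq_bigr => i /negPf ij; rewrite step_upd ij.
Qed.

(* The value of k_j at which e^{2 pi i k_j / q_j} = e^t. *)
Definition rescale j t : C := t * (q j)%:R / (2 * pi%:C * 'i%C).

Lemma pii_neq0 : (2 * pi%:C * 'i%C : C) != 0.
Proof.
rewrite !mulf_neq0 ?pnatr_eq0 //.
  by rewrite eq_complex /= negb_and gt_eqF ?pi_gt0.
by rewrite eq_complex /= oner_eq0 andbF.
Qed.

Lemma step_rescale k j t : step q (upd k j (rescale j t)) j = cexp t.
Proof.
rewrite step_upd eqxx /rescale; congr cexp.
have q0 : (q j)%:R != 0 :> C by rewrite pnatr_eq0 -lt0n.
by have := pii_neq0; move: (2 * pi%:C * 'i%C : C) => x x0; field; rewrite q0 x0.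
Qed.

Lemma upd_rescale k j : exists t, upd k j (rescale j t) = k /\ step q k j = cexp t.
Proof.
have q0 : (q j)%:R != 0 :> C by rewrite pnatr_eq0 -lt0n.
have e : rescale j (k 0 j * (2 * pi%:C * 'i%C) / (q j)%:R) = k 0 j.
  rewrite /rescale; have := pii_neq0; move: (2 * pi%:C * 'i%C : C) => x x0.
  by field; rewrite q0 x0.
exists (k 0 j * (2 * pi%:C * 'i%C) / (q j)%:R); rewrite e upd_id; split=> //.
by rewrite -(step_rescale k j) e upd_id.
Qed.

(** * The form of an entire section *)

Section Form.
Variables (V : 'rV[int]_d -> C) (f : 'rV[C]_d -> C).
Hypotheses (Vp : Defs.periodic q V) (fE : entire f).
Hypothesis fV : forall k, bloch_variety q V (k, f k).

Lemma section_one_variable k j : exists a b c, [/\ a ^+ q j = 1, b ^+ q j = 1 &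
  forall t, f (upd k j (rescale j t)) = a * cexp t + b * cexp (- t) + c].
Proof.
apply: (@entire_near_exp _ (q j) ((q j)%:R * sbound q k j V) (q_gt0 j) (omega R (q j))).
- exact: omegaX.
- apply: (@cdiff_comp _ (fun t => f (upd k j t))); first exact: entire_cdiff.
  rewrite /rescale; apply: cdiffM; last exact: cdiff_cst.
  by apply: cdiffM; [exact: cdiff_id|exact: cdiff_cst].
move=> t; have [l] := eigenvalue_near q_gt0 j Vp (fV (upd k j (rescale j t))).
by rewrite step_rescale sbound_upd cexpN => ?; exists l.
Qed.

(* With E = e^t running over 1, -1 and i, these combinations of values of
   a E + b / E + c extract a and b. *)
Definition mean_pm k j := (f (upd k j (rescale j 0)) + f (upd k j (rescale j (pi%:C * 'i%C)))) / 2.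
Definition diff_pm k j := (f (upd k j (rescale j 0)) - f (upd k j (rescale j (pi%:C * 'i%C)))) / 2.
Definition diff_i k j := (f (upd k j (rescale j ((pi / 2)%:C * 'i%C))) - mean_pm k j) / 'i%C.
Definition coef_a k j := (diff_pm k j + diff_i k j) / 2.
Definition coef_b k j := (diff_pm k j - diff_i k j) / 2.

Lemma coef_abP k j a b c :
  (forall t, f (upd k j (rescale j t)) = a * cexp t + b * cexp (- t) + c) ->
  coef_a k j = a /\ coef_b k j = b.
Proof.
move=> fj; have i0 : 'i%C != 0 :> C by rewrite eq_complex /= oner_eq0 andbF.
have e0 : cexp 0 = 1 :> C by rewrite cexp0.
have epi : cexp (pi%:C * 'i%C) = -1 :> C.
  have -> : (pi%:C * 'i%C : C) = 0 +i* pi.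
    by apply/eqP; rewrite eq_complex /=; apply/andP; split; apply/eqP; ring.
  rewrite cexp_imZ cospi sinpi expR0 mulr0 mul1r.
  by apply/eqP; rewrite eq_complex /= oppr0 !eqxx.
have ehalf : cexp ((pi / 2)%:C * 'i%C) = 'i%C :> C.
  have -> : ((pi / 2)%:C * 'i%C : C) = 0 +i* (pi / 2).
    by apply/eqP; rewrite eq_complex /=; apply/andP; split; apply/eqP; ring.
  by rewrite cexp_imZ cos_pihalf sin_pihalf expR0 mulr0 mulr1.
have ii : 'i%C * 'i%C = -1 :> C by rewrite -expr2 sqr_i.
have iV : 'i%C^-1 = - 'i%C :> C by apply: (mulfI i0); rewrite mulfV // mulrN ii opprK.
have m : mean_pm k j = c.
  by rewrite /mean_pm !fj !cexpN e0 epi invrN1 invr1; field.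
have dp : diff_pm k j = a + b.
  by rewrite /diff_pm !fj !cexpN e0 epi invrN1 invr1; field.
have di : diff_i k j = a - b.
  rewrite /diff_i m fj !cexpN ehalf iV.
  have -> : (a * 'i%C + b * (- 'i%C) + c - c) * (- 'i%C) = - (a - b) * ('i%C * 'i%C) by ring.
  by rewrite ii mulrN1 opprK.
by rewrite /coef_a /coef_b dp di; split; field.
Qed.

Lemma cdiff_coef k j i : i != j ->
  cdiff (fun t => coef_a (upd k i t) j) /\ cdiff (fun t => coef_b (upd k i t) j).
Proof.
move=> ij.
have dv s : cdiff (fun t => f (upd (upd k i t) j s)).
  have := @entire_cdiff f (upd k j s) i fE; congr cdiff; apply/funext => t.
  by rewrite (@updC k i j t s ij).
have dm : cdiff (fun t => mean_pm (upd k i t) j).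
  by apply: cdiffM; [exact: cdiffD|exact: cdiff_cst].
have dd : cdiff (fun t => diff_pm (upd k i t) j).
  by apply: cdiffM; [exact: cdiffB|exact: cdiff_cst].
have di : cdiff (fun t => diff_i (upd k i t) j).
  by apply: cdiffM; [exact: cdiffB|exact: cdiff_cst].
by split; (apply: cdiffM; last exact: cdiff_cst); [exact: cdiffD|exact: cdiffB].
Qed.

Lemma coef_root k j : coef_a k j ^+ q j = 1 /\ coef_b k j ^+ q j = 1.
Proof. by have [a [b [c [a1 b1 /coef_abP[-> ->]]]]] := section_one_variable k j. Qed.

Lemma normc_root (z : C) m : (0 < m)%N -> z ^+ m = 1 -> normc z = 1.
Proof.
move=> m0 z1; apply/eqP; rewrite -(@pexpr_eq1 _ _ m) ?normc_ge0 //.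
by rewrite -normcX z1 Normc.normc1.
Qed.

(** As functions of another variable k_i the coefficients are entire, being combinations of values
    of f, and have modulus one, so Liouville's theorem applies; k_j itself is overwritten in their
    definition. *)
Lemma coef_const j k k' : coef_a k j = coef_a k' j /\ coef_b k j = coef_b k' j.
Proof.
suff [ca cb] : (forall k i t, coef_a (upd k i t) j = coef_a k j) /\
               (forall k i t, coef_b (upd k i t) j = coef_b k j).
  by split; [apply: (upd_invariant ca)|apply: (upd_invariant cb)].
have cjj k0 i t : i != j -> coef_a (upd k0 i t) j = coef_a k0 j /\ coef_b (upd k0 i t) j = coef_b k0 j.
  move=> /(cdiff_coef k0)[da db].
  have ba s : normc (coef_a (upd k0 i s) j) <= 1.
    by rewrite (normc_root (q_gt0 j) (coef_root _ j).1).
  have bb s : normc (coef_b (upd k0 i s) j) <= 1.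
    by rewrite (normc_root (q_gt0 j) (coef_root _ j).2).
  by rewrite (liouville da ba t (k0 0 i)) (liouville db bb t (k0 0 i)) upd_id.
split=> k0 i t; have [->|ij] := eqVneq i j; try by case: (cjj k0 i t ij).
  by rewrite /coef_a /diff_pm /diff_i /mean_pm !upd_upd.
by rewrite /coef_b /diff_pm /diff_i /mean_pm !upd_upd.
Qed.

Theorem entire_section_form : exists (a b : 'I_d -> C) c,
  [/\ forall j, a j ^+ q j = 1, forall j, b j ^+ q j = 1 &
    forall k, f k = \sum_j (a j * step q k j + b j * (step q k j)^-1) + c].
Proof.
pose a j := coef_a 0 j; pose b j := coef_b 0 j.
pose g k := f k - \sum_j (a j * step q k j + b j * (step q k j)^-1).
have gU k j t : g (upd k j t) = g k.
  have [a' [b' [c [_ _ fj]]]] := section_one_variable k j.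
  have [aE bE] := coef_abP fj; have [aE' bE'] := coef_const j 0 k.
  have gs s : g (upd k j (rescale j s)) =
      c - \sum_(i < d | i != j) (a i * step q k i + b i * (step q k i)^-1).
    rewrite /g fj (bigD1 j) //= step_rescale /a /b aE' bE' aE bE cexpN.
    rewrite (eq_bigr (fun i => a i * step q k i + b i * (step q k i)^-1)).
      move: (\sum_(i < d | _) _) (cexp s) (cexp s)^-1 => S x y; ring.
    by move=> i /negPf ij; rewrite step_upd ij.
  have [s [kE _]] := upd_rescale k j; rewrite -[in RHS]kE gs.
  have [s' [kE' _]] := upd_rescale (upd k j t) j.
  by rewrite -kE' upd_upd gs.
exists a, b, (g 0); split=> [j|j|k]; try by have [] := coef_root 0 j.
by rewrite -(upd_invariant gU k 0) /g addrC subrK.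
Qed.

End Form.
End EntireSections.

(** * The characteristic polynomial *)

Section CharacteristicPolynomial.
Context (R : realType) (d : nat) (q : 'I_d -> nat).
Hypothesis q_gt0 : forall j, (0 < q j)%N.
Local Notation C := R[i].
Implicit Types (k : 'rV[C]_d) (t : R) (V : 'rV[int]_d -> C) (phi : R -> C).

Definition circ t : C := cexp (2 * pi%:C * 'i%C * t%:C).

Lemma circ_neq0 t : circ t != 0.
Proof. exact: cexp_neq0. Qed.

Lemma circE t : circ t = (cos (pi *+ 2 * t)) +i* (sin (pi *+ 2 * t)).
Proof.
have -> : circ t = cexp (0 +i* (pi *+ 2 * t)).
  rewrite /circ; congr cexp; apply/eqP; rewrite eq_complex /=.
  by apply/andP; split; apply/eqP; ring.
by rewrite cexp_imZ expR0 !mul1r.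
Qed.

Lemma poly_circ_eq0 (p : {poly C}) : (forall t, p.[circ t] = 0) -> p = 0.
Proof.
move=> p0; apply/eqP; apply: contraT => pn0.
(* The angles 2 pi t become pi / (n + 1), distinct points of the interval on which cos is
   injective. *)
pose tn (n : nat) : R := (2 * n.+1%:R)^-1.
have tn0 n : 0 < tn n by rewrite invr_gt0 mulr_gt0.
have := @max_poly_roots _ p [seq circ (tn n) | n <- iota 0 (size p)] pn0.
rewrite size_map size_iota ltnn => -> //.
  by apply/allP => _ /mapP[n _ ->]; apply/eqP/p0.
rewrite map_inj_uniq ?iota_uniq // => m n; rewrite !circE => -[cmn _].
have pi0 : 0 < pi *+ 2 :> R by rewrite mulrn_wgt0 // pi_gt0.
have in0pi x : pi *+ 2 * tn x \in `[0 : R, pi].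
  rewrite in_itv /=; apply/andP; split; first by rewrite mulr_ge0 // ltW.
  have -> : pi *+ 2 * tn x = pi * x.+1%:R^-1.
    have : (x.+1%:R : R) != 0 by rewrite pnatr_eq0.
    by rewrite /tn; move: (x.+1%:R : R) => y y0; field.
  by rewrite ger_pMr ?pi_gt0 // invf_le1 ?ltr0n // ler1n.
have := cos_inj (in0pi m) (in0pi n) cmn.
have n2 : (2 : R) != 0 by rewrite pnatr_eq0.
move/(mulfI (lt0r_neq0 pi0))/invr_inj/(mulfI n2).
by move/eqP; rewrite eqr_nat => /eqP[].
Qed.

(* Laurent polynomials in circ t, as functions of t. *)
Definition laurent phi := exists K (p : {poly C}), forall t, phi t * circ t ^+ K = p.[circ t].

(** Multiplying by the polynomial with roots B extends the vanishing to the whole circle, and a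
    nonzero polynomial can be cancelled afterwards. *)
Lemma laurent_eq0 phi (B : seq C) : laurent phi ->
  (forall t, circ t \notin B -> phi t = 0) -> forall t, phi t = 0.
Proof.
move=> [K [p phip]] phiB.
have : p * \prod_(b <- B) ('X - b%:P) = 0.
  apply: poly_circ_eq0 => t; rewrite hornerM -phip.
  have [tB|/phiB ->] := boolP (circ t \in B); last by rewrite !mul0r.
  by rewrite (_ : (\prod_(b <- B) _).[_] = 0) ?mulr0 //; apply/eqP; rewrite -[_ == 0]/(root _ _) root_prod_XsubC.
move/eqP; rewrite mulf_eq0 (negPf (monic_neq0 (monic_prod_XsubC _ _ _))) orbF => /eqP p0 t.
have := phip t; rewrite p0 horner0 => /eqP.
by rewrite mulf_eq0 expf_eq0 (negPf (circ_neq0 t)) andbF orbF => /eqP.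
Qed.

Lemma laurent_cst c : laurent (fun=> c).
Proof. by exists 0%N, c%:P => t; rewrite hornerC expr0 mulr1. Qed.

Lemma laurent_ext phi psi : phi =1 psi -> laurent phi -> laurent psi.
Proof. by move=> e [K [p pE]]; exists K, p => t; rewrite -e. Qed.

Lemma laurentD phi psi : laurent phi -> laurent psi -> laurent (fun t => phi t + psi t).
Proof.
move=> [K [p pE]] [L [r rE]]; exists (K + L)%N, (p * 'X^L + r * 'X^K) => t.
by rewrite hornerD !hornerM !hornerXn -pE -rE exprD; ring.
Qed.

Lemma laurentM phi psi : laurent phi -> laurent psi -> laurent (fun t => phi t * psi t).
Proof.
move=> [K [p pE]] [L [r rE]]; exists (K + L)%N, (p * r) => t.
by rewrite hornerM -pE -rE exprD mulrACA.
Qed.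

Lemma laurentN phi : laurent phi -> laurent (fun t => - phi t).
Proof. by move=> [K [p pE]]; exists K, (- p) => t; rewrite hornerN -pE mulNr. Qed.

Lemma laurent_sum (I : Type) (r : seq I) (P : pred I) (F : I -> R -> C) :
  (forall i, P i -> laurent (F i)) -> laurent (fun t => \sum_(i <- r | P i) F i t).
Proof.
move=> lF; elim: r => [|i r IH].
  by apply: laurent_ext (laurent_cst 0) => t; rewrite big_nil.
case Pi: (P i); last by apply: laurent_ext IH => t; rewrite big_cons Pi.
by apply: laurent_ext (laurentD (lF i Pi) IH) => t; rewrite big_cons Pi.
Qed.

Lemma laurent_prod (I : Type) (r : seq I) (P : pred I) (F : I -> R -> C) :
  (forall i, P i -> laurent (F i)) -> laurent (fun t => \prod_(i <- r | P i) F i t).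
Proof.
move=> lF; elim: r => [|i r IH].
  by apply: laurent_ext (laurent_cst 1) => t; rewrite big_nil.
case Pi: (P i); last by apply: laurent_ext IH => t; rewrite big_cons Pi.
by apply: laurent_ext (laurentM (lF i Pi) IH) => t; rewrite big_cons Pi.
Qed.

Lemma laurent_exprz (c : C) (m : nat) (z : int) : laurent (fun t => (c * circ t ^+ m) ^ z).
Proof.
case: z => n.
  exists 0%N, ((c *: 'X^m) ^+ n) => t; rewrite expr0 mulr1.
  by rewrite horner_exp hornerZ hornerXn.
exists (m * n.+1)%N, (c ^- n.+1)%:P => t; rewrite hornerC NegzE.
rewrite -[in LHS]invr_expz -exprnP exprMn invfM -exprM -mulrA mulVf ?mulr1 //.
by rewrite expf_neq0 // circ_neq0.
Qed.

(** The speed q_j (j + 1) multiplies w_j by s^(j+1), where s is [circ t], and [phase] by an integral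
    power of s, so the matrix entries are Laurent polynomials in s. *)
Definition kline k t : 'rV[C]_d := \row_j (k 0 j + ((q j * j.+1)%:R : C) * t%:C).

Lemma kline0 k : kline k 0 = k.
Proof. by apply/rowP => j; rewrite mxE rmorph0 mulr0 addr0. Qed.

Lemma step_kline k t j : step q (kline k t) j = step q k j * circ t ^+ j.+1.
Proof.
rewrite /step /circ cexpX -cexpD mxE natrM; congr cexp.
have q0 : (q j)%:R != 0 :> C by rewrite pnatr_eq0 -lt0n.
by field.
Qed.

Lemma phase_kline k t j : phase (kline k t) j = phase k j * circ t ^+ (q j * j.+1).
Proof. by rewrite -!(stepX q_gt0) step_kline exprMn -exprM mulnC. Qed.

Lemma laurent_floquet_mx V k a b : laurent (fun t => floquet_mx q V (kline k t) a b).
Proof.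
have lbb w n : laurent (fun t => bloch_basis (q := q) (kline k t) w n).
  apply: (@laurent_prod _ _ _ (fun j t => if (n 0%R j %% (q j)%:Z)%Z == (w j : nat)%:Z
    then phase (kline k t) j ^ (n 0%R j %/ (q j)%:Z)%Z else 0)) => j _.
  case: eqP => _; last exact: laurent_cst.
  apply: (laurent_ext (phi := fun t => (phase k j * circ t ^+ (q j * j.+1)) ^ (n 0%R j %/ (q j)%:Z)%Z)).
    by move=> t; rewrite phase_kline.
  exact: laurent_exprz.
pose x := cell_pt (enum_val a : cell q); pose w := (enum_val b : cell q).
apply: (laurent_ext (phi := fun t => \sum_(j < d)
  (bloch_basis (q := q) (kline k t) w (x + e_ j) + bloch_basis (q := q) (kline k t) w (x - e_ j))
  + V x * bloch_basis (q := q) (kline k t) w x)).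
  by move=> t; rewrite mxE /schroedinger laplacianE.
apply: laurentD; last by apply: laurentM => //; apply: laurent_cst.
by apply: laurent_sum => j _; apply: laurentD.
Qed.

Lemma laurent_det V k (lam : C) : laurent (fun t => \det (lam%:M - floquet_mx q V (kline k t))).
Proof.
pose M t i j := lam *+ (i == j) - floquet_mx q V (kline k t) i j.
apply: (laurent_ext (phi := fun t => \sum_(s : {perm 'I_#|{: cell q}|})
    (-1) ^+ s * \prod_i M t i (s i))).
  move=> t; apply: eq_bigr => s _; congr (_ * _); apply: eq_bigr => i _.
  by rewrite mxE [X in X + _]mxE [X in _ + X]mxE.
apply: laurent_sum => s _; apply: laurentM; first exact: laurent_cst.
apply: (@laurent_prod _ _ _ (fun i t => M t i (s i))) => i _.
apply: laurentD; first exact: laurent_cst.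
by apply: laurentN; exact: laurent_floquet_mx.
Qed.

(** The Laurent polynomial sum_j (al_j s^(j+1) + be_j / s^(j+1)) + c, multiplied by s^d. Its 2 d + 1
    exponents are distinct, whence [lpoly_eq0]. *)
Definition lpoly (al be : 'I_d -> C) (c : C) : {poly C} :=
  \sum_(j < d) (al j *: 'X^(d + j.+1) + be j *: 'X^(d - j.+1)) + c *: 'X^d.

Lemma horner_lpoly al be c (s : C) : s != 0 ->
  (lpoly al be c).[s] = s ^+ d * (\sum_(j < d) (al j * s ^+ j.+1 + be j * (s ^+ j.+1)^-1) + c).
Proof.
move=> s0; rewrite hornerD horner_sum hornerZ hornerXn mulrDr mulr_sumr [c * _]mulrC.
congr (_ + _); apply: eq_bigr => j _; rewrite hornerD !hornerZ !hornerXn mulrDr.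
rewrite exprD mulrCA; congr (_ + _); rewrite [RHS]mulrCA; congr (_ * _).
by rewrite expfB_cond // (negPf s0) add0n ltn_ord.
Qed.

Lemma lpoly_eq0 al be c : lpoly al be c = 0 -> (forall j, al j = 0 /\ be j = 0) /\ c = 0.
Proof.
move=> l0; have coefl i : \sum_(j < d) (al j * (i == d + j.+1)%N%:R + be j * (i == d - j.+1)%N%:R)
    + c * (i == d)%:R = 0.
  have := congr1 (fun p : {poly C} => p`_i) l0; rewrite coef0 coefD coef_sum coefZ coefXn => li.
  rewrite -[RHS]li.
  by congr (_ + _); apply: eq_bigr => j _; rewrite coefD !coefZ !coefXn.
split=> [j|].
  split.
    have := coefl (d + j.+1)%N; rewrite (bigD1 j) //= eqxx mulr1.
    have -> : (d + j.+1 == d - j.+1)%N = false by lia.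
    have -> : (d + j.+1 == d)%N = false by lia.
    rewrite !mulr0 !addr0 big1 ?addr0 // => i ij.
    have -> : (d + j.+1 == d + i.+1)%N = false.
      by apply/negbTE; move: ij; rewrite -val_eqE /=; lia.
    have -> : (d + j.+1 == d - i.+1)%N = false by lia.
    by rewrite !mulr0 addr0.
  have lj := ltn_ord j.
  have := coefl (d - j.+1)%N; rewrite (bigD1 j) //= eqxx mulr1.
  have -> : (d - j.+1 == d + j.+1)%N = false by lia.
  have -> : (d - j.+1 == d)%N = false by lia.
  rewrite !mulr0 add0r addr0 big1 ?addr0 // => i ij.
  have -> : (d - j.+1 == d + i.+1)%N = false by lia.
  have -> : (d - j.+1 == d - i.+1)%N = false.
    by apply/negbTE; have := ltn_ord i; move: ij; rewrite -val_eqE /=; lia.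
  by rewrite !mulr0 addr0.
have := coefl d; rewrite eqxx mulr1 big1 ?add0r // => j _.
have lj := ltn_ord j.
have -> : (d == d + j.+1)%N = false by lia.
have -> : (d == d - j.+1)%N = false by lia.
by rewrite !mulr0 addr0.
Qed.

(** The value of the section at k + l ([step_kshift]). Adding the integer vector l does not change
    the Floquet matrix, so all Q values are eigenvalues at k. *)
Definition mu (a b : 'I_d -> C) (c : C) k (l : cell q) : C :=
  \sum_j (a j * (omega R (q j) ^+ l j * step q k j) +
          b j * (omega R (q j) ^+ l j * step q k j)^-1) + c.

Lemma mu_kline a b c k t l : mu a b c (kline k t) l =
  \sum_j (a j * omega R (q j) ^+ l j * step q k j * circ t ^+ j.+1 +
          b j * (omega R (q j) ^+ l j * step q k j)^-1 * (circ t ^+ j.+1)^-1) + c.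
Proof.
congr (_ + c); apply: eq_bigr => j _; rewrite step_kline.
by congr (_ + _); rewrite mulrA ?invfM ?mulrA //; rewrite mulrA.
Qed.

Lemma omega_exp_inj m i j : (0 < m)%N -> (i < m)%N -> (j < m)%N ->
  omega R m ^+ i = omega R m ^+ j -> i = j.
Proof.
move=> m0; wlog le_ij : i j / (i <= j)%N => [hw lt_i lt_j e|lt_i lt_j].
  by have [le_ij|/ltnW le_ji] := leqP i j; [apply: hw|apply/esym/hw].
rewrite -(subnKC le_ij) exprD -[LHS]mulr1 => /(mulfI (expf_neq0 _ (omega_neq0 R m))) /esym e.
have [//|ne] := eqVneq i j; first by move=> ->; rewrite subnn addn0.
have : (0 < j - i < m)%N by rewrite subn_gt0 ltn_neqAle ne le_ij /=; lia.
by move/(omega_primitive R); rewrite e eqxx.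
Qed.

Lemma floquet_mx_phase V k k' : (forall j, phase k j = phase k' j) ->
  floquet_mx q V k = floquet_mx q V k'.
Proof.
move=> kk'; have bE w : bloch_basis (q := q) k w = bloch_basis (q := q) k' w.
  by apply/funext => n; rewrite /bloch_basis; apply: eq_bigr => j _; rewrite kk'.
by apply/matrixP => a b; rewrite [LHS]mxE [RHS]mxE bE.
Qed.

Definition kshift k (l : cell q) : 'rV[C]_d := \row_j (k 0 j + (l j)%:R).

Lemma step_kshift k l j : step q (kshift k l) j = omega R (q j) ^+ l j * step q k j.
Proof.
rewrite /step /omega cexpX -cexpD mxE; congr cexp.
have q0 : (q j)%:R != 0 :> C by rewrite pnatr_eq0 -lt0n.
by field.
Qed.

Lemma phase_kshift k l j : phase (kshift k l) j = phase k j.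
Proof.
rewrite -!(stepX q_gt0) step_kshift exprMn exprAC omegaX // expr1n mul1r.
by [].
Qed.

(** Where the Q values are distinct they are all the roots. Along [kline] two of them meet only at
    zeros of [D l l'], a nonzero polynomial because [a j] is nonzero. At a fixed spectral parameter
    both sides are Laurent in s and agree off finitely many s, hence also at t = 0. *)
Lemma char_poly_section V a b c : (forall j, a j != 0) ->
  (forall k, bloch_variety q V (k, \sum_j (a j * step q k j + b j * (step q k j)^-1) + c)) ->
  forall k, char_poly (floquet_mx q V k) = \prod_(l : cell q) ('X - (mu a b c k l)%:P).
Proof.
move=> a0 fV k.
have mu_root k' l : root (char_poly (floquet_mx q V k')) (mu a b c k' l).
  rewrite rootE PolySystem.horner_char_poly -(floquet_mx_phase V (phase_kshift k' l)).
  have := fV (kshift k' l); rewrite /bloch_variety /= => det0.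
  have -> : mu a b c k' l = \sum_j (a j * step q (kshift k' l) j + b j * (step q (kshift k' l) j)^-1) + c.
    by rewrite /mu; congr (_ + _); apply: eq_bigr => j _; rewrite step_kshift.
  by rewrite -opprB -scaleN1r detZ det0 mulr0.
have prodE k' : injective (mu a b c k') ->
    char_poly (floquet_mx q V k') = \prod_(l : cell q) ('X - (mu a b c k' l)%:P).
  move=> inj; pose rs := [seq mu a b c k' l | l <- enum {: cell q}].
  have sz : size (char_poly (floquet_mx q V k')) = (size rs).+1.
    by rewrite size_char_poly size_map -cardE.
  have rs_root : all (root (char_poly (floquet_mx q V k'))) rs.
    by apply/allP => _ /mapP[l _ ->].
  have rs_uniq : uniq_roots rs by rewrite uniq_rootsE map_inj_uniq // enum_uniq.
  rewrite (all_roots_prod_XsubC sz rs_root rs_uniq).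
  by rewrite (monicP (char_poly_monic _)) scale1r big_map big_enum.
pose D (l l' : cell q) := lpoly
  (fun j => a j * omega R (q j) ^+ l j * step q k j - a j * omega R (q j) ^+ l' j * step q k j)
  (fun j => b j * (omega R (q j) ^+ l j * step q k j)^-1 -
            b j * (omega R (q j) ^+ l' j * step q k j)^-1) 0.
have D0 l l' : l != l' -> D l l' != 0.
  apply: contra_neq => /lpoly_eq0[al0 _]; apply/ffunP => j; apply: val_inj => /=.
  have [/eqP + _] := al0 j; rewrite -mulrBl mulf_eq0 (negPf (step_neq0 _ _ _)) orbF.
  rewrite -mulrBr mulf_eq0 (negPf (a0 j)) /= subr_eq0 => /eqP.
  by apply: omega_exp_inj.
(* Every s at which two of the Q values coincide is a root of this product. *)
pose P := \prod_(l : cell q) \prod_(l' : cell q | l != l') D l l'.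
have P0 : P != 0 by apply/prodf_neq0 => l _; apply/prodf_neq0 => l' /D0.
have [B PB] := closed_field_poly_normal P.
have injB t : circ t \notin B -> injective (mu a b c (kline k t)).
  move=> tB l l' ll'; apply/eqP; apply: contraNT tB => ne.
  rewrite -root_prod_XsubC -(rootZ _ _ (_ : lead_coef P != 0)) ?lead_coef_eq0 // -PB.
  have Dt : (D l l').[circ t] = 0.
    rewrite horner_lpoly ?circ_neq0 // addr0; apply/eqP; rewrite mulf_eq0; apply/orP; right.
    move/eqP: ll'; rewrite !mu_kline (inj_eq (addIr c)) -subr_eq0.
    by rewrite -sumrB; congr (_ == 0); apply: eq_bigr => j _; ring.
  rewrite rootE /P (bigD1 l) //= hornerM (bigD1 l') //= hornerM Dt !mul0r //.
pose phi (lam : C) t := \det (lam%:M - floquet_mx q V (kline k t)) -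
   \prod_(l : cell q) (lam - mu a b c (kline k t) l).
have lphi lam : laurent (phi lam).
  apply: laurentD; first exact: laurent_det.
  apply/laurentN/laurent_prod => l _; apply: laurentD; first exact: laurent_cst.
  apply: laurentN.
  apply: (laurent_ext (phi := fun t => \sum_j (a j * omega R (q j) ^+ l j * step q k j * circ t ^+ j.+1 +
          b j * (omega R (q j) ^+ l j * step q k j)^-1 * (circ t ^+ j.+1)^-1) + c)).
    by move=> t; rewrite mu_kline.
  apply: laurentD; last exact: laurent_cst.
  apply: laurent_sum => j _; apply: laurentD; apply: laurentM; try exact: laurent_cst.
    have := laurent_exprz 1 j.+1 1; apply: laurent_ext => t.
    by rewrite expr1z mul1r.
  have := laurent_exprz 1 j.+1 (-1); apply: laurent_ext => t.
  by rewrite exprN1 mul1r.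
have phi0 lam : phi lam 0 = 0.
  apply: (laurent_eq0 (lphi lam)) => t /injB/prodE pE; rewrite /phi.
  rewrite -PolySystem.horner_char_poly pE horner_prod; apply/eqP; rewrite subr_eq0; apply/eqP.
  by apply: eq_bigr => l _; rewrite hornerXsubC.
(* Here [circ t] only supplies infinitely many values of the spectral parameter. *)
apply/eqP; rewrite -subr_eq0; apply/eqP/poly_circ_eq0 => t.
have := phi0 (circ t); rewrite /phi kline0 -PolySystem.horner_char_poly hornerD hornerN horner_prod.
by under [in X in _ -> X]eq_bigr do rewrite hornerXsubC.
Qed.

End CharacteristicPolynomial.

(** * Separable potentials *)

Section Existence.
Context (R : realType) (d : nat) (q : 'I_d -> nat).
Hypothesis q_gt0 : forall j, (0 < q j)%N.
Local Notation C := R[i].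
Local Notation normc := (@Normc.normc R).

Lemma cdiff_differentiable (g : C -> C) (z : C) : cdiff g -> differentiable (g : C^o -> C^o) (z : C^o).
Proof.
move=> dg; have [D gD] := dg z; apply/derivable1_diffP/cvg_ex; exists D.
apply/cvgrPdist_le => e e0.
have eE : e = (complex.Re e)%:C by rewrite RRe_real // gtr0_real.
have e1 : 0 < complex.Re e by rewrite -ltcR -eE.
have [r r0 rP] := gD _ e1.
have rC : (0 : C) < r%:C by rewrite ltcR.
near=> h.
have h0 : h != 0 by near: h; exact: nbhs_dnbhs_neq.
have hr : `|h| <= r%:C by near: h; apply: dnbhs0_le.
have {}hr : normc h <= r by rewrite -lecR.
rewrite /= [h *: 1](mulr1 h) [h + z]addrC.
have -> : D - h^-1 *: (g (z + h) - g z) = - (h^-1 * (g (z + h) - g z - D * h)).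
  by rewrite /GRing.scale /=; field.
rewrite normrN eE -[`|_|]/((normc _)%:C) lecR Normc.normcM Normc.normcV.
have nh : 0 < normc h.
  by rewrite lt_neqAle normc_ge0 andbT eq_sym; apply: contra_neq h0; apply: Normc.eq0_normc.
by rewrite mulrC ler_pdivrMr // rP.
Unshelve. all: by end_near. Qed.

Lemma entire_step j : entire (fun k : 'rV[C]_d => step q k j) /\
  entire (fun k : 'rV[C]_d => (step q k j)^-1).
Proof.
have dc (g : C -> C) : cdiff g -> entire (fun k : 'rV[C]_d => g (k 0 j)).
  move=> dg k; apply: (@differentiable_comp _ _ _ _ (fun k : 'rV[C]_d => (k 0 j : C^o)) (g : C^o -> C^o)).
    exact: differentiable_coord.
  exact: cdiff_differentiable.
have dlin : cdiff (fun t : C => 2 * pi%:C * 'i%C * t / (q j)%:R).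
  apply: cdiffM; last exact: cdiff_cst.
  by apply: cdiffM; [exact: cdiff_cst|exact: cdiff_id].
split; first exact: (dc _ (cdiff_comp (@cdiff_cexp R) dlin)).
have := dc _ (cdiff_comp (@cdiff_cexp R) (cdiffN dlin)).
by congr entire; apply/funext => k; rewrite cexpN.
Qed.

Lemma entire_section (b : 'I_d -> C) :
  entire (fun k : 'rV[C]_d => \sum_j (step q k j + b j * (step q k j)^-1)).
Proof.
move=> k; have -> : (fun k : 'rV[C]_d => \sum_j (step q k j + b j * (step q k j)^-1) : C^o) =
   \sum_j ((fun k : 'rV[C]_d => step q k j : C^o) + b j *: (fun k : 'rV[C]_d => (step q k j)^-1 : C^o)).
  by apply/funext => k'; rewrite fct_sumE.
apply: differentiable_sum => j; apply: differentiableD; first exact: (entire_step j).1.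
apply: differentiableZ; exact: (entire_step j).2.
Qed.

(* Dickson polynomials of the first kind: D_n (x + al / x) = x^n + (al / x)^n. *)
Fixpoint dickson (al : C) (n : nat) : {poly C} :=
  match n with
  | 0 => 2%:P
  | n'.+1 => match n' with
             | 0 => 'X
             | n''.+1 => 'X * dickson al n' - al *: dickson al n''
             end
  end.

Lemma dicksonSS al n : dickson al n.+2 = 'X * dickson al n.+1 - al *: dickson al n.
Proof. by []. Qed.

Lemma dickson_monic al n : dickson al n.+1 \is monic /\ size (dickson al n.+1) = n.+2.
Proof.
suff : [/\ dickson al n.+1 \is monic, size (dickson al n.+1) = n.+2 &
           (size (dickson al n) <= n.+1)%N] by case.
elim: n => [|n [m1 s1 s0]].
  split; [exact: monicX|exact: size_polyX|exact: size_polyC_leq1].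
have sz : size ('X * dickson al n.+1) = n.+3.
  by rewrite size_monicM ?monicX ?monic_neq0 // size_polyX s1.
have lt_s : (size (- (al *: dickson al n)) < size ('X * dickson al n.+1)%R)%N.
  by rewrite sz size_polyN (leq_ltn_trans (size_scale_leq _ _)) // ltnS (leq_trans s0).
rewrite dicksonSS; split; last by rewrite s1.
  by rewrite monicE lead_coefDl // -monicE monicMl ?monicX.
by rewrite size_polyDl.
Qed.

Lemma dickson_horner al n (x : C) : x != 0 ->
  (dickson al n).[x + al / x] = x ^+ n + (al / x) ^+ n.
Proof.
move=> x0; suff : (dickson al n).[x + al / x] = x ^+ n + (al / x) ^+ n /\
  (dickson al n.+1).[x + al / x] = x ^+ n.+1 + (al / x) ^+ n.+1 by case.
elim: n => [|n [IH0 IH1]]; first by rewrite hornerC hornerX !expr0 !expr1.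
split=> //; rewrite dicksonSS hornerD hornerN hornerZ hornerM hornerX IH0 IH1.
have : al = x * (al / x) by rewrite mulrC divfK.
by move: (al / x) => y ->; rewrite !exprS; ring.
Qed.

(** * The one-dimensional equation and its monodromy *)

Section OneDimension.
Variables (m : nat) (V : nat -> C) (lam z : C).
Hypotheses (m_gt0 : (0 < m)%N) (z0 : z != 0).
Let v j := lam - V j.
Hypothesis trE : PolySystem.monodromy_trace v m = z + z^-1.

Lemma recur_linear y x r : PolySystem.recur v y x r =
  (y * (PolySystem.recur v 1 0 r).1 + x * (PolySystem.recur v 0 1 r).1,
   y * (PolySystem.recur v 1 0 r).2 + x * (PolySystem.recur v 0 1 r).2).
Proof.
elim: r => [|r IH]; first by rewrite /= !mulr1 !mulr0 addr0 add0r.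
by rewrite !PolySystem.recurS IH /=; congr (_, _); ring.
Qed.

Lemma wronskian r : (PolySystem.recur v 0 1 r).2 * (PolySystem.recur v 1 0 r).1 -
  (PolySystem.recur v 1 0 r).2 * (PolySystem.recur v 0 1 r).1 = 1.
Proof.
elim: r => [|r IH]; first by rewrite /= mulr1 mul0r subr0.
by rewrite !PolySystem.recurS /= -[RHS]IH; ring.
Qed.

(** The monodromy matrix has determinant 1 ([wronskian]) and trace z + 1/z, so z is an eigenvalue.
    [det0] is the characteristic equation at z, and the cases are split according to a nonzero
    off-diagonal entry. *)
Lemma monodromy_eigenvector : exists y x, (y != 0) || (x != 0) /\
  PolySystem.recur v y x m = (z * y, z * x).
Proof.
have w1 := wronskian m; have := trE; rewrite /PolySystem.monodromy_trace.
have rl y x := recur_linear y x m.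
move: (PolySystem.recur v 0 1 m) (PolySystem.recur v 1 0 m) w1 rl => [c' c] [s' s] /= w1 rl tr.
have det0 : s * c' = (c - z) * (s' - z).
  have -> : (c - z) * (s' - z) = c * s' - z * (c + s') + z ^+ 2 by ring.
  rewrite tr mulrDr mulfV // -w1; ring.
have [s0|sn0] := eqVneq s 0; last first.
  exists (z - c), s; rewrite sn0 orbT rl; split=> //; congr (_, _); last by ring.
  by rewrite [s * c']det0; ring.
have [c0|cn0] := eqVneq c' 0; last first.
  exists c', (z - s'); rewrite cn0 rl; split=> //; congr (_, _); first by ring.
  have -> : c' * s + (z - s') * c = (s * c' - (c - z) * (s' - z)) + z * (z - s') by ring.
  by rewrite det0 subrr add0r.
have [e|ne] := eqVneq s' z.
  by exists 1, 0; rewrite oner_neq0 rl s0 e; split=> //; congr (_, _); ring.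
have cz : c = z.
  apply/eqP; rewrite -subr_eq0; move/eqP: det0.
  by rewrite s0 mul0r eq_sym mulf_eq0 [s' - z == 0]subr_eq0 (negPf ne) orbF.
by exists 0, 1; rewrite oner_neq0 orbT rl c0 cz; split=> //; congr (_, _); ring.
Qed.

(** The recurrence over one period, started from a monodromy eigenvector, is continued with a factor
    z per period; the equation needs care only where two periods meet. *)
Lemma one_dim_solution : exists u : int -> C,
  [/\ exists n, u n != 0, forall n, u (n + m%:Z) = z * u n &
      forall n, u (n + 1) + u (n - 1) = (lam - V (absz (n %% m%:Z)%Z)) * u n].
Proof.
have [y [x [xy0 rec_m]]] := monodromy_eigenvector.
pose U r := (PolySystem.recur v y x r).2.
have U0 : U 0%N = x by [].
have U1 r : (PolySystem.recur v y x r.+1).1 = U r by rewrite PolySystem.recurS.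
have Um : U m = z * x by rewrite /U rec_m.
have Um1 : U m.-1 = z * y by rewrite -U1 prednK // rec_m.
have mZ : m%:Z != 0 by rewrite eqz_nat -lt0n.
pose u (n : int) := z ^ (n %/ m%:Z)%Z * U (absz (n %% m%:Z)%Z).
have uE c r : (r < m)%N -> u (c * m%:Z + r%:Z) = z ^ c * U r.
  move=> rm; rewrite /u divzMDl // divz_small ?addr0; last by rewrite lez_nat ltz_nat.
  by rewrite modzMDl modz_small // lez_nat ltz_nat.
have nE (n : int) : exists c r, (r < m)%N /\ n = c * m%:Z + r%:Z.
  exists (n %/ m%:Z)%Z, (absz (n %% m%:Z)%Z); have ge0 := modz_ge0 n mZ.
  split; last by rewrite gez0_abs // -divz_eq.
  by rewrite -ltz_nat gez0_abs // ltz_pmod // ltz_nat.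
have zS c : z ^ (c + 1) = z * z ^ c by rewrite expfzDr // expr1z mulrC.
have zP c : z * z ^ (c - 1) = z ^ c by rewrite -zS subrK.
exists u; split.
- case/orP: xy0 => [yn0|xn0].
    exists (-1 * m%:Z + m.-1%:Z); rewrite uE ?prednK // Um1 exprN1 mulrA mulVf // mul1r.
    by [].
  by exists (0 * m%:Z + 0%:Z); rewrite uE // expr0z mul1r.
- move=> n; have [c [r [rm ->]]] := nE n.
  have -> : c * m%:Z + r%:Z + m%:Z = (c + 1) * m%:Z + r%:Z by ring.
  by rewrite !uE // zS mulrA.
- move=> n; have [c [r [rm ->]]] := nE n.
  have -> : absz ((c * m%:Z + r%:Z) %% m%:Z)%Z = r.
    by rewrite modzMDl modz_small // lez_nat ltz_nat.
  have up : u (c * m%:Z + r%:Z + 1) = z ^ c * U r.+1.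
    have [lt_r|le_r] := ltnP r.+1 m.
      by rewrite -addrA -[r%:Z + 1]/(r%:Z + 1%:Z) -PoszD addn1 uE.
    have rE : r.+1 = m by apply/eqP; rewrite eqn_leq rm le_r.
    have -> : c * m%:Z + r%:Z + 1 = (c + 1) * m%:Z + 0%:Z.
      by rewrite -rE -addn1 PoszD; ring.
    by rewrite uE // zS rE Um U0; ring.
  have dn : u (c * m%:Z + r%:Z - 1) = z ^ c * (PolySystem.recur v y x r).1.
    case: r rm up => [|r] rm _.
      have -> : c * m%:Z + 0%:Z - 1 = (c - 1) * m%:Z + m.-1%:Z.
        have -> : m%:Z = m.-1%:Z + 1 by rewrite -{1}(prednK m_gt0) -addn1 PoszD.
        by ring.
      by rewrite uE ?prednK // Um1 mulrA [_ * z]mulrC zP.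
    have -> : c * m%:Z + r.+1%:Z - 1 = c * m%:Z + r%:Z.
      by rewrite -addn1 PoszD; ring.
    by rewrite uE ?(ltnW rm) // U1.
  rewrite up dn uE // {1}/U PolySystem.recurS /= -/(U r) /v; ring.
Qed.

End OneDimension.

(** As al^q = 1, the Dickson polynomial takes at w + al / w the value w^q + w^(-q), the trace
    required for the multiplier w^q. A potential in direction j with this discriminant thus has the
    eigenvalue w_j + al / w_j for every k_j. Products of one-dimensional solutions solve the
    equation for the sum of the potentials, and the eigenvalues add up. *)
Lemma separable_section (m : cell q) : exists V : 'rV[int]_d -> C,
  Defs.periodic q V /\
  forall k, bloch_variety q V (k, \sum_j (step q k j + omega R (q j) ^+ m j * (step q k j)^-1)).
Proof.
have [W WE] : exists W : 'I_d -> nat -> C, forall j lam,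
    PolySystem.monodromy_trace (fun i => lam - W j i) (q j) = (dickson (omega R (q j) ^+ m j) (q j)).[lam].
  apply: (@fin_all_exists _ (fun=> nat -> C) (fun j (Wj : nat -> C) => forall lam : C,
    PolySystem.monodromy_trace (fun i => lam - Wj i) (q j) = (dickson (omega R (q j) ^+ m j) (q j)).[lam])) => j.
  have := q_gt0 j; case: (q j) (m j) => // n mj _.
  have [mon sz] := dickson_monic (omega R n.+1 ^+ mj) n.
  exact: PolySystem.monodromy_trace_solvable.
pose V (n : 'rV[int]_d) := \sum_j W j (absz (n 0%R j %% (q j)%:Z)%Z).
have Vp : Defs.periodic q V.
  move=> n _ [a ->]; apply: eq_bigr => j _; congr (W j (absz _)).
  by rewrite !mxE addrC mulrC modzMDl.
exists V; split=> // k; apply/(bloch_varietyP q_gt0 _ _ Vp).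
have al1 j : (omega R (q j) ^+ m j) ^+ q j = 1 by rewrite exprAC omegaX // expr1n.
pose lam j := step q k j + omega R (q j) ^+ m j / step q k j.
have /fin_all_exists[u uP] : forall j, exists u : int -> C,
    [/\ exists n, u n != 0, forall n, u (n + (q j)%:Z) = phase k j * u n &
      forall n, u (n + 1) + u (n - 1) = (lam j - W j (absz (n %% (q j)%:Z)%Z)) * u n].
  move=> j; apply: one_dim_solution => //; first exact: phase_neq0.
  rewrite WE dickson_horner ?step_neq0 // -(stepX q_gt0); congr (_ + _).
  by rewrite expr_div_n al1 mul1r.
exists (fun n => \prod_j u j (n 0%R j)).
have upd_prod (n n' : 'rV[int]_d) j : (forall i, i != j -> n' 0 i = n 0 i) ->
    \prod_i u i (n' 0 i) = u j (n' 0 j) * \prod_(i < d | i != j) u i (n 0 i).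
  by move=> nn'; rewrite (bigD1 j) //=; congr (_ * _); apply: eq_bigr => i /nn' ->.
have e_off (s : int) (n : 'rV[int]_d) j i : i != j -> (n + s *: e_ j) 0 i = n 0 i.
  by move=> /negPf ij; rewrite !mxE ij andbF mulr0 addr0.
have e_on (s : int) (n : 'rV[int]_d) j : (n + s *: e_ j) 0 j = n 0 j + s.
  by rewrite !mxE !eqxx mulr1.
split.
- move=> n j; rewrite (upd_prod n _ j) => [|i]; last exact: e_off.
  by rewrite e_on [in RHS](bigD1 j) //= mulrA; have [_ -> _] := uP j.
- have /fin_all_exists[n0 n0P] j : exists n, u j n != 0 by have [] := uP j.
  exists (\row_j n0 j); apply/prodf_neq0 => j _; rewrite mxE; exact: n0P.
move=> n; rewrite /schroedinger laplacianE.
have -> : V n * \prod_j u j (n 0 j) =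
    \sum_j W j (absz (n 0%R j %% (q j)%:Z)%Z) * \prod_i u i (n 0 i) by rewrite mulr_suml.
rewrite -big_split mulr_suml; apply: eq_bigr => j _ /=.
rewrite -[n + e_ j]/(n + e_ j) -{1}[e_ j]scale1r -[- e_ j]scaleN1r.
rewrite !(upd_prod n _ j) => [|//|i|i]; try exact: e_off.
rewrite !e_on; have [_ _ uj] := uP j.
rewrite -mulrDl uj -/(lam j); ring.
Qed.

End Existence.

(** * Counting *)

Section Cardinality.

(** An infinite A would contain n + 1 distinct elements, so bounding finite injections settles
    finiteness as well. *)
Lemma card_le_of_injections (T : Type) (A : set T) (n : nat) :
  (forall N (x : 'I_N -> T), injective x -> (forall i, A (x i)) -> (N <= n)%N) ->
  (A #<= `I_n)%card.
Proof.
move=> An; have le_n m : (`I_m #<= A)%card -> (m <= n)%N.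
  move=> /card_leP[f].
  have f_inj : injective (fun i : 'I_m => \val (f (ordII i))).
    move=> i j /val_inj ij; apply: val_inj.
    have /(congr1 \val) // : ordII i = ordII j.
    by apply: (@inj _ _ _ f) => //; apply: mem_set.
  exact: An f_inj (fun i => set_valP (f (ordII i))).
case: (pselect (finite_set A)) => [/finite_setP[m Am]|/infiniteP natA].
  have := Am; rewrite card_eq_le => /andP[le1 le2].
  by apply: (card_le_trans le1); rewrite card_le_II le_n.
have /le_n : (`I_n.+1 #<= A)%card by apply: card_le_trans natA; apply: card_leT.
by rewrite ltnn.
Qed.

Lemma card_finType_II (I : finType) : ([set: I] #= `I_#|I|)%card.
Proof.
rewrite card_eq_sym; apply: (card_eq_trans card_II).
rewrite card_eq_sym; have -> : [set: 'I_#|I|] = enum_rank @` [set: I].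
  by apply/seteqP; split=> // i _; exists (enum_val i) => //; apply: enum_valK.
rewrite card_eq_sym; apply: inj_card_eq => i j _ _; exact: enum_rank_inj.
Qed.

End Cardinality.

(** * Isospectrality classes and their sections *)

Section Classes.
Context (R : realType) (d : nat) (q : 'I_d -> nat).
Hypothesis q_gt0 : forall j, (0 < q j)%N.
Local Notation C := R[i].
Local Notation Q := #|{: cell q}|.
Implicit Types (V Y : 'rV[int]_d -> C) (k : 'rV[C]_d) (m : cell q).

Lemma card_cell_gt0 : (0 < Q)%N.
Proof. by rewrite card_cell prodn_gt0. Qed.

Lemma floquet_mx_potential V k : floquet_mx q V k =
  floquet_mx q (fun=> 0) k + diag_mx (\row_a V (cell_pt (enum_val a : cell q))).
Proof.
apply/matrixP => a b; rewrite [LHS]mxE [RHS]mxE [X in _ = X + _]mxE [X in _ = _ + X]mxE.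
rewrite [X in _ = _ + X *+ _]mxE /schroedinger mul0r addr0; congr (_ + _).
rewrite bloch_basis_cell (inj_eq enum_val_inj).
by case: eqP => _; rewrite ?mulr1 ?mulr0.
Qed.

Lemma tr_floquet_mx V k :
  \tr (floquet_mx q V k) = \tr (floquet_mx q (fun=> 0) k) + \sum_(w : cell q) V (cell_pt w).
Proof.
rewrite floquet_mx_potential mxtraceD mxtrace_diag; congr (_ + _).
rewrite [RHS](reindex (@enum_val (cell q) predT)) /=; last exact/onW_bij/enum_val_bij.
by apply: eq_bigr => a _; rewrite mxE.
Qed.

Lemma tr_section V a b c : (forall j, a j != 0) ->
  (forall k, bloch_variety q V (k, \sum_j (a j * step q k j + b j * (step q k j)^-1) + c)) ->
  forall k, \tr (floquet_mx q V k) = \sum_(l : cell q) mu a b c k l.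
Proof.
move=> a0 fV k; apply: oppr_inj; rewrite -char_poly_trace ?card_cell_gt0 //.
rewrite (char_poly_section q_gt0 a0 fV).
pose ps := [seq mu a b c k l | l <- enum {: cell q}].
have sz : size ps = Q by rewrite size_map -cardE.
have -> : \prod_(l : cell q) ('X - (mu a b c k l)%:P) = \prod_(z <- ps) ('X - z%:P).
  by rewrite big_map big_enum.
rewrite -sz coefPn_prod_XsubC; last by rewrite sz -lt0n card_cell_gt0.
by rewrite big_map big_enum.
Qed.

Lemma zero_section k : bloch_variety q (fun=> 0)
  (k, \sum_j (1 * step q k j + 1 * (step q k j)^-1) + 0).
Proof.
have p0 : Defs.periodic q (fun=> 0 : C) by move=> n g _.
apply/(bloch_varietyP q_gt0 _ _ p0); exists (gauge q k); split.
- by move=> n j; rewrite gauge_shift -(stepX q_gt0).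
- by exists 0; apply: gauge_neq0.
move=> n; rewrite /schroedinger laplacianE mul0r !addr0 mulr_suml.
by apply: eq_bigr => j _; rewrite gaugeD gaugeB !mul1r mulrDl.
Qed.

(** The traces of the Floquet matrices of V and of the zero potential differ by the sum of V over
    the cell. Computed from the eigenvalues along [kline], the same difference is Q c plus negative
    powers of s, and the constant terms are compared. *)
Lemma section_constant V b c :
  (forall k, bloch_variety q V (k, \sum_j (1 * step q k j + b j * (step q k j)^-1) + c)) ->
  Q%:R * c = \sum_(w : cell q) V (cell_pt w).
Proof.
move=> fV; have n1 (j : 'I_d) : (1 : C) != 0 by apply: oner_neq0.
have trV := tr_section n1 fV; have tr0 := tr_section n1 zero_section.
pose be j := \sum_(l : cell q) (b j - 1) * (omega R (q j) ^+ l j * step q 0 j)^-1.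
have /lpoly_eq0[_ /eqP] : lpoly (fun=> 0) be (Q%:R * c - \sum_(w : cell q) V (cell_pt w)) = 0.
  apply: poly_circ_eq0 => t; rewrite horner_lpoly ?circ_neq0 //.
  apply/eqP; rewrite mulf_eq0; apply/orP; right.
  have := tr_floquet_mx V (kline q 0 t); rewrite trV tr0 => trE.
  have -> : \sum_(w : cell q) V (cell_pt w) = \sum_(l : cell q) mu (fun=> 1) b c (kline q 0 t) l -
     \sum_(l : cell q) mu (fun=> 1) (fun=> 1) 0 (kline q 0 t) l by rewrite trE addrC addKr.
  rewrite -sumrB.
  have -> : \sum_(l : cell q) (mu (fun=> 1) b c (kline q 0 t) l -
      mu (fun=> 1) (fun=> 1) 0 (kline q 0 t) l) =
      \sum_j be j * (circ t ^+ j.+1)^-1 + Q%:R * c.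
    rewrite (eq_bigr (fun l : cell q => \sum_j ((b j - 1) *
      (omega R (q j) ^+ l j * step q 0 j)^-1 * (circ t ^+ j.+1)^-1) + c)).
      rewrite big_split /= exchange_big /= sumr_const mulr_natl; congr (_ + _).
      by apply: eq_bigr => j _; rewrite /be mulr_suml.
    move=> l _; rewrite !mu_kline // addr0 addrAC -sumrB; congr (_ + _).
    by apply: eq_bigr => j _; ring.
  rewrite (eq_bigr (fun j => be j * (circ t ^+ j.+1)^-1)) => [|j _]; last first.
    by rewrite mul0r add0r.
  by apply/eqP; move: (\sum_j _) (Q%:R * c) => x y; ring.
by rewrite subr_eq0 => /eqP.
Qed.

Lemma root_of_unity n (z : C) : (0 < n)%N -> z ^+ n = 1 -> exists l : 'I_n, z = omega R n ^+ l.
Proof.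
move=> n0 z1; have prim : n.-primitive_root (omega R n).
  rewrite /primitive_root_of_unity n0; apply/forallP => i; rewrite unity_rootE.
  have [e|ne] := eqVneq i.+1 n; first by rewrite e omegaX // eqxx.
  rewrite eqbF_neg; apply: omega_primitive.
  by rewrite /= ltn_neqAle ne ltn_ord.
by have [l ->] := prim_rootP prim z1; exists l.
Qed.

(* The class of the potentials having the section
   sum_j (w_j + omega_j^(m j) / w_j), where w_j = e^{2 pi i k_j / q_j}. *)
Definition has_section m V := forall k,
  bloch_variety q V (k, \sum_j (1 * step q k j + omega R (q j) ^+ m j * (step q k j)^-1) + 0).

Definition char_prod m k : {poly C} :=
  \prod_(l : cell q) ('X - (mu (fun=> 1) (fun j => omega R (q j) ^+ m j) 0 k l)%:P).

Lemma has_section_char_poly m V k : has_section m V ->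
  char_poly (floquet_mx q V k) = char_prod m k.
Proof. by move=> fV; apply: (char_poly_section q_gt0) => // j; apply: oner_neq0. Qed.

Lemma has_section_isospectral m V Y : has_section m V -> has_section m Y ->
  floquet_isospectral q V Y.
Proof. by move=> fV fY k; rewrite /spectrum !(has_section_char_poly _ fV, has_section_char_poly _ fY). Qed.

Lemma floquet_isospectral_trans V Y Z : floquet_isospectral q V Y ->
  floquet_isospectral q Y Z -> floquet_isospectral q V Z.
Proof. by move=> VY YZ k; rewrite VY YZ. Qed.

Lemma X_e_has_section V : X_e q V -> exists m, has_section m V.
Proof.
move=> [Vp V0 [f [fE fV]]].
have [a [b [c [a1 b1 fk]]]] := entire_section_form q_gt0 Vp fE fV.
have /fin_all_exists[la laE] := fun j => root_of_unity (q_gt0 j) (a1 j).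
have ab1 j : (a j * b j) ^+ q j = 1 by rewrite exprMn a1 b1 mulr1.
have /fin_all_exists[m mE] := fun j => root_of_unity (q_gt0 j) (ab1 j).
pose l : cell q := [ffun j => la j]; exists [ffun j => m j].
have a0 j : a j != 0 by rewrite laE expf_neq0 // omega_neq0.
have sec k : bloch_variety q V (k, \sum_j (1 * step q k j +
    omega R (q j) ^+ (finfun m : cell q) j * (step q k j)^-1) + c).
  (* Evaluating the section at k - l turns a_j w_j into w_j and b_j / w_j into a_j b_j / w_j, while
     the Floquet matrix is the one at k. *)
  pose k' : 'rV[C]_d := \row_j (k 0 j - (l j)%:R).
  have kk' : kshift k' l = k by apply/rowP => j; rewrite !mxE subrK.
  have := fV k'; rewrite /bloch_variety /= -(@floquet_mx_phase _ _ q V _ _ (phase_kshift q_gt0 k' l)) kk'.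
  rewrite fk; congr (\det (_ - _%:M) = 0); congr (_ + _); apply: eq_bigr => j _.
  have -> : step q k j = a j * step q k' j.
    by rewrite -kk' step_kshift // ffunE -laE.
  rewrite mul1r ffunE -mE; congr (_ + _).
  move: (step_neq0 q k' j) (a0 j); move: (step q k' j) (a j) (b j) => s x y s0 x0.
  by field; rewrite s0 x0.
have := section_constant sec; rewrite V0 => /eqP.
rewrite mulf_eq0 pnatr_eq0 (gtn_eqF card_cell_gt0) /= => /eqP c0.
by move=> k; have := sec k; rewrite c0.
Qed.

(** For each s the section of V is one of the Q branches of Y, so the product of the differences
    [D l] vanishes on the circle and one difference vanishes identically. Its coefficients at
    s^(j+1) force om_j^(l j) = 1, and those at the inverse powers then give m = m'. *)
Lemma has_section_inj m m' V Y : has_section m V -> has_section m' Y ->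
  floquet_isospectral q V Y -> m = m'.
Proof.
move=> fV fY VY.
pose om j := omega R (q j).
pose D (l : cell q) := lpoly (fun j => 1 - om j ^+ l j)
   (fun j => om j ^+ m j - om j ^+ m' j * (om j ^+ l j)^-1) 0.
have step0 j : step q (0 : 'rV[C]_d) j = 1 by rewrite /step mxE mulr0 mul0r cexp0.
have l0 : cell q := [ffun j => Ordinal (q_gt0 j)].
have : \prod_(l : cell q) D l = 0.
  apply: poly_circ_eq0 => t; rewrite horner_prod.
  (* The line through 0 consists of real quasimomenta, where isospectrality is available. *)
  pose kr : 'rV[R]_d := \row_j ((q j * j.+1)%:R * t).
  have krE : map_mx (real_complex R) kr = kline q 0 t.
    by apply/rowP => j; rewrite !mxE add0r rmorphM rmorph_nat.
  have := VY kr; rewrite /spectrum krE.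
  rewrite (has_section_char_poly _ fV) (has_section_char_poly _ fY).
  pose z0 := \sum_j (1 * step q (kline q 0 t) j + om j ^+ m j * (step q (kline q 0 t) j)^-1) + 0.
  move=> /(congr1 (fun g => g z0)) mupE.
  have root0 : root (char_prod m' (kline q 0 t)) z0.
    have ch0 : char_prod m (kline q 0 t) != 0 by rewrite monic_neq0 // monic_prod_XsubC.
    have ch1 : char_prod m' (kline q 0 t) != 0 by rewrite monic_neq0 // monic_prod_XsubC.
    rewrite -dvdp_XsubCl XsubC_dvd // -mupE -XsubC_dvd // dvdp_XsubCl.
    rewrite -(has_section_char_poly _ fV) rootE PolySystem.horner_char_poly.
    have := fV (kline q 0 t); rewrite /bloch_variety /= -/z0 => det0.
    by rewrite -opprB -scaleN1r detZ det0 mulr0.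
  move: root0; rewrite rootE horner_prod => /eqP/eqP/prodf_eq0[l _].
  rewrite hornerXsubC subr_eq0 => /eqP zE.
  apply/eqP/prodf_eq0; exists l => //; rewrite horner_lpoly ?circ_neq0 // addr0.
  rewrite mulf_eq0; apply/orP; right; move/eqP: zE; rewrite -subr_eq0 mu_kline // /z0 !addr0.
  rewrite -sumrB; congr (_ == 0); apply: eq_bigr => j _.
  rewrite step_kline // step0 !mulr1 !mul1r mulrBl mulrBl; ring.
move/eqP/prodf_eq0 => [l _ /eqP/lpoly_eq0[Dl _]].
apply/ffunP => j; apply: val_inj; have [al be] := Dl j.
have ol : om j ^+ l j = 1 by apply: subr0_eq; rewrite -opprB al oppr0.
apply: (@omega_exp_inj R _ _ _ (q_gt0 j)); [exact: ltn_ord|exact: ltn_ord|].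
by apply: subr0_eq; move: be; rewrite ol invr1 mulr1.
Qed.

Lemma has_section_exists m : exists V, X_e q V /\ has_section m V.
Proof.
have [V [Vp secV]] := separable_section R q_gt0 m.
have hV : has_section m V.
  by move=> k; rewrite addr0; under eq_bigr do rewrite mul1r; apply: secV.
exists V; split=> //; split=> //.
  by rewrite -(section_constant hV) mulr0.
exists (fun k => \sum_j (step q k j + omega R (q j) ^+ m j * (step q k j)^-1)); split=> //.
exact: entire_section.
Qed.

Lemma has_section_count m N (V : 'I_N -> 'rV[int]_d -> C) : injective V ->
  (forall r, Defs.periodic q (V r)) -> (forall r, has_section m (V r)) -> (N <= Q`!)%N.
Proof.
move=> V_inj Vp Vsec.
apply: (@PolySystem.char_poly_addmx_diag_count _ _ (floquet_mx q (fun=> 0) 0) (char_prod m 0) N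
  (fun r a => V r (cell_pt (enum_val a : cell q)))) => [r|r s rs].
  by rewrite -floquet_mx_potential; apply: has_section_char_poly.
apply: V_inj; apply/funext; apply: (floquet_bloch_ext q_gt0).
- exact: periodic_floquet0 (Vp r).
- exact: periodic_floquet0 (Vp s).
by move=> w; have := rs (enum_rank w); rewrite enum_rankK.
Qed.

End Classes.

Theorem theorem1p3 (R : realType) (d : nat) (q : 'I_d -> nat)
    (hd : (0 < d)%N) (hq : forall j, (0 < q j)%N) :
  let Q := (\prod_(j < d) q j)%N in
  (quotient_set (@X_e d q R) (@floquet_isospectral d q R) #= `I_Q)%card /\
  (@X_e d q R #<= `I_(Q * Q`!))%card.
Proof.
move=> Q; have QE : #|{: cell q}| = Q by apply: card_cell.
split.
  have [v vP] := @fin_all_exists (cell q) (fun=> 'rV[int]_d -> R[i])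
     (fun m V => X_e q V /\ has_section m V) (has_section_exists R hq).
  pose Phi m := @X_e d q R `&` [set Y | floquet_isospectral q (v m) Y].
  have -> : quotient_set (@X_e d q R) (@floquet_isospectral d q R) = Phi @` [set: cell q].
    apply/seteqP; split=> [_ [V XV <-]|_ [m _ <-]]; last first.
      by exists (v m); have [] := vP m.
    have [m Vm] := X_e_has_section hq XV; exists m; first exact: I.
    have [_ vm] := vP m; have Vv := has_section_isospectral hq Vm vm.
    have vV : floquet_isospectral q (v m) V by move=> k; rewrite Vv.
    apply/seteqP; split=> Y [XY VY].
      exact: (conj XY (floquet_isospectral_trans Vv VY)).
    exact: (conj XY (floquet_isospectral_trans vV VY)).
  rewrite -QE; apply: card_eq_trans (card_finType_II _).
  apply: inj_card_eq => m m' _ _ mm'.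
  have [Xm vm] := vP m; have [Xm' vm'] := vP m'.
  have : Phi m (v m) by split.
  rewrite mm' => -[_ iso]; apply/esym.
  exact: (has_section_inj hq vm' vm iso).
apply: card_le_of_injections => N V V_inj VX.
have /fin_all_exists[m mP] := fun i => X_e_has_section hq (VX i).
(* The N potentials are sorted by their sections; each of the Q fibres has at most Q! members. *)
rewrite -[N]card_ord -sum1_card (partition_big m xpredT) //= -QE.
rewrite -sum_nat_const; apply: leq_sum => l _; rewrite sum1_card.
pose B := [pred i : 'I_N | m i == l].
have := @has_section_count R d q hq l #|B| (fun r => V (enum_val r)); apply=> [r s /V_inj|r|r].
- exact: enum_val_inj.
- by have [] := VX (enum_val r).
- by have := mP (enum_val r); have /eqP <- : m (enum_val r) == l by have := enum_valP r.
Qed.
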